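(* If two shares $I_1,I_2$ have isomorphic (colour-preserving) two-coloured intersection graphs, then $I_1$ and $I_2$ are equal as elements of $\mathcal S$; equivalently, $w_{\mathfrak{sl}_2}((I_1,H))=w_{\mathfrak{sl}_2}((I_2,H))$ for every share $H$.
   Context: A chord diagram is an oriented circle with $2n$ distinct points partitioned into $n$ pairs (chords), up to orientation-preserving diffeomorphism; $w_{\mathfrak{sl}_2}(D)=\sum_\varphi x_{\varphi(p_1)}\cdots x_{\varphi(p_{2n})}\in\mathbb C[c]$ where $p_i$ are endpoints in order from a cut point, $\varphi$ runs over maps chords$\to\{1,2,3\}$, $x_1=\tfrac12\begin{pmatrix}0&1\\1&0\end{pmatrix}$, $x_2=\tfrac12\begin{pmatrix}0&-i\\ i&0\end{pmatrix}$, $x_3=\tfrac12\begin{pmatrix}1&0\\0&-1\end{pmatrix}$, $c=x_1^2+x_2^2+x_3^2$. A share consists of two oriented intervals (strand 1, strand 2) and finitely many chords (disjoint pairs of distinct points of their union), up to orientation-preserving diffeomorphisms of each strand; a chord is an arch if both endpoints are on one strand, a bridge otherwise. $A_2$ is the $\mathbb C$-span of shares. The join $(I,H)$ of shares is the chord diagram whose circle reads strand 1 of $I$, strand 1 of $H$, strand 2 of $I$, strand 2 of $H$; $I,I'\in A_2$ are equivalent if $w_{\mathfrak{sl}_2}((I,H))=w_{\mathfrak{sl}_2}((I',H))$ for all shares $H$ (bilinear extension), and $\mathcal S=A_2/\!\sim$. The two-coloured intersection graph of a share has the chords as vertices, arches coloured white and bridges black; two arches are adjacent iff they lie on the same strand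 with alternating endpoints; an arch and a bridge are adjacent iff an endpoint of the bridge lies between the endpoints of the arch; two bridges are adjacent iff their endpoints occur in different relative orders on strand 1 and on strand 2. *)

(* Defs.v *)
From HB Require Import structures.
From mathcomp Require Import all_boot all_order all_algebra.
Set Implicit Arguments. Unset Strict Implicit. Unset Printing Implicit Defensive.
Import Order.TTheory GRing.Theory Num.Theory.
Local Open Scope ring_scope.

(* ---------- Shares ----------
   A share with n chords: chords are labelled by 'I_n; strand 1 (resp. 2)
   is the word of chord labels read along strand 1 (resp. 2) in the
   orientation of the strand.  Every chord has exactly two endpoints in
   the union of the two strands. *)
Record share := Share {
  nch : nat;
  st1 : seq 'I_nch;
  st2 : seq 'I_nch;
  share_ok : [forall c : 'I_nch, count_mem c (st1 ++ st2) == 2%N]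
}.

(* ---------- The sl2 weight system ----------
   x : 'I_3 -> A is a triple satisfying the sl2 relations
   [x_a, x_b] = i x_c for (a,b,c) cyclic; the universal such triple lives in
   U(sl2), and the matrices of the context are one instance. *)
Definition sl2_triple (C : numClosedFieldType) (A : algType C) (x : 'I_3 -> A) :=
  [/\ x 0 * x 1 - x 1 * x 0 = 'i *: x 2,
      x 1 * x 2 - x 2 * x 1 = 'i *: x 0 &
      x 2 * x 0 - x 0 * x 2 = 'i *: x 1].

(* A chord diagram with m chords, cut at a point, is a word s in which each
   chord occurs twice; w is the sum over all maps chords -> {1,2,3} of the
   ordered product of the x's along the word. *)
Definition wsl2 (C : numClosedFieldType) (A : algType C) (x : 'I_3 -> A)
    (m : nat) (s : seq 'I_m) : A :=
  \sum_(phi : {ffun 'I_m -> 'I_3}) \prod_(p <- s) x (phi p).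

(* The join (I,H): the circle reads strand 1 of I, strand 1 of H,
   strand 2 of I, strand 2 of H (cut point at the start of strand 1 of I);
   chords of I are lshift'ed, chords of H rshift'ed. *)
Definition join (I H : share) : seq 'I_(nch I + nch H) :=
  [seq lshift (nch H) c | c <- st1 I] ++ [seq rshift (nch I) c | c <- st1 H] ++
  [seq lshift (nch H) c | c <- st2 I] ++ [seq rshift (nch I) c | c <- st2 H].

Section Graph.
Variable I : share.
Local Notation n := (nch I).

(* arch = both endpoints on one strand; bridge = one endpoint on each. *)
Definition is_arch (c : 'I_n) : bool := count_mem c (st1 I) != 1%N.

Definition arch_on1 (c : 'I_n) : bool := count_mem c (st1 I) == 2%N.
Definition arch_strand (c : 'I_n) : seq 'I_n :=
  if arch_on1 c then st1 I else st2 I.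

Definition fstpos (s : seq 'I_n) (c : 'I_n) : nat := index c s.
Definition lstpos (s : seq 'I_n) (c : 'I_n) : nat := (size s).-1 - index c (rev s).

Definition arch_arch_adj (a b : 'I_n) : bool :=
  let s := arch_strand a in
  let a1 := fstpos s a in let a2 := lstpos s a in
  let b1 := fstpos s b in let b2 := lstpos s b in
  (arch_on1 a == arch_on1 b) &&
  (((a1 < b1) && (b1 < a2) && (a2 < b2)) || ((b1 < a1) && (a1 < b2) && (b2 < a2)))%N.

Definition arch_bridge_adj (a b : 'I_n) : bool :=
  let s := arch_strand a in
  ((fstpos s a < index b s) && (index b s < lstpos s a))%N.

Definition bridge_bridge_adj (b b' : 'I_n) : bool :=
  (index b (st1 I) < index b' (st1 I))%N != (index b (st2 I) < index b' (st2 I))%N.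

Definition adj (u v : 'I_n) : bool :=
  (u != v) &&
  match is_arch u, is_arch v with
  | true, true => arch_arch_adj u v
  | true, false => arch_bridge_adj u v
  | false, true => arch_bridge_adj v u
  | false, false => bridge_bridge_adj u v
  end.
End Graph.
Arguments is_arch : clear implicits.
Arguments adj : clear implicits.

Definition graph_iso (I1 I2 : share) (f : 'I_(nch I1) -> 'I_(nch I2)) : Prop :=
  [/\ bijective f,
      forall u, is_arch I2 (f u) = is_arch I1 u &
      forall u v, adj I2 (f u) (f v) = adj I1 u v].

(* Main.v *)
Require Import Defs.
From mathcomp Require Import all_boot all_order all_algebra.
From mathcomp Require Import zify ring.
From Stdlib Require Import Classical FunctionalExtensionality.
From HB Require Import structures.
Set Implicit Arguments. Unset Strict Implicit. Unset Printing Implicit Defensive.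
Import GRing.Theory.

(* With [c] the Casimir element, every share acts on elements of the algebra as a linear combination
   of the operators [h |-> c^i t_k(h) c^j], where [t_k] is the share of [k] parallel bridges; the
   coefficients do not depend on the algebra. Comparing with the opposite algebra, a share may be
   turned upside down inside a chord diagram (mutation) without changing its value. A share [I] with
   one extra chord separating its two strands is a chord diagram whose intersection graph is
   determined by the two-coloured graph of [I]; so by the expansion of [H] it suffices that the value
   of a chord diagram, with each chord replaced by a bundle of pairwise crossing ones, depends only on
   its intersection graph. This goes by induction on the number of chords.
   - Values of disconnected diagrams multiply.
   - A prime diagram (no share with at least two chords inside and outside) is determined by its graph
     up to rotation and reversal. This is a second induction, on prime diagrams: a splitter argument
     for 4-regular multigraphs gives a chord that can be deleted, up to local complementations, with
     the diagram staying prime, and a chord has a unique place in a prime diagram.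
   - Otherwise there is a split. If it comes from twin or pendant chords, mutations move them next to
     each other in both diagrams. If it is a minimal one, then with one outer chord added it is a prime
     diagram, and rigidity of the latter makes it a split of the other diagram too. Expanding first the
     outer and then the inner share reduces the equality to smaller diagrams. *)

Local Open Scope ring_scope.

(** * Normal form of the action of a share *)

(** At a split no chain of mutations between the two diagrams is constructed; only their values are
    compared. The obstacle is that both diagrams must be cut along the same set of chords, whereas a
    cut is read off from the word and not from the graph. The graph remembers a split only as a
    block of crossings of rank one, and rigidity of a smaller prime diagram is what turns this block
    back into a cut of the other word. Multigraphs enter because a chord diagram, read along its
    circle, is an Euler circuit of a 4-regular multigraph with the chords as vertices. Reversing an
    arc between the two ends of a chord gives another circuit of the same multigraph, so primeness,
    a condition on cuts, survives, while the intersection graph undergoes local complementation.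
    Each of the three splittings of a vertex is a deletion after suitable reversals. What is
    particular to sl2 is that two contracted epsilon tensors become Kronecker deltas, which keeps
    the number of trivalent vertices at most one during the reduction to normal form. *)

Definition upd (T : eqType) (phi : T -> 'I_3) z a :=
  fun y => if y == z then a else phi y.

Section NestedSum.
Variable T : eqType.

Lemma updC (phi : T -> 'I_3) y z a b :
  y != z -> upd (upd phi y a) z b = upd (upd phi z b) y a.
Proof.
move=> nyz; apply: functional_extensionality => t; rewrite /upd.
by case: (t =P z) => [->|//]; case: (z =P y) => [E|//]; rewrite E eqxx in nyz.
Qed.

Lemma upd_eq (phi : T -> 'I_3) z a : upd phi z a z = a.
Proof. by rewrite /upd eqxx. Qed.

Lemma upd_neq (phi : T -> 'I_3) z a y : y != z -> upd phi z a y = phi y.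
Proof. by rewrite /upd => /negbTE ->. Qed.

Variable V : zmodType.
Implicit Types (F G : (T -> 'I_3) -> V).

(** Summation letter by letter over a list asks for no finiteness of [T] and lets one chord at a
    time be taken out of the sum; [phi] supplies the values of the letters outside [ps]. *)
Fixpoint nsum (ps : seq T) F phi : V :=
  if ps is z :: ps' then \sum_(a < 3) nsum ps' F (upd phi z a) else F phi.

Lemma nsum_cat ps qs F phi : nsum (ps ++ qs) F phi = nsum ps (nsum qs F) phi.
Proof.
by elim: ps phi => //= z ps IH phi; apply: eq_bigr => a _; rewrite IH.
Qed.

Lemma eq_nsum ps F G phi : (forall psi, F psi = G psi) -> nsum ps F phi = nsum ps G phi.
Proof.
by move=> FG; elim: ps phi => //= z ps IH phi; apply: eq_bigr => a _; rewrite IH.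
Qed.

Lemma nsum_swap y z ps F phi :
  nsum (y :: z :: ps) F phi = nsum (z :: y :: ps) F phi.
Proof.
have [->//|nyz] := eqVneq y z.
rewrite /= exchange_big /=; apply: eq_bigr => a _; apply: eq_bigr => b _.
by rewrite updC.
Qed.

Lemma nsum_perm ps qs F phi : perm_eq ps qs -> nsum ps F phi = nsum qs F phi.
Proof.
have mv z l1 l2 psi : nsum (z :: l1 ++ l2) F psi = nsum (l1 ++ z :: l2) F psi.
  elim: l1 psi => // y l1 IH psi; rewrite cat_cons nsum_swap cat_cons.
  by apply: eq_bigr => a _; apply: IH.
elim: ps qs phi => [|z ps IH] qs phi pq.
  by rewrite perm_sym in pq; rewrite (perm_nilP pq).
have zq: z \in qs by rewrite -(perm_mem pq) mem_head.
case/splitPr: zq pq => q1 q2 pq.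
have /IH E: perm_eq ps (q1 ++ q2).
  by move: pq; rewrite -[q1 ++ _ :: _]/(q1 ++ [:: z] ++ q2) perm_sym perm_catCA perm_cons perm_sym.
by rewrite -mv /=; apply: eq_bigr => a _.
Qed.

Lemma nsumD ps F G phi :
  nsum ps (fun f => F f + G f) phi = nsum ps F phi + nsum ps G phi.
Proof.
elim: ps phi => //= z ps IH phi; rewrite -big_split.
by apply: eq_bigr => a _; rewrite IH.
Qed.

Lemma nsum_sum (I : finType) ps (F : I -> (T -> 'I_3) -> V) phi :
  nsum ps (fun f => \sum_i F i f) phi = \sum_i nsum ps (F i) phi.
Proof.
elim: ps phi => //= z ps IH phi; rewrite exchange_big.
by apply: eq_bigr => a _; rewrite IH.
Qed.

Lemma nsum_seq (I : Type) (r : seq I) ps (F : I -> (T -> 'I_3) -> V) phi :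
  nsum ps (fun f => \sum_(i <- r) F i f) phi = \sum_(i <- r) nsum ps (F i) phi.
Proof.
elim: ps phi => //= z ps IH phi; rewrite exchange_big.
by apply: eq_bigr => a _; rewrite IH.
Qed.

End NestedSum.

Lemma mulr_nsumr (T : eqType) (R : nzRingType) (c : R) ps (F : (T -> 'I_3) -> R) phi :
  c * nsum ps F phi = nsum ps (fun psi => c * F psi) phi.
Proof.
elim: ps phi => //= z ps IH phi; rewrite mulr_sumr.
by apply: eq_bigr => a _; rewrite IH.
Qed.

Lemma mulr_nsuml (T : eqType) (R : nzRingType) (c : R) ps (F : (T -> 'I_3) -> R) phi :
  nsum ps F phi * c = nsum ps (fun psi => F psi * c) phi.
Proof.
elim: ps phi => //= z ps IH phi; rewrite mulr_suml.
by apply: eq_bigr => a _; rewrite IH.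
Qed.

Lemma scaler_nsum (T : eqType) (R : nzRingType) (W : lmodType R) (c : R) ps
  (F : (T -> 'I_3) -> W) phi :
  c *: nsum ps F phi = nsum ps (fun psi => c *: F psi) phi.
Proof.
elim: ps phi => //= z ps IH phi; rewrite scaler_sumr.
by apply: eq_bigr => a _; rewrite IH.
Qed.

Lemma nsum_map (T T' : eqType) (V : zmodType) (f : T -> T') (L ps : seq T)
    (G : (T -> 'I_3) -> V) (F : (T' -> 'I_3) -> V) phi phi' :
  {in L &, injective f} -> {subset ps <= L} ->
  (forall psi psi', {in L, forall p, psi p = psi' (f p)} -> G psi = F psi') ->
  {in L, forall p, p \notin ps -> phi p = phi' (f p)} ->
  nsum ps G phi = nsum (map f ps) F phi'.
Proof.
move=> fi + GF; elim: ps phi phi' => [|z ps IH] phi phi' sL E /=.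
  by apply: GF => p pL; apply: E.
apply: eq_bigr => a _; apply: IH => [p pp|p pL pps].
  by apply: sL; rewrite inE pp orbT.
rewrite /upd; have [->|npz] := eqVneq p z; first by rewrite eqxx.
rewrite (inj_in_eq fi pL) ?sL ?mem_head // (negbTE npz).
by apply: E => //; rewrite inE negb_or npz.
Qed.

(** * The epsilon tensor and the Casimir element *)

Section Eps.
Variable C : comNzRingType.

(** The Levi-Civita symbol, with indices added modulo 3: the structure constants of sl2 up to the
    factor ['i]. *)
Definition eps (a b c : 'I_3) : C :=
  ((b == a + 1) && (c == a + 2))%:R - ((b == a + 2) && (c == a + 1))%:R.

Lemma ord3_cases (a : 'I_3) : [\/ a = 0, a = 1 | a = 2].
Proof.
case: a => [[|[|[|//]]] H]; [constructor 1|constructor 2|constructor 3]; exact: val_inj.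
Qed.

Lemma epsC12 a b c : eps b a c = - eps a b c.
Proof.
by case: (ord3_cases a) => ->; case: (ord3_cases b) => ->; case: (ord3_cases c) => ->;
  rewrite /eps /=; ring.
Qed.

Lemma eps_rot a b c : eps b c a = eps a b c.
Proof.
by case: (ord3_cases a) => ->; case: (ord3_cases b) => ->; case: (ord3_cases c) => ->;
  rewrite /eps /=; ring.
Qed.

(** Two vertices joined by an edge become a difference of two identifications of their free legs, so
    vertices never accumulate. *)
Lemma eps_contract b c q r :
  \sum_(a < 3) eps a b c * eps a q r =
  (b == q)%:R * (c == r)%:R - (b == r)%:R * (c == q)%:R.
Proof.
rewrite !big_ord_recl big_ord0.
by case: (ord3_cases b) => ->; case: (ord3_cases c) => ->;
  case: (ord3_cases q) => ->; case: (ord3_cases r) => ->; rewrite /eps /=; ring.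
Qed.

End Eps.

Section Sl2.
Variables (C : numClosedFieldType) (A : algType C) (x : 'I_3 -> A).
Hypothesis xsl2 : sl2_triple x.

Definition cas : A := \sum_(a < 3) x a * x a.

Lemma sum3 (V : zmodType) (F : 'I_3 -> V) : \sum_(a < 3) F a = F 0 + F 1 + F 2.
Proof.
rewrite !big_ord_recl big_ord0 addr0 addrA.
by congr (F _ + F _ + F _); apply: val_inj.
Qed.

Lemma sl2_comm a b :
  x a * x b = x b * x a + 'i *: \sum_(r < 3) eps C a b r *: x r.
Proof.
case: xsl2 => h01 h12 h20; apply/eqP; rewrite addrC -subr_eq; apply/eqP.
case: (ord3_cases a) => ->; case: (ord3_cases b) => ->;
  rewrite sum3 /eps /= ?subrr ?subr0 ?sub0r ?scale0r ?scale1r ?scaleN1r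
   ?addr0 ?add0r ?scaler0 ?scalerN //.
- by rewrite -h20 opprB.
- by rewrite -h01 opprB.
- by rewrite -h12 opprB.
Qed.

Lemma eps_xx c :
  \sum_(a < 3) \sum_(b < 3) eps C a b c *: (x a * x b) = 'i *: x c.
Proof.
case: xsl2 => h01 h12 h20; rewrite !sum3.
case: (ord3_cases c) => ->; rewrite -?h01 -?h12 -?h20 /eps /=
 ?subrr ?subr0 ?sub0r ?scale0r ?scale1r ?scaleN1r ?addr0 ?add0r //.
by rewrite addrC.
Qed.

(** Moving [x b] past both factors of each square leaves [eps C a b r] summed against
    [x r * x a + x a * x r], an antisymmetric tensor against a symmetric one. *)
Lemma cas_comm b : cas * x b = x b * cas.
Proof.
rewrite /cas mulr_suml mulr_sumr.
have E a : x a * x a * x b = x b * (x a * x a) +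
   'i *: (\sum_r eps C a b r *: (x r * x a) + \sum_r eps C a b r *: (x a * x r)).
  rewrite -mulrA sl2_comm mulrDr mulrA sl2_comm mulrDl -!mulrA -addrA; congr (_ + _).
  rewrite scalerDr -scalerAl -scalerAr mulr_suml mulr_sumr.
  have -> : \sum_r eps C a b r *: x r * x a = \sum_r eps C a b r *: (x r * x a).
    by apply: eq_bigr => r _; rewrite scalerAl.
  have -> // : \sum_r x a * (eps C a b r *: x r) = \sum_r eps C a b r *: (x a * x r).
  by apply: eq_bigr => r _; rewrite scalerAr.
rewrite (eq_bigr _ (fun a _ => E a)) big_split /= -[RHS]addr0; congr (_ + _).
rewrite -scaler_sumr big_split /= exchange_big /= -big_split /=.
rewrite big1 ?scaler0 // => a _; rewrite -big_split big1 // => r _ /=.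
by rewrite -scalerDl -[eps C a b r]eps_rot -[eps C r b a]eps_rot eps_rot epsC12 -eps_rot addNr scale0r.
Qed.

End Sl2.

(** * Words with at most one trivalent vertex and their relations *)

Section Words.
Variables (C : numClosedFieldType) (T : eqType).
Implicit Types (s : seq (option T)) (ps : seq T).

Definition xw (A : algType C) (x : 'I_3 -> A) (h : A) s (phi : T -> 'I_3) : A :=
  \prod_(p <- s) oapp (fun q => x (phi q)) h p.

Definition rep (b q : T) (p : option T) : option T := if p == Some b then Some q else p.

(* [None] marks the slot of the argument [h]: a share acts on elements of the algebra by
   inserting [h] between its strands. *)
Definition op ps s (A : algType C) (x : 'I_3 -> A) (h : A) : A :=
  nsum ps (xw x h s) (fun=> ord0).

(* Commuting two neighbouring letters leaves a trivalent vertex, the tensor [eps] on three letters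
   that each occur once. *)
Definition op1 u v w ps s (A : algType C) (x : 'I_3 -> A) (h : A) : A :=
  nsum [:: u, v, w & ps]
    (fun phi => eps C (phi u) (phi v) (phi w) *: xw x h s phi) (fun=> ord0).

Section Alg.
Variables (A : algType C) (x : 'I_3 -> A) (h : A).

Lemma xw_cat s1 s2 phi : xw x h (s1 ++ s2) phi = xw x h s1 phi * xw x h s2 phi.
Proof. exact: big_cat. Qed.

Lemma xw_cons p s phi : xw x h (p :: s) phi = oapp (fun q => x (phi q)) h p * xw x h s phi.
Proof. exact: big_cons. Qed.

Lemma xw_upd p s phi a : Some p \notin s -> xw x h s (upd phi p a) = xw x h s phi.
Proof.
move=> ps; apply: eq_big_seq => -[q|//] qs /=; rewrite upd_neq //.
by apply: contraNneq ps => <-.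
Qed.

Lemma xw_rep b q s phi : xw x h s (upd phi b (phi q)) = xw x h (map (rep b q) s) phi.
Proof.
rewrite /xw big_map; apply: eq_bigr => -[p|] _ //=; rewrite /rep /upd.
by rewrite -[Some p == Some b]/(p == b); case: eqP.
Qed.

Lemma nsum_delta b q ps (G : (T -> 'I_3) -> A) phi :
  b \notin ps -> b != q ->
  nsum (b :: ps) (fun f => (f b == f q)%:R *: G f) phi =
  nsum ps (fun f => G (upd f b (f q))) phi.
Proof.
move=> bps nbq; have nqb: q != b by rewrite eq_sym.
rewrite -(cat1s b) (nsum_perm _ _ (permEl (perm_catC _ _))) nsum_cat.
apply: eq_nsum => psi /=; rewrite (bigD1 (psi q)) //= upd_eq upd_neq //.
rewrite eqxx scale1r big1 ?addr0 // => a na; rewrite upd_eq upd_neq //.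
by rewrite (negbTE na) scale0r.
Qed.

Hypothesis xsl2 : sl2_triple x.

(** By [eps_xx] two adjacent legs contract to the third one: the vertex turns into a chord [c],
    whose second end is placed here. *)
Lemma op1_merge a b c ps s1 s2 :
  a != b -> a != c -> b != c ->
  Some a \notin s1 ++ s2 -> Some b \notin s1 ++ s2 ->
  op1 a b c ps (s1 ++ Some a :: Some b :: s2) x h =
  'i *: op (c :: ps) (s1 ++ Some c :: s2) x h.
Proof.
move=> nab nac nbc.
have nba : b != a by rewrite eq_sym.
have nca : c != a by rewrite eq_sym.
have ncb : c != b by rewrite eq_sym.
rewrite !mem_cat !negb_or => /andP[a1 a2] /andP[b1 b2].
rewrite /op1 -(cat1s a) -(cat1s b) catA (nsum_perm _ _ (permEl (perm_catC _ _))) nsum_cat.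
rewrite /op scaler_nsum; apply: eq_nsum => psi /=.
transitivity (xw x h s1 psi * (\sum_(i < 3) \sum_(j < 3) eps C i j (psi c) *: (x i * x j))
   * xw x h s2 psi).
  rewrite mulr_sumr mulr_suml; apply: eq_bigr => i _.
  rewrite mulr_sumr mulr_suml; apply: eq_bigr => j _.
  rewrite upd_neq // upd_eq upd_eq !upd_neq //.
  rewrite xw_cat !xw_cons /= upd_eq upd_neq // upd_eq !xw_upd //.
  by rewrite -scalerAr -scalerAl !mulrA.
by rewrite eps_xx // xw_cat xw_cons /= -scalerAr -scalerAl mulrA.
Qed.

(** The commutator creates a second vertex, joined to the first by [a]. After [eps_contract] one
    Kronecker delta identifies [q] with [b] and the other identifies [q] with [c], hence the two
    renamings. *)
Lemma op1_swap a b c q ps s1 s2 :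
  uniq [:: a, b, c & ps] -> q \in ps -> Some a \notin s1 ++ s2 ->
  op1 a b c ps (s1 ++ Some a :: Some q :: s2) x h =
  op1 a b c ps (s1 ++ Some q :: Some a :: s2) x h +
  'i *: (op (c :: ps) (map (rep b q) (s1 ++ Some c :: s2)) x h -
         op (b :: ps) (map (rep c q) (s1 ++ Some b :: s2)) x h).
Proof.
move=> /= /and4P[]; rewrite !inE !negb_or => /and3P[nab nac aps] /andP[nbc bps] cps _ qps.
have nba : b != a by rewrite eq_sym.
have nca : c != a by rewrite eq_sym.
have ncb : c != b by rewrite eq_sym.
rewrite mem_cat negb_or => /andP[a1 a2].
have naq : a != q by apply: contraNneq aps => ->.
have nbq : b != q by apply: contraNneq bps => ->.
have ncq : c != q by apply: contraNneq cps => ->.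
have nqa : q != a by rewrite eq_sym.
have nqb : q != b by rewrite eq_sym.
have nqc : q != c by rewrite eq_sym.
pose W r f := xw x h s1 f * (x r * xw x h s2 f).
have E f : eps C (f a) (f b) (f c) *: xw x h (s1 ++ Some a :: Some q :: s2) f =
   eps C (f a) (f b) (f c) *: xw x h (s1 ++ Some q :: Some a :: s2) f +
   'i *: \sum_(r < 3) (eps C (f a) (f b) (f c) * eps C (f a) (f q) r) *: W r f.
  rewrite !xw_cat !xw_cons /= ![x (f _) * (x (f _) * _)]mulrA sl2_comm //.
  rewrite mulrDl mulrDr scalerDr; congr (_ + _).
  rewrite -scalerAl -scalerAr [LHS]scalerA mulrC -scalerA; congr (_ *: _).
  rewrite mulr_suml mulr_sumr scaler_sumr; apply: eq_bigr => r _.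
  by rewrite -scalerAl -scalerAr scalerA.
rewrite /op1 (eq_nsum _ _ E) nsumD; congr (_ + _); rewrite -scaler_nsum; congr (_ *: _).
rewrite -(cat1s a) (nsum_perm _ _ (permEl (perm_catC _ _))) nsum_cat.
have E2 f : nsum [:: a] (fun f => \sum_(r < 3) (eps C (f a) (f b) (f c) * eps C (f a) (f q) r) *: W r f) f
   = (f b == f q)%:R *: W (f c) f + (-1) *: ((f c == f q)%:R *: W (f b) f).
  rewrite /= exchange_big /=.
  transitivity (\sum_(r < 3) ((f b == f q)%:R * (f c == r)%:R -
     (f b == r)%:R * (f c == f q)%:R) *: W r f).
    apply: eq_bigr => r _; rewrite -eps_contract scaler_suml; apply: eq_bigr => i _.
    by rewrite upd_eq !upd_neq // /W !xw_upd.
  transitivity (\sum_(r < 3) ((f c == r)%:R *: ((f b == f q)%:R *: W r f)) -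
      \sum_(r < 3) ((f b == r)%:R *: ((f c == f q)%:R *: W r f))).
    rewrite -sumrB; apply: eq_bigr => r _.
    by rewrite scalerBl -!scalerA scalerA mulrC -scalerA.
  have D (i : 'I_3) (F : 'I_3 -> A) : \sum_(r < 3) (i == r)%:R *: F r = F i.
    rewrite (bigD1 i) //= eqxx scale1r big1 ?addr0 // => r nr.
    by rewrite eq_sym (negbTE nr) scale0r.
  by rewrite !D scaleN1r.
rewrite (eq_nsum _ _ E2) nsumD -scaler_nsum scaleN1r; congr (_ - _).
  rewrite nsum_delta // ?inE ?negb_or ?nbc //; apply: eq_nsum => f.
  rewrite -xw_rep xw_cat xw_cons /W /= [_ c]upd_neq //.
rewrite (nsum_perm (qs := [:: c, b & ps])) ?nsum_delta //.
- apply: eq_nsum => f; rewrite -xw_rep xw_cat xw_cons /W /= [_ b]upd_neq //.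
- by rewrite inE negb_or eq_sym nbc.
- by rewrite -(cat1s b) -(cat1s c) -(cat1s c (b :: ps)) -(cat1s b ps) perm_catCA.
Qed.

(** Exchanging neighbouring ends of two chords costs a vertex: [p] and [q] now name the two
    remaining ends, and [r] stands in the place of the exchanged letters. *)
Lemma op_swap p q r ps s1 s2 :
  uniq [:: r, p, q & ps] -> Some r \notin s1 ++ s2 ->
  op [:: p, q & ps] (s1 ++ Some p :: Some q :: s2) x h =
  op [:: p, q & ps] (s1 ++ Some q :: Some p :: s2) x h +
  'i *: op1 p q r ps (s1 ++ Some r :: s2) x h.
Proof.
move=> /= /and4P[]; rewrite !inE !negb_or => /and3P[nrp nrq rps] _ _ _.
have npr : p != r by rewrite eq_sym.
have nqr : q != r by rewrite eq_sym.
rewrite mem_cat negb_or => /andP[r1 r2].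
have -> : op1 p q r ps (s1 ++ Some r :: s2) x h =
   nsum ([:: p, q & ps] ++ [:: r])
    (fun phi => eps C (phi p) (phi q) (phi r) *: xw x h (s1 ++ Some r :: s2) phi)
    (fun=> ord0).
  apply: nsum_perm; rewrite !perm_cons -(cat1s r) perm_sym.
  by rewrite (perm_catC ps) perm_refl.
rewrite nsum_cat scaler_nsum -nsumD; apply: eq_nsum => f /=.
rewrite !xw_cat !xw_cons /= ![x (f _) * (x (f _) * _)]mulrA sl2_comm //.
rewrite mulrDl mulrDr; congr (_ + _).
rewrite -scalerAl -scalerAr; congr (_ *: _).
rewrite mulr_suml mulr_sumr; apply: eq_bigr => i _.
rewrite upd_eq !upd_neq // xw_cat xw_cons /= upd_eq !xw_upd //.
by rewrite -scalerAl -scalerAr.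
Qed.

Lemma op_arch p ps s1 s2 : p \notin ps -> Some p \notin s1 ++ s2 ->
  op (p :: ps) (s1 ++ Some p :: Some p :: s2) x h =
  nsum ps (fun f => xw x h s1 f * (cas x * xw x h s2 f)) (fun=> ord0).
Proof.
move=> pps; rewrite mem_cat negb_or => /andP[p1 p2].
rewrite /op -(cat1s p) (nsum_perm _ _ (permEl (perm_catC _ _))) nsum_cat.
apply: eq_nsum => f /=; rewrite mulr_suml mulr_sumr; apply: eq_bigr => a _.
by rewrite xw_cat !xw_cons /= upd_eq !xw_upd // !mulrA.
Qed.

End Alg.
End Words.

Ltac genlia :=
  repeat match goal with |- context [nat_of_bool ?b] => move: (nat_of_bool b) => ? end;
  repeat match goal with |- context [count ?p ?s] => move: (count p s) => ? end;
  clear; lia.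

Lemma count_comp (T U : Type) (f : T -> U) (P : pred U) s :
  count P (map f s) = count (P \o f) s.
Proof. exact: count_map. Qed.

(** * Reduction of a share to parallel bridges *)

Section NormalForm.
Variable C : numClosedFieldType.

(* [k] parallel bridges. *)
Fixpoint tk (A : algType C) (x : 'I_3 -> A) k h : A :=
  if k is k'.+1 then \sum_(a < 3) x a * tk x k' (h * x a) else h.

Definition nf_term (A : algType C) (x : 'I_3 -> A) h (q : C * (nat * nat * nat)) : A :=
  q.1 *: (cas x ^+ q.2.1.1 * tk x q.2.2 h * cas x ^+ q.2.1.2).

Definition nf (F : forall A : algType C, ('I_3 -> A) -> A -> A) : Prop :=
  exists l : seq (C * (nat * nat * nat)),
  forall (A : algType C) (x : 'I_3 -> A) h, sl2_triple x ->
  F A x h = \sum_(q <- l) nf_term x h q.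

Lemma eq_nf (F G : forall A : algType C, ('I_3 -> A) -> A -> A) :
  (forall (A : algType C) (x : 'I_3 -> A) h, sl2_triple x -> G A x h = F A x h) ->
  nf F -> nf G.
Proof. by move=> FG [l Hl]; exists l => A x h sx; rewrite FG ?Hl. Qed.

Lemma nf_tk k : nf (fun A x h => tk x k h).
Proof.
by exists [:: (1, (0, 0, k))]; move=> A x h _; rewrite big_seq1 /nf_term /= mul1r mulr1 scale1r.
Qed.

Lemma nfZD a (F G : forall A : algType C, ('I_3 -> A) -> A -> A) :
  nf F -> nf G -> nf (fun A x h => F A x h + a *: G A x h).
Proof.
move=> [l Hl] [l' Hl']; exists (l ++ [seq (a * q.1, q.2) | q <- l']) => A x h sx.
rewrite big_cat big_map Hl // Hl' // scaler_sumr; congr (_ + _).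
by apply: eq_bigr => q _; rewrite /nf_term scalerA.
Qed.

Lemma nfZ a (F : forall A : algType C, ('I_3 -> A) -> A -> A) :
  nf F -> nf (fun A x h => a *: F A x h).
Proof.
move=> [l Hl]; exists ([seq (a * q.1, q.2) | q <- l]) => A x h sx.
rewrite big_map Hl // scaler_sumr.
by apply: eq_bigr => q _; rewrite /nf_term scalerA.
Qed.

Lemma nf_casl (F : forall A : algType C, ('I_3 -> A) -> A -> A) :
  nf F -> nf (fun A x h => cas x * F A x h).
Proof.
move=> [l Hl]; exists ([seq (q.1, (q.2.1.1.+1, q.2.1.2, q.2.2)) | q <- l]) => A x h sx.
rewrite big_map Hl // mulr_sumr; apply: eq_bigr => q _.
by rewrite /nf_term /= -scalerAr exprS !mulrA.
Qed.

Lemma nf_casr (F : forall A : algType C, ('I_3 -> A) -> A -> A) :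
  nf F -> nf (fun A x h => F A x h * cas x).
Proof.
move=> [l Hl]; exists ([seq (q.1, (q.2.1.1, q.2.1.2.+1, q.2.2)) | q <- l]) => A x h sx.
rewrite big_map Hl // mulr_suml; apply: eq_bigr => q _.
by rewrite /nf_term /= -scalerAl exprSr !mulrA.
Qed.

(** Letters are natural numbers here, so that a fresh one is always at hand for a new leg. *)
Definition cl2 (ps : seq nat) s := uniq ps && perm_eq s (None :: map Some (ps ++ ps)).
Definition cl3 u v w (ps : seq nat) s :=
  uniq [:: u, v, w & ps] && perm_eq s (None :: map Some ([:: u, v, w & ps] ++ ps)).

Lemma count_Some (P : pred (option nat)) (ps : seq nat) :
  count P (map Some ps) = count (fun p : nat => P (Some p)) ps.
Proof. exact: count_map. Qed.

Lemma count_None (P : pred (option nat)) (ps : seq nat) :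
  count P (None :: map Some (ps ++ ps)) = (P None + 2 * count (fun p : nat => P (Some p)) ps)%N.
Proof. by rewrite map_cat /= count_cat count_Some; lia. Qed.

Section Step.
Variable n : nat.
(** A vertex together with [n] chords resolves into diagrams with [n.+1] chords, hence the shift. *)
Hypothesis K0 : forall ps s, size ps = n.+1 -> cl2 ps s -> nf (op ps s).

Lemma cl3_count u v w ps s (P : pred (option nat)) : cl3 u v w ps s ->
  count P s = (P None + P (Some u) + P (Some v) + P (Some w) + 2 * count (fun p : nat => P (Some p)) ps)%N.
Proof.
move=> /andP[_ /permP->]; rewrite /= map_cat count_cat count_Some; lia.
Qed.

Lemma op1C12 (u v w : nat) ps s (A : algType C) (x : 'I_3 -> A) h :
  op1 v u w ps s x h = (-1) *: op1 u v w ps s x h.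
Proof.
rewrite /op1 scaler_nsum (nsum_perm (qs := [:: u, v, w & ps])).
  by apply: eq_nsum => f; rewrite scaleN1r -scaleNr -epsC12.
by apply/permP => P /=; genlia.
Qed.

Lemma op1_rot (u v w : nat) ps s (A : algType C) (x : 'I_3 -> A) h :
  op1 v w u ps s x h = op1 u v w ps s x h.
Proof.
rewrite /op1 (nsum_perm (qs := [:: u, v, w & ps])).
  by apply: eq_nsum => f; rewrite eps_rot.
by apply/permP => P /=; genlia.
Qed.

Lemma cl3C12 u v w ps s : cl3 u v w ps s = cl3 v u w ps s.
Proof.
have E l : perm_eq [:: u, v, w & l] [:: v, u, w & l].
  by apply/permP => P /=; genlia.
rewrite /cl3 (perm_uniq (E ps)); congr (_ && _); apply: permPr.
by rewrite perm_cons; apply: perm_map; apply: E.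
Qed.

Lemma cl3_rot u v w ps s : cl3 u v w ps s = cl3 v w u ps s.
Proof.
have E l : perm_eq [:: u, v, w & l] [:: v, w, u & l].
  by apply/permP => P /=; genlia.
rewrite /cl3 (perm_uniq (E ps)); congr (_ && _); apply: permPr.
by rewrite perm_cons; apply: perm_map; apply: E.
Qed.

(* Two legs of a trivalent vertex on the same strand are moved next to each other, where they merge
   by [eps_xx]; every letter passed on the way creates a second vertex, contracted with the first. *)
Lemma K1_near b ps : forall be a c s1 s2, size ps = n ->
  None \notin be ->
  cl3 a b c ps (s1 ++ Some a :: be ++ Some b :: s2) ->
  nf (op1 a b c ps (s1 ++ Some a :: be ++ Some b :: s2)).
Proof.
move=> be; elim: be => [|q be IH] a c s1 s2 sps nbe cl.
  have := cl => /andP[/= /and4P[]]; rewrite !inE !negb_or => /and3P[nab nac aps] /andP[nbc bps] cps ups _.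
  have ca := cl3_count (pred1 (Some a)) cl.
  have cb := cl3_count (pred1 (Some b)) cl.
  have Za : count (pred1 a) ps = 0%N by apply/count_memPn.
  have Zb : count (pred1 b) ps = 0%N by apply/count_memPn.
  have xo (u v : nat) : (Some u == Some v) = (u == v) by [].
  rewrite /= count_cat /= !xo eqxx ![_ == a]eq_sym (negbTE nab) (negbTE nac) in ca.
  rewrite /= count_cat /= !xo eqxx (negbTE nab) [c == b]eq_sym (negbTE nbc) in cb.
  have a0 : Some a \notin s1 ++ s2.
    by apply/count_memPn; rewrite count_cat; move: ca; rewrite (eq_count (a2 := pred1 a)) // Za /=; lia.
  have b0 : Some b \notin s1 ++ s2.
    by apply/count_memPn; rewrite count_cat; move: cb; rewrite (eq_count (a2 := pred1 b)) // Zb /=; lia.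
  apply: (eq_nf (F := fun A x h => 'i *: op (c :: ps) (s1 ++ Some c :: s2) x h)).
    by move=> A x h sx; rewrite op1_merge.
  apply/nfZ/K0; first by rewrite /= sps.
  rewrite /cl2 /= cps ups /=; apply/permP => P; have := cl3_count P cl.
  rewrite -[None :: _]/(None :: map Some ((c :: ps) ++ (c :: ps))) count_None !count_cat /=; genlia.
case: q nbe cl => [q|//] nbe cl; have {}nbe : None \notin be by move: nbe; rewrite inE negb_or => /andP[].
have := cl => /andP[U _]; have := U => /= /and4P[]; rewrite !inE !negb_or => /and3P[nab nac aps] /andP[nbc bps] cps ups.
have nba : b != a by rewrite eq_sym.
have nca : c != a by rewrite eq_sym.
have ncb : c != b by rewrite eq_sym.
have xo (u v : nat) : (Some u == Some v) = (u == v) by [].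
have a0 : Some a \notin s1 ++ Some q :: be ++ Some b :: s2.
  apply/count_memPn; have := cl3_count (pred1 (Some a)) cl.
  have Za : count (pred1 a) ps = 0%N by apply/count_memPn.
  rewrite (eq_count (a2 := pred1 a)) // Za !count_cat /= !xo count_cat /= !xo (negbTE nba) (negbTE nca) eqxx /=; lia.
have naq : q != a by move: a0; rewrite mem_cat inE !negb_or xo eq_sym => /and3P[].
have a1 : Some a \notin s1 ++ be ++ Some b :: s2.
  by move: a0; rewrite !(mem_cat, inE) !negb_or => /and5P[-> _ -> -> ->].
(* The letter to be passed may be the third leg; then [a] and [c] are adjacent and merge at once,
   with the sign of the transposed vertex. *)
have [qc|nqc] := eqVneq q c.
  subst q.
  apply: (eq_nf (F := fun A x h => (-1) *: ('i *: op (b :: ps) (s1 ++ Some b :: be ++ Some b :: s2) x h))).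
    move=> A x h sx.
    have c0 : Some c \notin s1 ++ be ++ Some b :: s2.
      apply/count_memPn; have := cl3_count (pred1 (Some c)) cl.
      have Zc : count (pred1 c) ps = 0%N by apply/count_memPn.
      rewrite (eq_count (a2 := pred1 c)) // Zc !count_cat /= !xo count_cat /= !xo.
      by rewrite eqxx (eq_sym a) (negbTE nca) (eq_sym b) (negbTE ncb) /=; lia.
    by rewrite -op1_rot op1C12 -op1_rot -[op1 _ _ _ _ _ _ _]op1_rot op1_merge.
  apply/nfZ/nfZ/K0; first by rewrite /= sps.
  rewrite /cl2 /= bps ups /=; apply/permP => P; have := cl3_count P cl.
  rewrite -[None :: _]/(None :: map Some ((b :: ps) ++ (b :: ps))) count_None !count_cat /= !count_cat /=; genlia.
have qps : q \in ps.
  have : Some q \in s1 ++ Some a :: (Some q :: be) ++ Some b :: s2.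
    by rewrite mem_cat inE mem_cat mem_head !orbT.
  have nqb : q != b.
    apply/eqP => qb; subst q; have := cl3_count (pred1 (Some b)) cl.
    have Zb : count (pred1 b) ps = 0%N by apply/count_memPn.
    rewrite (eq_count (a2 := pred1 b)) // Zb !count_cat /= !xo count_cat /= !xo eqxx.
    by rewrite (negbTE ncb) (negbTE nab) /=; lia.
  move: cl => /andP[_ /perm_mem ->]; rewrite in_cons mem_map; last by move=> ? ? [].
  by rewrite orFb mem_cat !inE (negbTE naq) (negbTE nqb) (negbTE nqc) /= orbb.
apply: (eq_nf (F := fun A x h => op1 a b c ps ((s1 ++ [:: Some q]) ++ Some a :: be ++ Some b :: s2) x h +
    'i *: (op (c :: ps) (map (rep b q) (s1 ++ Some c :: be ++ Some b :: s2)) x h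
       + (-1) *: op (b :: ps) (map (rep c q) (s1 ++ Some b :: be ++ Some b :: s2)) x h))).
  by move=> A x h sx; rewrite /= scaleN1r -catA op1_swap.
apply: nfZD.
  apply: IH => //; move: cl; rewrite /cl3 -catA /= => /andP[-> cl] /=.
  by apply: perm_trans cl; rewrite perm_cat2l; apply/permP => P /=; genlia.
have naq' : a != q by rewrite eq_sym.
have Pr (u v : nat) (P : pred (option nat)) : u != q -> v \notin ps -> v != q -> v != u ->
   [/\ P (rep v q None) = P None, P (rep v q (Some u)) = P (Some u),
     P (rep v q (Some v)) = P (Some q), P (rep v q (Some q)) = P (Some q) &
    count (fun p : nat => P (rep v q (Some p))) ps = count (fun p : nat => P (Some p)) ps].
  move=> nuq vps nvq nvu; rewrite /rep /= !xo eqxx (eq_sym q) (negbTE nvq) (eq_sym u) (negbTE nvu).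
  split => //; apply: eq_in_count => p pp; rewrite xo; case: eqP => // E.
  by rewrite -E pp in vps.
have nqb : b != q by apply: contraNneq bps => ->.
have ncq : c != q by rewrite eq_sym.
apply: nfZD; apply: K0; rewrite /= ?sps //; rewrite /cl2 /= ?cps ?bps ?ups /=; apply/permP => P.
- have [p1 p2 p3 p4 p5] := Pr c b P ncq bps nqb nbc.
  have [p1' p2' p3' p4' p5'] := Pr a b P naq' bps nqb nba.
  have := cl3_count (P \o rep b q) cl; rewrite count_comp.
  rewrite -[None :: _]/(None :: map Some ((c :: ps) ++ (c :: ps))) count_None !count_cat /= !count_cat /=.
  rewrite p1 p2 p3 p4 p2' p5; genlia.
- have [p1 p2 p3 p4 p5] := Pr b c P nqb cps ncq ncb.
  have [p1' p2' p3' p4' p5'] := Pr a c P naq' cps ncq nca.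
  have := cl3_count (P \o rep c q) cl; rewrite count_comp.
  rewrite -[None :: _]/(None :: map Some ((b :: ps) ++ (b :: ps))) count_None !count_cat /= !count_cat /=.
  rewrite p1 p2 p3 p4 p2' p5; genlia.
Qed.

Lemma K1_side a b c ps L t R : size ps = n -> None \notin t ->
  Some a \in t -> Some b \in t -> cl3 a b c ps (L ++ t ++ R) ->
  nf (op1 a b c ps (L ++ t ++ R)).
Proof.
move=> sps nt at_ bt cl.
have nab : a != b.
  by move: cl => /andP[/= /and4P[]]; rewrite inE negb_or => /andP[].
case/splitPr: at_ bt nt cl => t1 t2; rewrite mem_cat inE => /orP[bt|].
  case/splitPr: bt => t3 t4 nt cl.
  apply: (eq_nf (F := fun A x h => (-1) *: op1 b a c ps
     ((L ++ t3) ++ Some b :: t4 ++ Some a :: (t2 ++ R)) x h)).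
    by move=> A x h _; rewrite -op1C12 -!catA.
  apply/nfZ/K1_near => //.
    by apply: contraNN nt; rewrite !mem_cat inE => ->; rewrite !orbT.
  by rewrite -cl3C12; move: cl; rewrite -!catA.
rewrite -[Some b == Some a]/(b == a) eq_sym (negbTE nab) /= => bt.
case/splitPr: bt => t3 t4 nt cl.
have -> : L ++ (t1 ++ Some a :: t3 ++ Some b :: t4) ++ R =
  (L ++ t1) ++ Some a :: t3 ++ Some b :: (t4 ++ R) by rewrite -!catA /= -catA.
apply: K1_near => //.
  by apply: contraNN nt; rewrite mem_cat inE mem_cat => ->; rewrite !orbT.
by move: cl; rewrite -!catA /= -catA.
Qed.

(** Three legs on two strands: two of them lie on the same strand, and since [eps] is invariant
    under rotation these may be taken as the first two. *)
Lemma K1 a b c ps s : size ps = n -> cl3 a b c ps s -> nf (op1 a b c ps s).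
Proof.
move=> sps cl; have := cl => /andP[_ /perm_mem ms].
have n0 : None \in s by rewrite ms mem_head.
have [as_ bs cs] : [/\ Some a \in s, Some b \in s & Some c \in s].
  by rewrite !ms; split; rewrite in_cons mem_map ?mem_cat ?inE ?eqxx ?orbT // => ? ? [].
have := cl3_count (pred1 None) cl; rewrite /= addn0.
case/splitPr: n0 as_ bs cs cl {ms} => s1 s2; rewrite count_cat /= => as_ bs cs cl ct.
have ct0 : count (fun p : nat => Some p == None) ps = 0%N by rewrite count_pred0.
have [n1 n2] : None \notin s1 /\ None \notin s2.
  by split; apply/count_memPn; move: ct; rewrite ct0 /=; lia.
have cl' : cl3 a b c ps ((s1 ++ [:: None]) ++ s2 ++ [::]) by rewrite cats0 -catA.
have R : nf (op1 a b c ps ((s1 ++ [:: None]) ++ s2 ++ [::])) ->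
         nf (op1 a b c ps (s1 ++ None :: s2)) by rewrite cats0 -catA.
have E3 u v w t : nf (op1 v w u ps t) -> nf (op1 u v w ps t).
  by apply: eq_nf => A x h _; exact/esym/op1_rot.
have E3' u v w t : nf (op1 w u v ps t) -> nf (op1 u v w ps t).
  by apply: eq_nf => A x h _; exact: op1_rot.
move: as_ bs cs; rewrite !mem_cat !inE /=.
case: (boolP (Some a \in s1)) => [a1|_ /= a2]; case: (boolP (Some b \in s1)) => [b1|_ /= ].
- by move=> _ _ _; apply: (@K1_side _ _ _ _ [::]).
- move=> _ b2 /orP[c1|c2].
    apply: E3'.
    by apply: (@K1_side _ _ _ _ [::]) => //; rewrite cl3_rot.
  apply/R/E3/K1_side; rewrite -1?cl3_rot //.
- move=> _ /orP[c1|c2].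
    apply: E3.
    by apply: (@K1_side _ _ _ _ [::]) => //; rewrite -cl3_rot.
  apply/R/E3'/K1_side => //; rewrite cl3_rot //.
- by move=> b2 _; apply/R/K1_side.
Qed.

End Step.

Lemma op_perm (T : eqType) (ps qs : seq T) s (A : algType C) (x : 'I_3 -> A) h :
  perm_eq ps qs -> op ps s x h = op qs s x h.
Proof. exact: nsum_perm. Qed.

Lemma op_tk (T : eqType) (ps : seq T) (A : algType C) (x : 'I_3 -> A) h phi : uniq ps ->
  nsum ps (xw x h (map Some ps ++ None :: map Some ps)) phi = tk x (size ps) h.
Proof.
elim: ps h phi => [|p ps IH] h phi /=; first by rewrite /xw big_seq1.
move=> /andP[pps ups].
have npp : Some p \notin map Some ps by rewrite mem_map // => ? ? [].
transitivity (\sum_(a < 3) nsum ps (fun f => x a * xw x (h * x a) (map Some ps ++ None :: map Some ps) f) phi).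
  rewrite -nsum_sum -[LHS]/(nsum (p :: ps) (xw x h (Some p :: map Some ps ++ None :: Some p :: map Some ps)) phi).
  rewrite -(cat1s p) (nsum_perm _ _ (permEl (perm_catC _ _))) nsum_cat.
  apply: eq_nsum => f /=; apply: eq_bigr => a _.
  rewrite xw_cons !xw_cat !xw_cons /= upd_eq !xw_upd //.
  by rewrite /xw !big_map /= !mulrA.
by apply: eq_bigr => a _; rewrite -mulr_nsumr IH.
Qed.

Lemma notin_fresh (ps : seq nat) : (\max_(p <- ps) p).+1 \notin ps.
Proof.
apply/negP => H; have := @leq_bigmax_seq _ ps xpredT id _ H isT.
by rewrite ltnn.
Qed.

Lemma dup_perm (T : eqType) (l : seq T) : ~~ uniq l -> exists p l', perm_eq l [:: p, p & l'].
Proof.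
elim: l => //= a l IH; rewrite negb_and negbK => /orP[al|/IH[p [l' H]]].
  by exists a, (rem a l); rewrite perm_cons perm_to_rem.
exists p, (a :: l'); rewrite -[[:: p, p, a & l']]/([:: p; p] ++ [:: a] ++ l') perm_sym perm_catCA.
by rewrite perm_sym perm_cons.
Qed.

Section Main.
Variable ps : seq nat.
Hypothesis K1ps : forall p q r ps' s, perm_eq ps [:: p, q & ps'] -> cl3 p q r ps' s ->
  nf (op1 p q r ps' s).

Let Q s := cl2 ps s -> nf (op ps s).

(** Modulo diagrams with a vertex, which have a normal form by [K1ps], the order of the ends on a
    strand does not matter. *)
Let Q_swap p q s1 s2 : Q (s1 ++ Some p :: Some q :: s2) -> Q (s1 ++ Some q :: Some p :: s2).
Proof.
have [->//|npq] := eqVneq p q => H cl.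
have cl' : cl2 ps (s1 ++ Some p :: Some q :: s2).
  move: cl; rewrite /cl2 => /andP[-> cl] /=; apply: perm_trans cl.
  by rewrite perm_cat2l; apply/permP => P /=; genlia.
have := cl => /andP[ups pe].
have [pps qps] : p \in ps /\ q \in ps.
  have M u : Some u \in s1 ++ Some q :: Some p :: s2 -> u \in ps.
    rewrite (perm_mem pe) in_cons mem_map; last by move=> ? ? [].
    by rewrite orFb mem_cat orbb.
  by split; apply: M; rewrite mem_cat !inE eqxx ?orbT.
set ps' := rem q (rem p ps).
have qr : q \in rem p ps by rewrite mem_rem_uniq // !inE eq_sym npq.
have pps' : perm_eq ps [:: q, p & ps'].
  rewrite (perm_trans (perm_to_rem pps)) //.
  rewrite (perm_trans (y := p :: q :: ps')) //; first by rewrite perm_cons perm_to_rem.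
  by apply/permP => P /=; genlia.
pose r := (\max_(p <- ps) p).+1.
have rps : r \notin ps by exact: notin_fresh.
have ur : uniq [:: r, q, p & ps'] by rewrite /= -(perm_mem pps') rps; rewrite (perm_uniq pps') in ups.
have rs : Some r \notin s1 ++ s2.
  have : Some r \notin s1 ++ Some q :: Some p :: s2.
    rewrite (perm_mem pe) in_cons mem_map; last by move=> ? ? [].
    by rewrite orFb mem_cat orbb.
  by rewrite !mem_cat !inE !negb_or => /and4P[-> _ _ ->].
apply: (eq_nf (F := fun A x h => op ps (s1 ++ Some p :: Some q :: s2) x h +
   'i *: op1 q p r ps' (s1 ++ Some r :: s2) x h)).
  by move=> A x h sx; rewrite !(op_perm _ _ _ pps') (op_swap h sx ur).
apply: nfZD; first exact: H.
apply: K1ps => //; rewrite /cl3; apply/andP; split.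
  suff /perm_uniq -> : perm_eq [:: q, p, r & ps'] [:: r, q, p & ps'] by [].
  by apply/permP => P /=; genlia.
apply/permP => P; have /permP/(_ P) := pe.
rewrite count_None; have /permP -> := pps'.
rewrite /= !map_cat !count_cat /= !count_Some; genlia.
Qed.

Let Q_cat L al al' R : perm_eq al al' ->
  Q (L ++ map Some al ++ R) -> Q (L ++ map Some al' ++ R).
Proof.
have mv p l l' : forall L, Q (L ++ map Some l ++ Some p :: l') -> Q (L ++ Some p :: map Some l ++ l').
  elim: l => [|q l IH] L0 //= H; apply: Q_swap.
  by rewrite -[L0 ++ _]/(L0 ++ [:: Some q] ++ _) catA; apply: IH; rewrite -catA.
elim: al' al L => [|p al' IH] al L0 pe H; first by rewrite (perm_nilP pe) in H.
have pal : p \in al by rewrite (perm_mem pe) mem_head.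
case/splitPr: pal pe H => a1 a2; rewrite -(cat1s p a2) perm_catCA perm_cons => pe H.
rewrite /= -[L0 ++ _]/(L0 ++ [:: Some p] ++ _) catA; apply: (IH _ _ pe).
rewrite -catA /= map_cat -catA; apply: mv.
by rewrite map_cat /= -catA in H.
Qed.

(** As ends can be permuted along a strand, an arch is pushed to the outer end of its strand, where
    it splits off as a Casimir factor. Without arches both strands carry every chord once and can be
    sorted alike, which gives [tk]. *)
Lemma K0_step n s : size ps = n ->
  (forall ps' s', size ps' = n.-1 -> n != 0%N -> cl2 ps' s' -> nf (op ps' s')) -> Q s.
Proof.
move=> sps IH cl; have := cl => /andP[ups pe].
have n0 : None \in s by rewrite (perm_mem pe) mem_head.
case/splitPr: n0 cl pe => s1 s2 cl pe.
have ct0 : count (fun p : nat => Some p == None) ps = 0%N by rewrite count_pred0.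
have n12 : None \notin s1 ++ s2.
  apply/count_memPn; have /permP/(_ (pred1 None)) := pe.
  by rewrite count_None /= !count_cat /= ct0; lia.
have lift t : None \notin t -> exists l : seq nat, t = map Some l.
  elim: t => [|[p|] t H] //; first by exists [::].
  by rewrite inE => /H[l ->]; exists (p :: l).
move: n12; rewrite mem_cat negb_or => /andP[/lift[al E1] /lift[ga E2]]; subst s1 s2.
have mS : injective (@Some nat) by move=> ? ? [].
have cnt p : (count_mem p al + count_mem p ga = 2 * count_mem p ps)%N.
  have /permP/(_ (pred1 (Some p))) := pe.
  by rewrite count_None count_cat /= !count_Some.
have arch p al0 ga0 t (F := fun A x h => op ps t x h) :
    p \in ps -> None \notin [::] -> True.
  by [].
case: (boolP (uniq al)) => [ual|/dup_perm[p [al0 pal]]]; last first.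
  have pps : p \in ps.
    rewrite -has_pred1 has_count; have := cnt p.
    by rewrite (permP pal) /= eqxx; lia.
  have Hq : Q ([::] ++ map Some [:: p, p & al0] ++ None :: map Some ga).
    move=> cl'; have {}cl' : cl2 (rem p ps) (map Some al0 ++ None :: map Some ga).
      move: cl' => /andP[_ /permP pe']; rewrite /cl2 rem_uniq //=; apply/permP => P.
      have := pe' P; rewrite !count_None /= (permP (perm_to_rem pps)) /=; genlia.
    have pn : Some p \notin map Some al0 ++ None :: map Some ga.
      rewrite mem_cat inE /= !mem_map // negb_or.
      have := cnt p; rewrite (permP pal) /= eqxx (count_uniq_mem _ ups) pps => c2.
      by apply/andP; split; apply/count_memPn; move: c2 => /=; lia.
    apply: (eq_nf (F := fun A x h => cas x * op (rem p ps) (map Some al0 ++ None :: map Some ga) x h)).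
      move=> A x h sx; rewrite (op_perm _ _ _ (perm_to_rem pps)).
      rewrite (@op_arch _ _ _ _ _ p _ [::]) //; last by rewrite mem_rem_uniq // !inE eqxx.
      by rewrite /op mulr_nsumr; apply: eq_nsum => f; rewrite /xw big_nil mul1r.
    apply: nf_casl; apply: IH cl'; first by rewrite size_rem // sps.
    by rewrite -sps; case: (ps) pps.
  rewrite perm_sym in pal.
  exact: (Q_cat (L := [::]) pal Hq).
case: (boolP (uniq ga)) => [uga|/dup_perm[p [ga0 pga]]]; last first.
  have pps : p \in ps.
    rewrite -has_pred1 has_count; have := cnt p.
    by rewrite (permP pga) /= eqxx; lia.
  have pga' : perm_eq (ga0 ++ [:: p; p]) ga.
    by rewrite perm_sym (permPl pga) -[[:: p, p & ga0]]/([:: p; p] ++ ga0) perm_catC.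
  have Hq : Q ((map Some al ++ [:: None]) ++ map Some (ga0 ++ [:: p; p]) ++ [::]).
    rewrite cats0 -catA map_cat.
    move=> cl'; have {}cl' : cl2 (rem p ps) (map Some al ++ None :: map Some ga0).
      move: cl' => /andP[_ /permP pe']; rewrite /cl2 rem_uniq //=; apply/permP => P.
      have := pe' P; rewrite !count_None /= !count_cat /= count_cat /= (permP (perm_to_rem pps)) /=.
      genlia.
    have pn : Some p \notin (map Some al ++ None :: map Some ga0) ++ [::].
      rewrite cats0 mem_cat inE /= !mem_map // negb_or.
      have := cnt p; rewrite (permP pga) /= eqxx (count_uniq_mem _ ups) pps => c2.
      by apply/andP; split; apply/count_memPn; move: c2 => /=; lia.
    apply: (eq_nf (F := fun A x h => op (rem p ps) (map Some al ++ None :: map Some ga0) x h * cas x)).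
      move=> A x h sx; rewrite (op_perm _ _ _ (perm_to_rem pps)).
      rewrite -[map Some al ++ _]/(map Some al ++ (None :: map Some ga0) ++ [:: Some p; Some p]) catA.
      rewrite (op_arch _ _ _ pn); last by rewrite mem_rem_uniq // !inE eqxx.
      by rewrite /op mulr_nsuml; apply: eq_nsum => f; rewrite /xw [in LHS]big_nil mulr1.
    apply: nf_casr; apply: IH cl'; first by rewrite size_rem // sps.
    by rewrite -sps; case: (ps) pps.
  have := (Q_cat pga' Hq); rewrite cats0 -catA; exact.
have eqps l l' : uniq l -> uniq l' ->
   (forall p, count_mem p l + count_mem p l' = 2 * count_mem p ps)%N -> perm_eq ps l.
  move=> ul ul' H; apply: uniq_perm => // p; have := H p.
  rewrite !count_uniq_mem //.
  by case: (p \in l); case: (p \in l'); case: (p \in ps).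
have pal : perm_eq ps al by apply: eqps ual uga cnt.
have pga : perm_eq ps ga by apply: (eqps _ al) => // p; rewrite addnC.
have H0 : Q ((map Some ps ++ [:: None]) ++ map Some ps ++ [::]).
  move=> _; apply: eq_nf (nf_tk (size ps)) => A x h sx.
  by rewrite cats0 -catA /op op_tk.
have := Q_cat pga H0; rewrite cats0 -catA => H1.
exact: (Q_cat (L := [::]) pal H1).
Qed.

End Main.

Lemma op_nf_nat ps s : cl2 ps s -> nf (op ps s).
Proof.
move En: (size ps) => n; elim: n ps s En => [|n IH] ps s En.
  apply: (K0_step _ En) => // p q r ps' t /perm_size E; by rewrite E in En.
apply: (K0_step _ En) => [p q r ps' t /perm_size E cl|ps' t /= sps' _ cl]; last exact: IH.
(* Among [n.+1] chords the vertex consumes two and leaves [n.-1]; resolving it gives back one, so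
   the induction hypothesis for [n] chords applies. *)
apply: (K1 (n := size ps')) => // ps2 t2 s2; apply: IH.
by rewrite s2; move: En; rewrite E => -[].
Qed.

(* Universality in the algebra is what later makes it possible to compare [s] with its reversal. *)
Lemma op_nf (T : eqType) (al ga : seq T) :
  {in al ++ ga, forall p, count_mem p (al ++ ga) = 2} ->
  nf (op (undup (al ++ ga)) (map Some al ++ None :: map Some ga)).
Proof.
move=> H; set L := undup (al ++ ga).
pose f p := index p L.
have fi : {in L &, injective f}.
  by move=> p q pL qL E; rewrite -(nth_index p pL) -[index p L]/(f p) E nth_index.
have sub : forall p, p \in al ++ ga -> p \in L by move=> p; rewrite mem_undup.
have ul : uniq (map f L) by rewrite map_inj_in_uniq ?undup_uniq.
have cl : cl2 (map f L) (map Some (map f al) ++ None :: map Some (map f ga)).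
  rewrite /cl2 ul /=; apply/permP => P; rewrite count_None count_cat /= !count_Some.
  rewrite [X in (_ * X)%N]count_map !count_map.
  set P' := preim f _.
  suff -> : (2 * count P' L = count P' (al ++ ga))%N by rewrite count_cat; genlia.
  rewrite -!sum1_count big_distrr /= [RHS](eq_bigl (fun p => P' p)) //.
  rewrite -[RHS]big_undup_iterop_count /=.
  rewrite big_mkcond [RHS]big_mkcond; apply: eq_big_seq => p pL.
  by case: ifP => // _; rewrite H // -mem_undup.
apply: eq_nf (op_nf_nat cl) => A x h sx; rewrite /op.
apply: (nsum_map (f := f) (L := L)) => // psi psi' E.
rewrite /xw !big_cat !big_cons !big_map /=; congr (_ * (_ * _)).
  by apply: eq_big_seq => p pa; rewrite /= E // sub // mem_cat pa.
by apply: eq_big_seq => p pa; rewrite /= E // sub // mem_cat pa orbT.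
Qed.

End NormalForm.

(** * Values of chord diagrams and mutation *)

(** The opposite ring under a name of its own, so that it can carry the algebra structure in which
    scalars act as on [A]. *)
Definition oppalg (C : nzRingType) (A : algType C) : Type := A^c.
HB.instance Definition _ (C : nzRingType) (A : algType C) :=
  GRing.NzRing.copy (oppalg A) A^c.

Section OppAlg.
Variables (C : comNzRingType) (A : algType C).
Let sc (a : C) (u : oppalg A) : oppalg A := a *: (u : A).
Let scA a b v : sc a (sc b v) = sc (a * b) v. Proof. exact: scalerA. Qed.
Let sc1 : left_id 1 sc. Proof. exact: scale1r. Qed.
Let scDr : right_distributive sc +%R. Proof. exact: scalerDr. Qed.
Let scDl v : {morph sc^~ v : a b / a + b}. Proof. by move=> a b; apply: scalerDl. Qed.
HB.instance Definition _ := GRing.Zmodule_isLmodule.Build C (oppalg A) scA sc1 scDr scDl.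
Let scAl (a : C) (u v : oppalg A) : a *: (u * v) = (a *: u) * v.
Proof. exact: (@scalerAr C A a v u). Qed.
HB.instance Definition _ := GRing.Lmodule_isLalgebra.Build C (oppalg A) scAl.
Let scAr (a : C) (u v : oppalg A) : a *: (u * v) = u * (a *: v).
Proof. exact: (@scalerAl C A a v u). Qed.
HB.instance Definition _ := GRing.Lalgebra_isAlgebra.Build C (oppalg A) scAr.
End OppAlg.

Section Values.
Variables (C : numClosedFieldType).

Definition xp (T : eqType) (A : algType C) (x : 'I_3 -> A) (s : seq T) (f : T -> 'I_3) : A :=
  \prod_(p <- s) x (f p).

Definition shop (T : eqType) (al ga : seq T) (A : algType C) (x : 'I_3 -> A) (h : A) : A :=
  op (undup (al ++ ga)) (map Some al ++ None :: map Some ga) x h.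

Definition W (T : eqType) (A : algType C) (x : 'I_3 -> A) (s : seq T) : A :=
  nsum (undup s) (xp x s) (fun=> ord0).

(* Double occurrence words, i.e. chord diagrams. *)
Definition dow (T : eqType) (s : seq T) := all (fun p => count_mem p s == 2) s.

Lemma dowP (T : eqType) (s : seq T) : reflect {in s, forall p, count_mem p s = 2} (dow s).
Proof. by apply: (iffP allP) => H p /H /eqP. Qed.

Lemma shop_nf (T : eqType) (al ga : seq T) : dow (al ++ ga) -> nf (shop al ga).
Proof. by move/dowP => H; exact: op_nf. Qed.

Lemma nsum_outer (T : eqType) (V : zmodType) (ps : seq T) (F G : (T -> 'I_3) -> V) phi :
  (forall psi, (forall q, q \notin ps -> psi q = phi q) -> F psi = G psi) ->
  nsum ps F phi = nsum ps G phi.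
Proof.
elim: ps phi => [|z ps IH] phi H /=; first exact: H.
apply: eq_bigr => a _; apply: IH => psi E; apply: H => q; rewrite inE negb_or => /andP[nqz qps].
by rewrite E // upd_neq.
Qed.

Lemma xp_cat (T : eqType) (A : algType C) (x : 'I_3 -> A) (s t : seq T) f :
  xp x (s ++ t) f = xp x s f * xp x t f.
Proof. exact: big_cat. Qed.

Lemma eq_xp (T : eqType) (A : algType C) (x : 'I_3 -> A) (s : seq T) f g :
  {in s, f =1 g} -> xp x s f = xp x s g.
Proof. by move=> E; apply: eq_big_seq => p ps; rewrite E. Qed.

(** All letters of the share are summed, so the starting assignment is arbitrary; it can be the one
    already chosen for the surrounding word. *)
Lemma shop_nsum (T : eqType) (al ga : seq T) (A : algType C) (x : 'I_3 -> A) (h : A) phi :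
  nsum (undup (al ++ ga)) (fun f => xp x al f * h * xp x ga f) phi = shop al ga x h.
Proof.
rewrite /shop /op -[X in nsum X _ (fun=> _)]map_id.
apply: (nsum_map (L := undup (al ++ ga))) => // [|p ->] //.
move=> f g E; rewrite xw_cat xw_cons /xw /xp !big_map /= mulrA.
by congr (_ * _ * _); apply: eq_big_seq => p pa; rewrite E // mem_undup mem_cat pa ?orbT.
Qed.

Lemma xp_comm (T : eqType) (A : algType C) (x : 'I_3 -> A) (s : seq T) f (c : A) :
  (forall a, c * x a = x a * c) -> c * xp x s f = xp x s f * c.
Proof.
move=> H; elim: s => [|p s IH]; first by rewrite /xp big_nil mulr1 mul1r.
by rewrite /xp big_cons mulrA H -!mulrA -[X in _ = _ * X]IH.
Qed.

Lemma tk_comm (A : algType C) (x : 'I_3 -> A) k h (c : A) :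
  (forall a, c * x a = x a * c) -> c * h = h * c -> c * tk x k h = tk x k h * c.
Proof.
move=> H; elim: k h => //= k IH h ch; rewrite mulr_sumr mulr_suml; apply: eq_bigr => a _.
by rewrite mulrA H -!mulrA IH // -!mulrA -H !mulrA ch.
Qed.

(** Peels off the last bridge where the definition of [tk] peels off the first; reversing products
    exchanges the two. *)
Lemma tkSr (A : algType C) (x : 'I_3 -> A) k h :
  tk x k.+1 h = \sum_(a < 3) tk x k (x a * h) * x a.
Proof.
elim: k h => [|k IH] h; first by apply: eq_bigr => a _; rewrite /= mulrA.
rewrite -[LHS]/(\sum_(b < 3) x b * tk x k.+1 (h * x b)).
under eq_bigr => b _ do rewrite IH mulr_sumr.
rewrite exchange_big; apply: eq_bigr => a _ /=; rewrite mulr_suml; apply: eq_bigr => b _.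
by rewrite !mulrA.
Qed.

(** The antipode of the enveloping algebra: negation restores the commutation relations for the
    reversed product. *)
Definition rl (A : algType C) (x : 'I_3 -> A) (a : 'I_3) : oppalg A := - x a.

Lemma mul_opp (A : algType C) (u v : A) : (u : oppalg A) * (v : oppalg A) = v * u.
Proof. by []. Qed.

Lemma sl2_rl (A : algType C) (x : 'I_3 -> A) : sl2_triple x -> sl2_triple (rl x).
Proof.
move=> [h01 h12 h20]; rewrite /rl.
have E (u v w : A) : u * v - v * u = 'i *: w ->
  (- u : oppalg A) * (- v : oppalg A) - (- v : oppalg A) * (- u : oppalg A)
   = 'i *: (- w : oppalg A).
  move=> H; rewrite !mulrNN !mul_opp scalerN.
  have K : v * u - u * v = - ('i *: w) by rewrite -H opprB.
  exact: K.
by split; apply: E.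
Qed.

Lemma cas_rl (A : algType C) (x : 'I_3 -> A) : cas (rl x) = cas x.
Proof. by apply: eq_bigr => a _; rewrite /rl mulrNN. Qed.

Lemma tkN (A : algType C) (x : 'I_3 -> A) k h : tk x k (- h) = - tk x k h.
Proof.
elim: k h => //= k IH h; rewrite -sumrN; apply: eq_bigr => a _.
by rewrite mulNr IH mulrN.
Qed.

(** Each bridge contributes two signs, and parallel bridges remain parallel when products are
    reversed. *)
Lemma tk_rl (A : algType C) (x : 'I_3 -> A) k (h : A) : tk (rl x) k (h : oppalg A) = tk x k h.
Proof.
elim: k h => // k IH h; rewrite [RHS]tkSr /=; apply: eq_bigr => a _.
transitivity (tk x k ((- x a) * h) * (- x a)); first by rewrite -IH.
by rewrite mulNr tkN mulrNN.
Qed.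

Lemma xp_rl (T : eqType) (A : algType C) (x : 'I_3 -> A) (s : seq T) f :
  xp (rl x) s f = (-1) ^+ size s *: (xp x (rev s) f : oppalg A).
Proof.
elim: s => [|p s IH]; first by rewrite /xp !big_nil scale1r.
rewrite /xp big_cons -[X in _ * X]/(xp (rl x) s f) IH rev_cons -cats1 /= exprS.
rewrite -[RHS]/((-1 * (-1) ^+ size s) *: (xp x (rev s ++ [:: p]) f : A)) xp_cat /xp big_seq1.
rewrite -[LHS]/((((-1) ^+ size s *: xp x (rev s) f) : A) * (- x (f p))).
by rewrite mulrN mulN1r scaleNr scalerAl.
Qed.

Lemma dow_catC (T : eqType) (u v : seq T) : dow (u ++ v) = dow (v ++ u).
Proof.
rewrite /dow (eq_all (a2 := fun p => count_mem p (v ++ u) == 2)); last first.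
  by move=> p; rewrite !count_cat addnC.
by rewrite !all_cat andbC.
Qed.

Lemma dow_perm (T : eqType) (u v : seq T) : perm_eq u v -> dow u = dow v.
Proof.
move=> E; rewrite /dow (perm_all _ E); apply: eq_all => p.
by rewrite (permP E).
Qed.

Lemma dow_even (T : eqType) (s : seq T) : dow s -> ~~ odd (size s).
Proof.
move: {2}(size s) (leqnn (size s)) => n; elim: n s => [|n IH] [|p s] //= sz ds.
have c1 : count_mem p s = 1%N by move/dowP: ds => /(_ p (mem_head _ _)) /=; rewrite eqxx => -[].
have ps : p \in s by rewrite -has_pred1 has_count c1.
have E := perm_to_rem ps; rewrite (perm_size E) /= negbK; apply: IH.
  by move: sz; rewrite (perm_size E) /=; lia.
have E2 : perm_eq (p :: s) [:: p, p & rem p s] by rewrite perm_cons.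
rewrite (dow_perm E2) in ds; apply/dowP => q qs.
have pr : p \notin rem p s by apply/count_memPn; move: c1; rewrite (permP E) /= eqxx => -[].
have nqp : q != p by apply: contraNneq pr => E3; rewrite -{1}E3.
have npq : (p == q) = false by rewrite eq_sym; apply/negbTE.
have qin : q \in [:: p, p & rem p s] by rewrite !inE qs !orbT.
by have := dowP _ ds q qin; rewrite /= npq.
Qed.

(** The opposite product reads the word backwards, which exchanges and reverses the strands; the
    signs cancel because a closed share has an even number of ends. *)
Lemma shop_rl (T : eqType) (al ga : seq T) (A : algType C) (x : 'I_3 -> A) (h : A) :
  dow (al ++ ga) -> shop al ga (rl x) (h : oppalg A) = shop (rev ga) (rev al) x h.
Proof.
move=> ds; rewrite -!(shop_nsum _ _ _ _ (fun=> ord0)).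
have pe : perm_eq (undup (al ++ ga)) (undup (rev ga ++ rev al)).
  apply: uniq_perm; rewrite ?undup_uniq // => p.
  by rewrite !mem_undup !mem_cat !mem_rev orbC.
transitivity (nsum (undup (al ++ ga)) (fun f => xp x (rev ga) f * h * xp x (rev al) f) (fun=> ord0));
  last exact: nsum_perm.
apply: (eq_nsum (V := oppalg A)) => f; rewrite !xp_rl.
transitivity (((-1) ^+ size ga *: xp x (rev ga) f) * (h * ((-1) ^+ size al *: xp x (rev al) f))) => //.
rewrite -!scalerAr -scalerAl scalerA mulrA -exprD.
have := dow_even ds; rewrite size_cat -signr_odd => /negbTE ->.
by rewrite expr0 scale1r.
Qed.

(** By [shop_rl] both sides have the same normal form up to exchanging the two Casimir exponents of
    each term. If the Casimir element commutes with [h], its powers pass from one side to the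
    other. *)
Lemma shop_swap (T : eqType) (al ga : seq T) : dow (al ++ ga) ->
  forall (A : algType C) (x : 'I_3 -> A) h, sl2_triple x ->
  (forall a, cas x * x a = x a * cas x) -> cas x * h = h * cas x ->
  shop (rev ga) (rev al) x h = shop al ga x h.
Proof.
move=> ds A x h sx cx ch; have [l Hl] := shop_nf ds.
rewrite -shop_rl // (Hl _ _ _ (sl2_rl sx)) (Hl _ _ _ sx).
have cX n : cas (rl x) ^+ n = cas x ^+ n :> A.
  elim: n => // n IH; rewrite exprS IH cas_rl.
  by rewrite -[LHS]/((cas x ^+ n : A) * cas x) -exprSr.
apply: eq_bigr => q _; rewrite /nf_term tk_rl !cX; congr (_ *: _).
rewrite -[LHS]/(cas x ^+ q.2.1.2 * (tk x q.2.2 h * cas x ^+ q.2.1.1)).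
have cT n : cas x ^+ n * tk x q.2.2 h = tk x q.2.2 h * cas x ^+ n.
  by apply/commr_sym/commrX/commr_sym; apply: tk_comm.
by rewrite cT mulrA cT -!mulrA -!exprD addnC.
Qed.
End Values.

(** * Rotation and multiplicativity of word values *)

Section WordValue.
Variables (C : numClosedFieldType) (A : algType C) (x : 'I_3 -> A).

Lemma W_sub (T : eqType) (al B ga E : seq T) :
  {in al ++ ga, forall p, p \notin B ++ E} ->
  W x (al ++ B ++ ga ++ E) =
  nsum (undup (B ++ E)) (fun f => shop al ga x (xp x B f) * xp x E f) (fun=> ord0).
Proof.
move=> dis; rewrite /W (nsum_perm (qs := undup (B ++ E) ++ undup (al ++ ga))); last first.
  apply: uniq_perm; rewrite ?undup_uniq // ?cat_uniq ?undup_uniq //=.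
    rewrite andbT; apply/hasPn => p; rewrite !mem_undup => /dis; exact.
  by move=> p; rewrite !(mem_undup, mem_cat) -!orbA; do !bool_congr.
rewrite nsum_cat; apply: eq_nsum => f.
rewrite (nsum_outer (G := fun g => (xp x al g * xp x B f * xp x ga g) * xp x E f)).
  by rewrite -mulr_nsuml shop_nsum.
move=> g gf; have out s : {subset s <= B ++ E} -> xp x s g = xp x s f.
  move=> sub; apply: eq_xp => p /sub ps; apply: gf; rewrite mem_undup.
  by apply: contraL ps => /dis.
rewrite !xp_cat (out B) ?(out E) ?mulrA // => p ps; by rewrite mem_cat ps ?orbT.
Qed.

Lemma shop_map (T T' : eqType) (f : T -> T') (al ga : seq T) (h : A) :
  {in al ++ ga &, injective f} -> shop (map f al) (map f ga) x h = shop al ga x h.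
Proof.
move=> fi; rewrite -!(shop_nsum _ _ _ _ (fun=> ord0)) -map_cat.
have -> : undup (map f (al ++ ga)) = map f (undup (al ++ ga)).
  elim: (al ++ ga) fi => //= p s IH fi; rewrite IH; last first.
    by move=> u v us vs; apply: fi; rewrite inE ?us ?vs orbT.
  case: ifP => [/mapP[q qs E]|].
    by rewrite (fi p q) ?inE ?eqxx ?qs ?orbT.
  by move=> /negP H; case: ifP => // ps; case: H; apply: map_f.
apply/esym/(nsum_map (L := undup (al ++ ga))) => //.
  by move=> u v; rewrite !mem_undup; apply: fi.
move=> g g' E; rewrite /xp !big_map.
by congr (_ * _ * _); apply: eq_big_seq => p ps; rewrite E // mem_undup mem_cat ps ?orbT.
Qed.

Hypothesis sx : sl2_triple x.

(** The two ends of [p] turn the other letters into a share applied to [x a]. In its normal form [p]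
    joins [k] parallel bridges as the first one or as the last one, and [tkSr] equates these. *)
Lemma W_rot1 (T : eqType) (p : T) s : dow (p :: s) -> W x (p :: s) = W x (rcons s p).
Proof.
move=> ds; have c1 : count_mem p s = 1%N.
  by move/dowP: ds => /(_ p (mem_head _ _)) /=; rewrite eqxx => -[].
have ps : p \in s by rewrite -has_pred1 has_count c1.
case/splitPr: ps c1 ds => s1 s2; rewrite count_cat /= eqxx => c1 ds.
have [p1 p2] : p \notin s1 /\ p \notin s2 by split; apply/count_memPn; lia.
have d12 : dow (s1 ++ s2).
  apply/dowP => q qs; have nqp : q != p.
    by apply: contraTneq qs => ->; rewrite mem_cat negb_or p1.
  have := dowP _ ds q; rewrite !(inE, mem_cat) (negbTE nqp) /= -mem_cat qs => /(_ isT).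
  by rewrite !count_cat /= eq_sym (negbTE nqp).
have pe : perm_eq (undup (p :: s1 ++ p :: s2)) (p :: undup (s1 ++ s2)).
  apply: uniq_perm; rewrite ?undup_uniq // ?cons_uniq ?undup_uniq ?mem_undup ?mem_cat ?negb_or ?p1 ?p2 //.
  by move=> q; rewrite !(mem_undup, inE, mem_cat); case: eqP; rewrite ?orbT.
have pe' : perm_eq (undup (rcons (s1 ++ p :: s2) p)) (p :: undup (s1 ++ s2)).
  apply: perm_trans pe; apply: uniq_perm; rewrite ?undup_uniq // => q.
  by rewrite !mem_undup mem_rcons.
have [l Hl] := shop_nf C d12.
transitivity (\sum_(a < 3) x a * shop s1 s2 x (x a)).
  rewrite /W (nsum_perm _ _ pe) /=; apply: eq_bigr => a _.
  rewrite -(shop_nsum _ _ _ _ (upd (fun=> ord0) p a)) mulr_nsumr; apply: nsum_outer => f E.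
  by rewrite /xp big_cons big_cat big_cons /= E ?upd_eq ?mem_undup ?mem_cat ?negb_or ?p1 ?p2 // !mulrA.
transitivity (\sum_(a < 3) shop s1 s2 x (x a) * x a); last first.
  rewrite /W (nsum_perm _ _ pe') /=; apply: eq_bigr => a _.
  rewrite -(shop_nsum _ _ _ _ (upd (fun=> ord0) p a)) mulr_nsuml; apply/esym/nsum_outer => f E.
  rewrite /xp -cats1 !big_cat !big_cons big_nil /= E ?upd_eq ?mem_undup ?mem_cat ?negb_or ?p1 ?p2 //.
  by rewrite mulr1 !mulrA.
under eq_bigr => a _ do rewrite Hl // mulr_sumr.
under [RHS]eq_bigr => a _ do rewrite Hl // mulr_suml.
rewrite exchange_big [RHS]exchange_big; apply: eq_bigr => -[c [[i j] k]] _.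
have cX n a : x a * cas x ^+ n = cas x ^+ n * x a.
  by apply/commrX/commr_sym; apply: cas_comm.
rewrite /nf_term /=; transitivity (c *: (cas x ^+ i * tk x k.+1 1 * cas x ^+ j)).
  rewrite /= mulr_sumr mulr_suml scaler_sumr; apply: eq_bigr => a _.
  by rewrite -scalerAr !mulrA cX mul1r.
rewrite tkSr mulr_sumr mulr_suml scaler_sumr; apply: eq_bigr => a _.
by rewrite -scalerAl mulr1 -!mulrA cX.
Qed.

Lemma W_rot (T : eqType) (u v : seq T) : dow (u ++ v) -> W x (u ++ v) = W x (v ++ u).
Proof.
elim: u v => [|p u IH] v; first by rewrite cats0.
rewrite cat_cons => ds; rewrite W_rot1 // -cats1 -catA IH -?catA //.
by rewrite catA dow_catC /= .
Qed.

Lemma W_cat (T : eqType) (u v : seq T) : {in u, forall p, p \notin v} ->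
  W x (u ++ v) = W x u * W x v.
Proof.
move=> dis; rewrite -[u ++ v]/(u ++ [::] ++ [::] ++ v) W_sub; last by rewrite cats0.
rewrite [W x v]/W mulr_nsumr; apply: eq_nsum => f; congr (_ * _).
rewrite -(shop_nsum _ _ _ _ (fun=> ord0)) cats0; apply: eq_nsum => g.
by rewrite /xp !big_nil !mulr1.
Qed.

End WordValue.

(** * Chords weighted by the size of a bundle *)

Section Expand.
Variable T : eqType.
Implicit Types (m : T -> nat) (s : seq T).

(* Chord [p] becomes a bundle of [m p] pairwise crossing chords: the normal form of a share involves
   such bundles, so the main induction needs weights. *)
Definition expand m s : seq (T * nat) :=
  flatten [seq [seq (p, j) | j <- iota 0 (m p)] | p <- s].

Lemma expand_cat m s t : expand m (s ++ t) = expand m s ++ expand m t.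
Proof. by rewrite /expand map_cat flatten_cat. Qed.

Lemma count_expand m s p j :
  count_mem (p, j) (expand m s) = (count_mem p s * (j < m p)%N)%N.
Proof.
elim: s => // q s IH; rewrite -[q :: s]cat1s expand_cat !count_cat IH mulnDl; congr (_ + _)%N.
rewrite /expand /= !addn0 count_map.
have [->|npq] := eqVneq q p; last first.
  rewrite mul0n (eq_count (a2 := pred0)) ?count_pred0 // => i.
  by rewrite -[LHS]/((q, i) == (p, j)) xpair_eqE (negbTE npq).
rewrite mul1n (eq_count (a2 := pred1 j)) => [|i]; last by rewrite -[LHS]/((p, i) == (p, j)) xpair_eqE eqxx.
by rewrite count_uniq_mem ?iota_uniq // mem_iota.
Qed.

Lemma mem_expand m s p j : ((p, j) \in expand m s) = (p \in s) && (j < m p)%N.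
Proof. by rewrite -!has_pred1 !has_count count_expand muln_gt0 lt0b. Qed.

Lemma dow_expand m s : dow s -> dow (expand m s).
Proof.
move=> /dowP ds; apply/dowP => -[p j]; rewrite mem_expand count_expand => /andP[/ds-> ->] //.
Qed.

Lemma eq_expand m m' s : {in s, m =1 m'} -> expand m s = expand m' s.
Proof. by move=> E; congr flatten; apply/eq_in_map => p /E ->. Qed.

(** Reversing a word also reverses the numbering inside each bundle; [flip] restores it. *)
Definition flip m (pj : T * nat) := (pj.1, ((m pj.1).-1 - pj.2)%N).

Lemma flip_expand m s : map (flip m) (rev (expand m s)) = expand m (rev s).
Proof.
elim: s => // p s IH; rewrite rev_cons -cats1 -cat1s !expand_cat rev_cat map_cat IH; congr (_ ++ _).
rewrite /expand /= !cats0 -map_rev -map_comp.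
apply: (@eq_from_nth _ (p, 0%N)); rewrite !size_map size_rev // => i.
rewrite size_iota => im; rewrite !(nth_map 0%N) ?size_rev ?size_iota // nth_rev ?size_iota //.
rewrite !nth_iota //=; last by lia.
by rewrite /flip /=; congr pair; lia.
Qed.

Lemma flip_inj m s : {in expand m s &, injective (flip m)}.
Proof.
move=> [p j] [q k]; rewrite !mem_expand => /andP[_ jm] /andP[_ km] [pq]; subst q => E.
by congr pair; lia.
Qed.

Definition mset m z k : T -> nat := fun p => if p == z then k else m p.

End Expand.

Section WVal.
Variables (C : numClosedFieldType) (A : algType C) (x : 'I_3 -> A).
Hypothesis sx : sl2_triple x.
Variable T : eqType.
Implicit Types (m : T -> nat) (s u v : seq T).

Definition wval m s : A := W x (expand m s).

(** For a part of a double occurrence word this says that it contains both ends of each of its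
    chords. *)
Definition evn s := forall p, ~~ odd (count_mem p s).

Lemma dow_evn u v : dow (u ++ v) -> evn u ->
  [/\ dow u, dow v & {in u, forall p, p \notin v}].
Proof.
move=> /dowP duv ev.
have H p : [\/ count_mem p u = 0 /\ count_mem p v = 0, count_mem p u = 2 /\ count_mem p v = 0
   | count_mem p u = 0 /\ count_mem p v = 2]%N.
  have [puv|] := boolP (p \in u ++ v).
    have := duv p puv; rewrite count_cat; have := ev p.
    case: (count_mem p u) => [|[|[|n]]] //= _ E; [constructor 3|constructor 2]; lia.
  by rewrite mem_cat negb_or => /andP[/count_memPn-> /count_memPn->]; constructor.
split; [apply/dowP => p pu|apply/dowP => p pv|move=> p pu].
- by move: pu; rewrite -has_pred1 has_count; have [[-> _]|[-> _]|[-> _]] := H p.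
- by move: pv; rewrite -has_pred1 has_count; have [[_ ->]|[_ ->]|[_ ->]] := H p.
- by apply/count_memPn; move: pu; rewrite -has_pred1 has_count; have [[-> ->]|[-> ->]|[-> ->]] := H p.
Qed.

Lemma share_closed al B ga E : dow (al ++ B ++ ga ++ E) -> evn (al ++ ga) ->
  [/\ dow (al ++ ga), dow (B ++ E) & {in al ++ ga, forall p, p \notin B ++ E}].
Proof.
move=> ds; apply: dow_evn; rewrite (@dow_perm _ _ (al ++ B ++ ga ++ E)) //.
by rewrite -!catA perm_cat2l perm_catCA.
Qed.

Lemma wval_rot m u v : dow (u ++ v) -> wval m (u ++ v) = wval m (v ++ u).
Proof. by move=> ds; rewrite /wval !expand_cat W_rot // -expand_cat dow_expand. Qed.

Lemma wval_cat m u v : dow (u ++ v) -> evn u -> wval m (u ++ v) = wval m u * wval m v.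
Proof.
move=> ds ev; have [_ _ dis] := dow_evn ds ev.
rewrite /wval expand_cat W_cat // => -[p j]; rewrite !mem_expand => /andP[pu ->].
by rewrite andbT dis.
Qed.

Lemma expand_dis m al ga B E : {in al ++ ga, forall p, p \notin B ++ E} ->
  {in expand m al ++ expand m ga, forall p, p \notin expand m B ++ expand m E}.
Proof.
move=> dis [p j]; rewrite -!expand_cat !mem_expand => /andP[pu ->].
by rewrite andbT dis.
Qed.

(** Mutation: the share is turned upside down in its place. The slot is filled with a product of
    elements [x a], with which the Casimir element commutes, as [shop_swap] demands. *)
Lemma wval_swap m al B ga E : dow (al ++ B ++ ga ++ E) -> evn (al ++ ga) ->
  wval m (al ++ B ++ ga ++ E) = wval m (rev ga ++ B ++ rev al ++ E).
Proof.
move=> ds ev; have [d1 d2 dis] := share_closed ds ev.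
rewrite /wval !expand_cat !W_sub; last 2 first.
- by apply: expand_dis => p; rewrite mem_cat !mem_rev orbC -mem_cat; apply: dis.
- exact: expand_dis.
apply: eq_nsum => f; congr (_ * _); rewrite -!flip_expand shop_map; last first.
  move=> p q; rewrite !mem_cat !mem_rev ![_ || (_ \in expand m al)]orbC -!mem_cat -expand_cat.
  exact: flip_inj.
have cx := cas_comm sx.
apply/esym/shop_swap => //; first by rewrite -expand_cat dow_expand.
exact: xp_comm.
Qed.

Lemma wval_rev m s : dow s -> wval m (rev s) = wval m s.
Proof.
move=> ds; have := @wval_swap m s [::] [::] [::]; rewrite /= !cats0 => <- //.
move=> p; have [ps|/count_memPn->//] := boolP (p \in s).
by rewrite (dowP _ ds).
Qed.

(** The list depends on the share and its weights, while [z], [B] and [E] are quantified after it: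
    different words around the same share expand with the same coefficients. *)
Lemma wval_subst m al ga : dow (al ++ ga) ->
  exists l : seq (C * (nat * nat * nat)), forall z B E,
  {in al ++ ga, forall p, p \notin B ++ E} -> z \notin B ++ E ->
  wval m (al ++ B ++ ga ++ E) =
  \sum_(q <- l) q.1 *: (cas x ^+ q.2.1.1 * wval (mset m z q.2.2) (z :: B ++ z :: E) * cas x ^+ q.2.1.2).
Proof.
move=> ds; have := dow_expand m ds; rewrite expand_cat => /(shop_nf C)[l Hl].
exists l => z B E dis zBE; rewrite /wval !expand_cat W_sub; last exact: expand_dis.
transitivity (nsum (undup (expand m B ++ expand m E)) (fun f => \sum_(q <- l)
    nf_term x (xp x (expand m B) f) q * xp x (expand m E) f) (fun=> ord0)).
  by apply: eq_nsum => f; rewrite Hl // mulr_suml.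
rewrite nsum_seq; apply: eq_bigr => -[c [[i j] k]] _; rewrite /nf_term /=.
set m' := mset m z k.
have zB : expand m B = expand m' B.
  apply: eq_expand => p pB; rewrite /m' /mset; case: eqP => // E1.
  by rewrite -E1 mem_cat pB in zBE.
have zE : expand m E = expand m' E.
  apply: eq_expand => p pB; rewrite /m' /mset; case: eqP => // E1.
  by rewrite -E1 mem_cat pB orbT in zBE.
rewrite -cat1s -(cat1s z E) !expand_cat zB zE W_sub; last first.
  by apply: expand_dis => p; rewrite /= !inE orbb => /eqP->.
rewrite mulr_nsumr mulr_nsuml scaler_nsum; apply: eq_nsum => f.
have -> : shop (expand m' [:: z]) (expand m' [:: z]) x (xp x (expand m' B) f)
   = tk x k (xp x (expand m' B) f).
  set L := expand m' [:: z].
  have uL : uniq L by rewrite /L /expand /= cats0 map_inj_uniq ?iota_uniq // => ? ? [].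
  rewrite /shop (op_perm (qs := L)); last first.
    by apply: uniq_perm; rewrite ?undup_uniq // => p; rewrite mem_undup mem_cat orbb.
  rewrite /op op_tk // /L /expand /= cats0 size_map size_iota /m' /mset eqxx //.
rewrite -scalerAl -!mulrA; congr (_ *: (_ * (_ * _))).
apply/commr_sym/commrX/commr_sym; apply: xp_comm; exact: cas_comm.
Qed.

End WVal.

Local Close Scope ring_scope.

(** * Cyclic words and their crossings *)

(** Counts the pairs of positions with [a] before [b]. Unlike a direct test for interleaving, this
    number is additive under concatenation up to a product of multiplicities, so that crossings
    become computations modulo 2. *)
Fixpoint inv (T : eqType) (a b : T) (s : seq T) :=
  if s is c :: s' then (c == a) * count_mem b s' + inv a b s' else 0.

Section CyclicWords.
Variable T : eqType.
Implicit Types (s t u v : seq T) (a b w : T).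

Definition crot s t := exists n, t = rot n s.

Lemma crot_refl s : crot s s. Proof. by exists 0; rewrite rot0. Qed.

Lemma crot_trans s t u : crot s t -> crot t u -> crot s u.
Proof. by move=> [n ->] [m ->]; rewrite rot_rot_add; eexists. Qed.

Lemma crot_cat u v : crot (u ++ v) (v ++ u).
Proof. by exists (size u); rewrite rot_size_cat. Qed.

Lemma crotP s t : crot s t -> exists u v, s = u ++ v /\ t = v ++ u.
Proof. by move=> [n ->]; exists (take n s), (drop n s); rewrite cat_take_drop. Qed.

Lemma crot_sym s t : crot s t -> crot t s.
Proof. by move=> /crotP[u [v [-> ->]]]; apply: crot_cat. Qed.

Lemma crot_perm s t : crot s t -> perm_eq s t.
Proof. by move=> [n ->]; rewrite perm_sym perm_rot. Qed.

Lemma crot_filter (P : pred T) s t : crot s t -> crot (filter P s) (filter P t).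
Proof. by move=> /crotP[u [v [-> ->]]]; rewrite !filter_cat; apply: crot_cat. Qed.

Lemma crot_rev s t : crot s t -> crot (rev s) (rev t).
Proof. by move=> /crotP[u [v [-> ->]]]; rewrite !rev_cat; apply: crot_cat. Qed.

Lemma crot_to a s : a \in s -> exists s', crot s (a :: s').
Proof. by move=> /rot_to[i s' E]; exists s', i. Qed.

Definition dih s t := crot s t \/ crot (rev s) t.

Lemma dih_sym s t : dih s t -> dih t s.
Proof.
by move=> [/crot_sym|/crot_rev/crot_sym]; rewrite ?revK; [left|right].
Qed.

Lemma dih_trans s t u : dih s t -> dih t u -> dih s u.
Proof.
move=> [st|st] [tu|tu].
- by left; apply: crot_trans st tu.
- by right; apply: crot_trans (crot_rev st) tu.
- by right; apply: crot_trans st tu.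
- by left; apply: crot_trans tu; move/crot_rev: st; rewrite revK.
Qed.

Lemma dih_perm s t : dih s t -> perm_eq s t.
Proof. by move=> [/crot_perm|/crot_perm] //; rewrite perm_rev. Qed.

Lemma inv_cat a b u v :
  inv a b (u ++ v) = inv a b u + inv a b v + count_mem a u * count_mem b v.
Proof. by elim: u => [|c u IH] /=; rewrite ?addn0 // IH count_cat; ring. Qed.

Lemma inv_rev a b s : inv a b (rev s) = inv b a s.
Proof.
elim: s => // c s IH; rewrite rev_cons -cats1 inv_cat IH /= count_rev; lia.
Qed.

Lemma inv_sum a b s : a != b -> inv a b s + inv b a s = count_mem a s * count_mem b s.
Proof.
move=> nab; elim: s => //= c s IH.
have [ca|_] := eqVneq c a; last by move: IH; lia.
by rewrite ca (negbTE nab); move: IH; lia.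
Qed.

Lemma inv_filter (P : pred T) a b s : P a -> P b -> inv a b (filter P s) = inv a b s.
Proof.
move=> Pa Pb; elim: s => //= c s IH; case: ifP => Pc /=; rewrite IH.
  rewrite count_filter; congr (_ * _ + _); apply: eq_count => q /=.
  by case: eqP => // ->; rewrite Pb.
by case: eqP => // E; rewrite E Pa in Pc.
Qed.

Lemma inv_map (T' : eqType) (f : T -> T') a b s :
  {in a :: b :: s &, injective f} -> inv (f a) (f b) (map f s) = inv a b s.
Proof.
elim: s => //= c s IH fi; rewrite IH; last first.
  have sub : {subset [:: a, b & s] <= [:: a, b, c & s]}.
    by move=> u; rewrite !inE => /or3P[] ->; rewrite ?orbT.
  by move=> u v /sub us /sub vs; apply: fi.
rewrite (inj_in_eq fi) ?inE ?eqxx ?orbT // count_map; congr (_ * _ + _).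
apply: eq_in_count => q qs /=; rewrite (inj_in_eq fi) ?inE ?eqxx ?qs ?orbT //.
Qed.

(* For a double occurrence word, [a] and [b] cross iff this holds. *)
Definition crs s a b := odd (inv a b s).

Lemma dow_count s a : dow s -> count_mem a s = 0 \/ count_mem a s = 2.
Proof.
move=> /dowP ds; have [/ds|/count_memPn] := boolP (a \in s); by [right|left].
Qed.

Lemma dow_odd u v a : dow (u ++ v) -> odd (count_mem a u) = odd (count_mem a v).
Proof.
by move=> /(dow_count a); rewrite count_cat => -[E|E];
  apply/eqP; rewrite -negb_add -oddD E.
Qed.

Lemma crs_catC u v a b : dow (u ++ v) -> crs (u ++ v) a b = crs (v ++ u) a b.
Proof.
move=> ds; rewrite /crs !inv_cat !oddD !oddM (dow_odd a ds) (dow_odd b ds).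
by rewrite [odd (inv a b u) (+) _]addbC.
Qed.

Lemma crs_crot s t a b : dow s -> crot s t -> crs s a b = crs t a b.
Proof. by move=> ds /crotP[u [v [E ->]]]; subst s; apply: crs_catC. Qed.

Lemma crs_sym s a b : dow s -> a != b -> crs s a b = crs s b a.
Proof.
move=> ds nab; apply/eqP; rewrite /crs -negb_add -oddD inv_sum //.
by rewrite oddM; case: (dow_count a ds) => ->.
Qed.

Lemma crs_rev s a b : dow s -> a != b -> crs (rev s) a b = crs s a b.
Proof. by move=> ds nab; rewrite [RHS]crs_sym // /crs inv_rev. Qed.

Lemma crs_filter (P : pred T) s a b : P a -> P b -> crs (filter P s) a b = crs s a b.
Proof. by move=> Pa Pb; rewrite /crs inv_filter. Qed.

Lemma dow_crot s t : crot s t -> dow s -> dow t.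
Proof. by move=> /crot_perm/dow_perm ->. Qed.

Lemma dow_filter (P : pred T) s : dow s -> dow (filter P s).
Proof.
move=> /dowP ds; apply/dowP => p; rewrite mem_filter => /andP[Pp /ds <-].
rewrite count_filter; apply: eq_count => q /=; by case: eqP => // ->; rewrite Pp.
Qed.

Lemma dow_split (v : T) s : dow s -> v \in s ->
  exists P A Q, [/\ s = P ++ v :: A ++ v :: Q, v \notin P, v \notin A & v \notin Q].
Proof.
move=> /dowP ds vs; have c2 := ds _ vs; case/path.splitP: vs c2 => P R.
rewrite cat_rcons count_cat /= eqxx => c2.
have [vP|/count_memPn vR] := boolP (v \in R).
  case/splitPr: vP c2 => A Q; rewrite count_cat /= eqxx => c2.
  by exists P, A, Q; split=> //; apply/count_memPn; lia.
have vP : v \in P by rewrite -has_pred1 has_count; lia.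
case/splitPr: vP c2 => A Q; rewrite count_cat /= eqxx => c2.
by exists A, Q, R; rewrite -catA; split=> //; apply/count_memPn; lia.
Qed.

Lemma dow_arcs (v : T) s : dow s -> v \in s ->
  exists A B, [/\ crot s (v :: A ++ v :: B), v \notin A & v \notin B].
Proof.
move=> ds /(dow_split ds)[P [A [Q [-> vP vA vQ]]]].
exists A, (Q ++ P); split=> //; last by rewrite mem_cat negb_or vQ.
have := crot_cat P (v :: A ++ v :: Q); by rewrite cat_cons -catA.
Qed.

Lemma crs_arc (v : T) A B b : v \notin A -> v \notin B -> dow (v :: A ++ v :: B) -> b != v ->
  crs (v :: A ++ v :: B) v b = odd (count_mem b A).
Proof.
move=> vA vB ds nbv; rewrite /crs /= eqxx inv_cat /= eqxx mul1n (count_memPn vA) mul0n.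
have i0 s : v \notin s -> inv v b s = 0.
  by elim: s => // c s IH; rewrite inE negb_or /= eq_sym => /andP[/negbTE -> /IH->].
rewrite !i0 // !count_cat /= eq_sym (negbTE nbv) !oddD /= !addbF.
by rewrite -addbA addbb addbF.
Qed.

(** Equality of labelled intersection graphs; isomorphisms are reduced to it by renaming chords. *)
Definition same_gr s t := perm_eq s t /\ forall a b, a != b -> crs s a b = crs t a b.

Lemma same_gr_sym s t : same_gr s t -> same_gr t s.
Proof. by move=> [pe H]; split=> [|a b nab]; rewrite 1?perm_sym // H. Qed.

Lemma same_gr_trans s t u : same_gr s t -> same_gr t u -> same_gr s u.
Proof.
move=> [pe H] [pe' H']; split=> [|a b nab]; first exact: perm_trans pe'.
by rewrite H // H'.
Qed.

Lemma same_gr_dih s t : dow s -> dih s t -> same_gr s t.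
Proof.
move=> ds H; split=> [|a b nab]; first exact: dih_perm.
case: H => H; first exact: crs_crot.
by rewrite -(crs_rev ds) //; apply: crs_crot => //; rewrite (dow_perm (v := s)) // perm_rev.
Qed.

Lemma same_gr_crot s t : dow s -> crot s t -> same_gr s t.
Proof. by move=> ds H; apply: same_gr_dih => //; left. Qed.

Lemma same_gr_filter (P : pred T) s t : same_gr s t -> same_gr (filter P s) (filter P t).
Proof.
move=> [pe H]; split=> [|a b nab]; first exact: perm_filter.
have [Pa|nPa] := boolP (P a); last first.
  have Z u : count_mem a (filter P u) = 0 by apply/count_memPn; rewrite mem_filter (negbTE nPa).
  have i0 u : inv a b (filter P u) = 0.
    elim: u => //= c u IH; case: ifP => //= Pc; rewrite IH.
    by case: eqP => // E; rewrite -E Pc in nPa.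
  by rewrite /crs !i0.
have [Pb|nPb] := boolP (P b); first by rewrite !crs_filter // H.
have i0 u : inv a b (filter P u) = 0.
  elim: u => //= c u IH; case: ifP => //= Pc; rewrite IH.
  by rewrite (_ : count_mem b _ = 0) ?muln0 //; apply/count_memPn; rewrite mem_filter (negbTE nPb).
by rewrite /crs !i0.
Qed.

(* Reversing the arc between the two ends of [w]: local complementation of the intersection graph at
   [w]; it preserves the cut function. *)
Definition lc w s :=
  let P := take (index w s) s in
  let R := drop (index w s).+1 s in
  let A := take (index w R) R in
  let Q := drop (index w R).+1 R in
  P ++ w :: rev A ++ w :: Q.

Lemma take_drop_index w P Q : w \notin P ->
  take (index w (P ++ w :: Q)) (P ++ w :: Q) = P /\
  drop (index w (P ++ w :: Q)).+1 (P ++ w :: Q) = Q.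
Proof.
move=> wP; rewrite index_cat (negbTE wP) /= eqxx addn0 take_size_cat //.
by rewrite -cat_rcons -[(size P).+1](size_rcons P w) drop_size_cat.
Qed.

Lemma lcE w P A Q : w \notin P -> w \notin A ->
  lc w (P ++ w :: A ++ w :: Q) = P ++ w :: rev A ++ w :: Q.
Proof.
move=> wP wA; rewrite /lc; have [-> ->] := take_drop_index (A ++ w :: Q) wP.
by have [-> ->] := take_drop_index Q wA.
Qed.

Lemma lc_perm w s : dow s -> w \in s -> perm_eq (lc w s) s.
Proof.
move=> ds /(dow_split ds)[P [A [Q [-> wP wA wQ]]]]; rewrite lcE //.
by rewrite perm_cat2l perm_cons perm_cat2r perm_rev.
Qed.

Lemma lcK w s : dow s -> w \in s -> lc w (lc w s) = s.
Proof.
move=> ds /(dow_split ds)[P [A [Q [-> wP wA wQ]]]].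
by rewrite lcE // lcE ?mem_rev // revK.
Qed.

Lemma crs_lcw w s a : dow s -> w \in s -> a != w -> crs (lc w s) w a = crs s w a.
Proof.
move=> ds /(dow_split ds)[P [A [Q [-> wP wA wQ]]]] naw; rewrite lcE //.
rewrite /crs !inv_cat /= !inv_cat /= !eqxx inv_rev !count_cat /= !count_rev.
have Z : inv w a A = 0 /\ inv a w A = 0.
  elim: A wA {ds} => // c A IH; rewrite inE negb_or => /andP[nwc wA]; have [/= -> ->] := IH wA.
  by rewrite (count_memPn wA) muln0 addn0 eq_sym (negbTE nwc).
by case: Z => -> ->.
Qed.

(** Reversing the arc [A] replaces the pairs counted by [inv a b A] with those of [inv b a A]. Their
    sum is the product of the multiplicities in [A], which is odd exactly if both chords cross
    [w]. *)
Lemma crs_lc w s a b : dow s -> w \in s -> a != w -> b != w -> a != b ->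
  crs (lc w s) a b = crs s a b (+) (crs s w a && crs s w b).
Proof.
move=> ds ws naw nbw nab; have [P [A [Q [E wP wA wQ]]]] := dow_split ds ws.
have cw c : c != w -> crs s w c = odd (count_mem c A).
  move=> ncw; rewrite (@crs_crot _ (w :: A ++ w :: (Q ++ P))) //.
    apply: crs_arc => //; first by rewrite mem_cat negb_or wQ.
    apply: dow_crot ds; rewrite E; have := crot_cat P (w :: A ++ w :: Q); by rewrite cat_cons -catA.
  rewrite E; have := crot_cat P (w :: A ++ w :: Q); by rewrite cat_cons -catA.
rewrite !cw // E lcE // -oddM.
have := inv_sum A nab.
rewrite /crs !inv_cat /= !inv_cat /= !(eq_sym w) (negbTE naw) (negbTE nbw).
rewrite inv_rev !count_cat /= !count_rev (eq_sym w) (negbTE nbw) => H.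
rewrite -H !mul0n !add0n !oddD; do !case: (odd _) => //=.
Qed.

Lemma same_gr_lc w s t : dow s -> w \in s -> same_gr s t -> same_gr (lc w s) (lc w t).
Proof.
move=> ds ws [pe H]; have dt : dow t by rewrite -(dow_perm pe).
have wt : w \in t by rewrite -(perm_mem pe).
split=> [|a b nab].
  by rewrite (perm_trans (lc_perm ds ws)) // perm_sym (perm_trans (lc_perm dt wt)) // perm_sym.
have dls : dow (lc w s) by rewrite (dow_perm (lc_perm ds ws)).
have dlt : dow (lc w t) by rewrite (dow_perm (lc_perm dt wt)).
have [E|naw] := eqVneq a w.
  by rewrite E in nab *; rewrite !crs_lcw // 1?eq_sym // H.
have [E|nbw] := eqVneq b w.
  by rewrite E in nab *; rewrite crs_sym // [RHS]crs_sym // !crs_lcw // H // eq_sym.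
by rewrite !crs_lc // !H // eq_sym.
Qed.

Lemma split_uniq w A B A' B' : w \notin A -> w \notin A' ->
  A ++ w :: B = A' ++ w :: B' -> A = A' /\ B = B'.
Proof.
move=> wA wA' E; have [t1 t2] := take_drop_index B wA.
have [u1 u2] := take_drop_index B' wA'.
by split; [rewrite -t1 E u1|rewrite -t2 E u2].
Qed.

Lemma crot_arcs w A B A' B' : w \notin A -> w \notin B -> w \notin A' -> w \notin B' ->
  crot (w :: A ++ w :: B) (w :: A' ++ w :: B') ->
  (A' = A /\ B' = B) \/ (A' = B /\ B' = A).
Proof.
move=> wA wB wA' wB' /crotP[u0 [v0 [E0 E0']]].
have same : w :: A' ++ w :: B' = w :: A ++ w :: B -> (A' = A /\ B' = B) \/ (A' = B /\ B' = A).
  by move=> [E]; left; apply: split_uniq E.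
case: u0 E0 E0' => [|c u] E0 E0'; first by apply: same; rewrite E0' E0 cats0.
case: v0 E0 E0' => [|d v] E0 E0'; first by apply: same; rewrite E0' E0 cats0.
case: E0 => cE E; case: E0' => dE E'; subst c d; right.
have wu : w \notin u.
  apply/count_memPn; have := congr1 (count_mem w) E.
  by rewrite !count_cat /= !eqxx (count_memPn wA) (count_memPn wB); lia.
have wv : w \notin v.
  apply/count_memPn; have := congr1 (count_mem w) E'.
  by rewrite !count_cat /= !eqxx (count_memPn wA') (count_memPn wB'); lia.
have [-> ->] := split_uniq wA' wv E'.
by have [-> ->] := split_uniq wA wu E.
Qed.

(** Reversing the other arc of [w] instead yields the mirror image, so up to [dih] it does not
    matter which of the two arcs is called [A]. *)
Lemma lc_arcs w s A B : w \notin A -> w \notin B -> dow s -> crot s (w :: A ++ w :: B) ->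
  dih (lc w s) (w :: rev A ++ w :: B).
Proof.
move=> wA wB ds cs.
have ws : w \in s by rewrite (perm_mem (crot_perm cs)) mem_head.
have [P [A' [Q [E wP wA' wQ]]]] := dow_split ds ws.
rewrite E lcE //.
have c1 : crot (P ++ w :: rev A' ++ w :: Q) (w :: rev A' ++ w :: (Q ++ P)).
  by have := crot_cat P (w :: rev A' ++ w :: Q); rewrite cat_cons -catA.
have c2 : crot (w :: A ++ w :: B) (w :: A' ++ w :: (Q ++ P)).
  apply: crot_trans (crot_sym cs) _; rewrite E.
  by have := crot_cat P (w :: A' ++ w :: Q); rewrite cat_cons -catA.
have wQP : w \notin Q ++ P by rewrite mem_cat negb_or wQ.
have [[E1 E2]|[E1 E2]] := crot_arcs wA wB wA' wQP c2.
  by left; rewrite -E1 -E2.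
right; apply: crot_trans (crot_rev c1) _; rewrite E1 E2.
rewrite rev_cons rev_cat rev_cons revK -cats1 -catA -cats1 -catA /=.
have := crot_cat (rev A ++ w :: B) [:: w]; by rewrite -catA.
Qed.

Lemma lc_dih w s t : dow s -> w \in s -> dih s t -> dih (lc w s) (lc w t).
Proof.
move=> ds ws st; have [A [B [cs wA wB]]] := dow_arcs ds ws.
have dt : dow t by rewrite -(dow_perm (dih_perm st)).
apply: dih_trans (lc_arcs wA wB ds cs) _; apply: dih_sym.
case: st => st; first exact: lc_arcs (crot_trans (crot_sym st) cs).
have ct : crot t (w :: rev A ++ w :: rev B).
  apply: crot_trans (crot_sym st) _; apply: crot_trans (crot_rev cs) _.
  rewrite rev_cons rev_cat rev_cons -!cats1 -!catA /=.
  apply: crot_trans (crot_cat (rev B) _) _ => /=.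
  by rewrite -catA; apply: crot_refl.
apply: dih_trans (lc_arcs _ _ dt ct) _; rewrite ?mem_rev // revK; right.
rewrite rev_cons rev_cat rev_cons revK -!cats1 -!catA /=.
apply: crot_trans (crot_cat B _) _ => /=; rewrite -catA; exact: crot_refl.
Qed.

Lemma lc_mem w s : dow s -> w \in s -> lc w s =i s.
Proof. by move=> ds ws; apply/perm_mem/lc_perm. Qed.

Lemma lc_dow w s : dow s -> w \in s -> dow (lc w s).
Proof. by move=> ds ws; rewrite (dow_perm (lc_perm ds ws)). Qed.

Lemma dih_of_lc w s t : dow s -> w \in s -> perm_eq s t -> dih (lc w s) (lc w t) -> dih s t.
Proof.
move=> ds ws pe H; have dt : dow t by rewrite -(dow_perm pe).
have wt : w \in t by rewrite -(perm_mem pe).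
by rewrite -(lcK ds ws) -(lcK dt wt); apply: lc_dih; rewrite ?lc_mem // lc_dow.
Qed.

End CyclicWords.

(** * Splitting a vertex of a prime 4-regular multigraph *)

Section Multigraph.
Variables (T : eqType) (E : seq (T * T)).
Implicit Types (X Y : pred T) (u v p q r t : T).

Definition cutE X := count (fun e => X e.1 != X e.2) E.

(** The edges at [v] are left out: what remains is the part of the cut common to all three
    splittings of [v]. *)
Definition cutE' v X := count (fun e => [&& e.1 != v, e.2 != v & X e.1 != X e.2]) E.

Definition nbr v := [seq e.2 | e <- E & e.1 == v] ++ [seq e.1 | e <- E & e.2 == v].

Lemma cutE_nbr v X : cutE X = cutE' v X + count (fun u => X u != X v) (nbr v).
Proof.
rewrite /cutE /cutE' /nbr; elim: E => //= e E' ->; rewrite !count_cat.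
have [E1|_] := eqVneq e.1 v; have [E2|_] := eqVneq e.2 v => /=;
  rewrite ?E1 ?E2 ?eqxx /= ?(eq_sym (X v)); lia.
Qed.

Lemma nbr_sym u v : (u \in nbr v) = (v \in nbr u).
Proof.
have H w z : w \in nbr z -> z \in nbr w.
  rewrite !mem_cat => /orP[] /mapP[[a b]]; rewrite mem_filter /= => /andP[/eqP-> ab] ->.
    by apply/orP; right; apply/mapP; exists (z, b) => //; rewrite mem_filter eqxx.
  by apply/orP; left; apply/mapP; exists (a, z) => //; rewrite mem_filter eqxx.
by apply/idP/idP; apply: H.
Qed.

Lemma count_le2 (S : Type) (s : seq S) (P1 P2 Q1 Q2 : pred S) :
  (forall e, P1 e + P2 e <= Q1 e + Q2 e) ->
  count P1 s + count P2 s <= count Q1 s + count Q2 s.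
Proof. by move=> H; elim: s => //= e s IH; have := H e; lia. Qed.

(** Submodularity for two opposite quadrants of [X] and [Y]. Taking [v] out of the second one is
    free, since edges at [v] are not counted. *)
Lemma uncut v X Y :
  cutE' v (fun u => X u && Y u) + cutE' v (fun u => [&& ~~ X u, ~~ Y u & u != v])
   <= cutE' v X + cutE' v Y.
Proof.
apply: count_le2 => e; case: eqP => //= _; case: eqP => //= _.
by case: (X e.1); case: (X e.2); case: (Y e.1); case: (Y e.2).
Qed.

Lemma count_subset (l s : seq T) : uniq s -> uniq l -> {subset l <= s} ->
  count (mem l) s = size l.
Proof.
move=> us ul ls; rewrite -size_filter; apply: perm_size.
apply: uniq_perm; rewrite ?filter_uniq // => u; rewrite mem_filter /=.
by case: (boolP (u \in l)) => // /ls ->.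
Qed.

Lemma perm4 (s : seq T) (a b c : T) : uniq s -> size s = 4 ->
  uniq [:: a; b; c] -> {subset [:: a; b; c] <= s} ->
  exists d, perm_eq s [:: a; b; c; d].
Proof.
move=> us ss uabc sub; have c3 := count_subset us uabc sub.
have := count_predC (mem [:: a; b; c]) s; rewrite ss c3 => /= -[c1].
have : size (filter (predC (mem [:: a; b; c])) s) = 1 by rewrite size_filter.
case Ef: (filter _ _) => [|d [|? ?]] // _; exists d.
have pf := perm_filterC (mem [:: a; b; c]) s; rewrite Ef in pf.
rewrite -pf -[[:: a; b; c; d]]/([:: a; b; c] ++ [:: d]) perm_cat2r.
apply: uniq_perm; rewrite ?filter_uniq // => u; rewrite mem_filter.
by apply/andP/idP => [[]//|H]; split=> //; exact: sub.
Qed.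

Variable V : seq T.
Hypotheses (uV : uniq V) (VE : {in E, forall e, (e.1 \in V) && (e.2 \in V)}).
Hypothesis reg : {in V, forall v, size (nbr v) = 4}.
Hypothesis prE : forall X, 1 < count X V -> 1 < count (predC X) V -> 6 <= cutE X.
Hypothesis V4 : 4 <= size V.

Lemma nbrV v : {subset nbr v <= V}.
Proof.
move=> u; rewrite mem_cat => /orP[] /mapP[e]; rewrite mem_filter => /andP[_ /VE/andP[]] ? ? -> //.
Qed.

Lemma eq_cutE X Y : {in V, X =1 Y} -> cutE X = cutE Y.
Proof. by move=> H; apply: eq_in_count => e /VE/andP[e1 e2]; rewrite !H. Qed.

Lemma two_in (X : pred T) u v : u \in V -> v \in V -> u != v -> X u -> X v -> 1 < count X V.
Proof.
move=> uiV viV nuv Xu Xv; rewrite -size_filter.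
have : uniq [:: u; v] by rewrite /= inE nuv.
move/uniq_leq_size; apply=> w; rewrite !inE mem_filter => /orP[]/eqP->; by rewrite ?Xu ?Xv.
Qed.

Lemma small_in (X : pred T) p : p \in V -> X p -> ~~ (1 < count X V) ->
  {in V, forall u, X u -> u = p}.
Proof.
move=> pV Xp H u uiV Xu; apply/eqP; apply: contraNT H => nup; exact: (two_in uiV pV).
Qed.

(** Two vertices joined by [k] edges have a cut of at most [8 - 2 * k], and loops lower it further,
    while primeness demands at least six. *)
Lemma prime_simple v : v \in V -> v \notin nbr v /\ uniq (nbr v).
Proof.
have loop a : a \in V -> cutE (pred1 a) + count_mem a (nbr a) = 4.
  move=> aV; rewrite (cutE_nbr a) /= eqxx (_ : cutE' _ _ = 0); last first.
    apply/eqP; rewrite -leqn0 leqNgt -has_count; apply/hasPn => e _ /=.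
    by case: (e.1 == a); case: (e.2 == a).
  have := count_predC (pred1 a) (nbr a); rewrite (reg aV) => <-.
  rewrite add0n addnC; congr (_ + _); apply: eq_count => u /=; by case: (u == a).
have pair a b : a \in V -> b \in V -> a != b ->
   count_mem a (nbr a) + count_mem b (nbr b) + 2 * count_mem b (nbr a) <= 2.
  move=> aV bV nab; have la := loop a aV; have lb := loop b bV.
  have e1 := cutE_nbr a (pred1 b); have e2 := cutE_nbr a (pred2 a b).
  have e3 : cutE' a (pred1 b) = cutE' a (pred2 a b).
    by apply: eq_count => e /=; case: eqP => //= _; case: eqP.
  have e4 : 6 <= cutE (pred2 a b).
    apply: prE; first by apply: (two_in aV bV) => //=; rewrite eqxx ?orbT.
    have c2 : count (mem [:: a; b]) V = 2.
      by rewrite count_subset //= ?inE ?nab // => u; rewrite !inE => /orP[]/eqP->.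
    have := count_predC (mem [:: a; b]) V; rewrite c2 => c4.
    rewrite (eq_count (a2 := predC (mem [:: a; b]))); last by move=> u /=; rewrite !inE.
    lia.
  rewrite /= (negbTE nab) in e1; rewrite /= eqxx /= in e2.
  have e5 : count (fun u => (u == b) != false) (nbr a) = count_mem b (nbr a).
    by apply: eq_count => u /=; case: (u == b).
  have e6 : count (fun u => ((u == a) || (u == b)) != true) (nbr a) + count_mem a (nbr a)
      + count_mem b (nbr a) = 4.
    rewrite -(reg aV); elim: (nbr a) => //= u s <-.
    have [->|nua] := eqVneq u a; first by rewrite (negbTE nab) /=; lia.
    by case: (u == b) => /=; lia.
  rewrite e5 in e1; lia.
move=> vV.
have l0 : count_mem v (nbr v) = 0.
  have [E0|n0] := eqVneq (count_mem v (nbr v)) 0; first by [].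
  have : exists2 b, b \in nbr v & b != v.
    apply/hasP; rewrite has_count.
    have := count_predC (pred1 v) (nbr v); rewrite (reg vV) => c4.
    have [b bV nbv] : exists2 b, b \in V & b != v.
      apply/hasP; rewrite has_count; have := count_predC (pred1 v) V.
      rewrite (count_uniq_mem _ uV) vV => c5.
      by rewrite (eq_count (a2 := predC (pred1 v))) //; lia.
    have := pair v b vV bV; rewrite eq_sym nbv => /(_ isT) H.
    by rewrite (eq_count (a2 := predC (pred1 v))) //; lia.
  move=> [b bn nbv]; have := pair v b vV (nbrV bn); rewrite eq_sym nbv => /(_ isT).
  by move: bn; rewrite -has_pred1 has_count; lia.
split; first by apply/count_memPn.
apply: count_mem_uniq => b; have [bn|/count_memPn //] := boolP (b \in nbr v).
have nbv : v != b by apply: contraTneq bn => <-; apply/count_memPn.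
have := pair v b vV (nbrV bn) nbv; move: bn; rewrite -has_pred1 has_count; lia.
Qed.

Lemma nbr_neq u v : v \in V -> u \in nbr v -> u != v.
Proof. by move=> vV; have [n _] := prime_simple vV; apply: contraTneq => ->. Qed.

Lemma cut1 v : v \in V -> cutE (pred1 v) = 4.
Proof.
move=> vV; rewrite (cutE_nbr v) (_ : cutE' _ _ = 0); last first.
  apply/eqP; rewrite -leqn0 leqNgt -has_count; apply/hasPn => e _ /=.
  by case: (e.1 == v); case: (e.2 == v).
rewrite -(reg vV); apply/eqP; rewrite -all_count; apply/allP => u un /=.
by rewrite eqxx (negbTE (nbr_neq vV un)).
Qed.

Lemma toggle v X : v \in V -> ~~ X v ->
  cutE (predU1 v X) + count X (nbr v) = cutE X + count (predC X) (nbr v).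
Proof.
move=> vV /negbTE Xv; rewrite (cutE_nbr v X) (cutE_nbr v (predU1 v X)) /= eqxx Xv.
have -> : cutE' v (predU1 v X) = cutE' v X.
  by apply: eq_count => e /=; case: eqP => //= _; case: eqP.
have -> : count (fun u => ((u == v) || X u) != true) (nbr v) = count (predC X) (nbr v).
  by apply: eq_in_count => u un /=; rewrite (negbTE (nbr_neq vV un)); case: (X u).
have -> : count (fun u => X u != false) (nbr v) = count X (nbr v).
  by apply: eq_count => u; case: (X u).
lia.
Qed.

(* A bad set obstructs the splitting of [v] that joins [p] to [q] and [r] to [t]: the multigraph so
   obtained is no longer prime. *)
Definition bad v p q r t := exists X : pred T,
  [/\ ~~ X v, [&& X p, X q, ~~ X r & ~~ X t], 1 < count X V,
      1 < count (fun u => ~~ X u && (u != v)) V & cutE' v X <= 4].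

Lemma badC v p q r t : bad v p q r t -> bad v q p r t.
Proof.
move=> [X [a /and4P[b1 b2 b3 b4] c d e]]; exists X; split=> //.
by rewrite b1 b2 b3 b4.
Qed.

Lemma badS v p q r t : p != v -> q != v -> r != v -> t != v -> bad v p q r t -> bad v r t p q.
Proof.
move=> np nq nr nt [X [a /and4P[b1 b2 b3 b4] c d e]].
exists (fun u => ~~ X u && (u != v)); split=> //.
- by rewrite eqxx andbF.
- by rewrite b1 b2 b3 b4 nr nt.
- apply: leq_trans c _; apply: sub_count => u Xu.
  by rewrite Xu /=; apply: contraNneq a => <-.
apply: leq_trans e; apply: sub_count => w /=; case: eqP => //= _; case: eqP => //= _.
by rewrite !andbT; case: (X w.1); case: (X w.2).
Qed.

Lemma perm_nbr v l : v \in V -> perm_eq (nbr v) l ->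
  uniq l /\ {in l, forall u, [/\ u != v, u \in V & v \in nbr u]}.
Proof.
move=> vV pe; have [vn un] := prime_simple vV; rewrite -(perm_uniq pe); split=> // u.
by rewrite -(perm_mem pe) => ul; rewrite nbr_sym ul (nbr_neq vV ul) (nbrV ul).
Qed.

Lemma count_perm4 v X a b c d : perm_eq (nbr v) [:: a; b; c; d] ->
  count X (nbr v) = X a + X b + X c + X d.
Proof. by move=> /permP->; rewrite /=; lia. Qed.

(** Here [X] consists of [p] and [q] alone. With the two edges to [v] added, its cut is at most six,
    whereas two non-adjacent vertices have a cut of eight. *)
Lemma small_adj v p q r t X : v \in V -> perm_eq (nbr v) [:: p; q; r; t] ->
  ~~ X v -> [&& X p, X q, ~~ X r & ~~ X t] -> cutE' v X <= 4 ->
  {in V, forall u, X u -> (u == p) || (u == q)} -> q \in nbr p.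
Proof.
move=> vV pe nXv /and4P[Xp Xq nXr nXt] c4 sub.
have [/= /and3P[U _ _] nb] := perm_nbr vV pe.
have [npv pV vp] : [/\ p != v, p \in V & v \in nbr p] by apply: nb; rewrite inE eqxx.
have [nqv qV vq] : [/\ q != v, q \in V & v \in nbr q] by apply: nb; rewrite !inE eqxx orbT.
have npq : p != q by move: U; rewrite inE negb_or => /andP[].
have e1 := cutE_nbr v X; rewrite (count_perm4 _ pe) (negbTE nXv) Xp Xq (negbTE nXr) (negbTE nXt) /= in e1.
have e2 : cutE X = cutE (predU1 p (pred1 q)).
  apply: eq_cutE => u uV'; rewrite /=; apply/idP/idP; first exact: sub.
  by case/orP => /eqP->.
have e3 : cutE X + count_mem q (nbr p) = 4 + count (predC (pred1 q)) (nbr p).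
  by rewrite e2 -(cut1 qV); apply: toggle.
have e4 := count_predC (pred1 q) (nbr p); rewrite (reg pV) in e4.
rewrite -has_pred1 has_count; clear -e1 e3 e4 c4; lia.
Qed.

(** The bad sets divide the vertices other than [v] into four quadrants, each containing one
    neighbour of [v]. Two quadrants that are not opposite turn out to be single vertices; together
    they form one of the bad sets or a complement, and [small_adj] applies. *)
Lemma uncross v p q r t : v \in V -> perm_eq (nbr v) [:: p; q; r; t] ->
  bad v p q r t -> bad v p r q t ->
  [|| q \in nbr p, t \in nbr r, r \in nbr p | t \in nbr q].
Proof.
move=> vV pe [X [nXv Xn X1 X2 Xc]] [Y [nYv Yn Y1 Y2 Yc]].
have := Xn => /and4P[Xp Xq nXr nXt]; have := Yn => /and4P[Yp Yr nYq nYt].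
have [] := perm_nbr vV pe; rewrite /= !inE !negb_or => /and4P[/and3P[npq npr npt] /andP[nqr nqt] nrt _] nb.
have [npv pV vp] : [/\ p != v, p \in V & v \in nbr p] by apply: nb; rewrite inE eqxx.
have [nqv qV vq] : [/\ q != v, q \in V & v \in nbr q] by apply: nb; rewrite !inE eqxx orbT.
have [nrv rV vr] : [/\ r != v, r \in V & v \in nbr r] by apply: nb; rewrite !inE eqxx !orbT.
have [ntv tV vt] : [/\ t != v, t \in V & v \in nbr t] by apply: nb; rewrite !inE eqxx !orbT.
have bX : bad v p q r t by exists X.
have bY : bad v p r q t by exists Y.
(* Of two opposite quadrants one has a cut below 6, hence is a single vertex. *)
have quad (X' Y' : pred T) p' q' r' t' : perm_eq (nbr v) [:: p'; q'; r'; t'] ->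
   p' \in V -> q' \in V -> r' \in V -> t' \in V -> p' != v -> q' != v -> t' != v -> r' != v ->
   q' != r' -> ~~ X' v -> ~~ Y' v ->
   [&& X' p', X' q', ~~ X' r' & ~~ X' t'] -> [&& Y' p', Y' r', ~~ Y' q' & ~~ Y' t'] ->
   cutE' v X' <= 4 -> cutE' v Y' <= 4 ->
   {in V, forall u, X' u -> Y' u -> u = p'} \/ {in V, forall u, ~~ X' u -> ~~ Y' u -> u != v -> u = t'}.
  move=> pe' pV' qV' rV' tV' npv' nqv' ntv' nrv' nqr' nX nY /and4P[Xp' Xq' Xr' Xt'] /and4P[Yp' Yr' Yq' Yt'] cX cY.
  pose S1 : pred T := fun u => X' u && Y' u.
  pose S2 : pred T := fun u => [&& ~~ X' u, ~~ Y' u & u != v].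
  have U : cutE' v S1 + cutE' v S2 <= cutE' v X' + cutE' v Y' := uncut v X' Y'.
  have e1 : cutE S1 = cutE' v S1 + 1.
    rewrite (cutE_nbr v) (count_perm4 _ pe') /S1 (negbTE nX) Xp' Yp' (negbTE Yq').
    by rewrite (negbTE Xr') (negbTE Xt') andbF.
  have e2 : cutE S2 = cutE' v S2 + 1.
    rewrite (cutE_nbr v) (count_perm4 _ pe') /S2 eqxx !andbF Xp' Xq' Yr'.
    by rewrite (negbTE Xt') (negbTE Yt') (negbTE Xr') ntv'.
  have [c1|c1] := leqP (cutE S1) 5.
    left=> u uV' Xu Yu; apply: (small_in (X := S1)) pV' _ _ _ uV' _ => //.
    - by rewrite /S1 Xp' Yp'.
    - apply/negP => c2; suff c3 : 1 < count (predC S1) V.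
        by have := leq_trans (prE c2 c3) c1.
      by apply: (two_in qV' rV' nqr') => /=; rewrite /S1 ?(negbTE Yq') ?(negbTE Xr') ?andbF.
    - by rewrite /S1 Xu Yu.
  have c3 : cutE S2 <= 5 by clear -c1 U e1 e2 cX cY; lia.
  right=> u uV' Xu Yu nuv.
  apply: (small_in (X := S2)) tV' _ _ _ uV' _ => //.
  - by rewrite /S2 Xt' Yt' ntv'.
  - apply/negP => c2; suff c4 : 1 < count (predC S2) V.
      by have := leq_trans (prE c2 c4) c3.
    by apply: (two_in pV' vV npv') => /=; rewrite /S2 ?Xp' ?eqxx ?andbF.
  - by rewrite /S2 Xu Yu nuv.
have pe2 : perm_eq (nbr v) [:: q; p; t; r].
  apply: perm_trans pe _; by apply/permP => P /=; genlia.
(* Passing from [Y] to its complement without [v] turns the other two quadrants into an opposite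
   pair to which [quad] applies. *)
pose Yc' : pred T := fun u => ~~ Y u && (u != v).
have cYc : cutE' v Yc' <= 4.
  apply: leq_trans Yc; apply: sub_count => w /=; rewrite /Yc'.
  by case: (w.1 == v); case: (w.2 == v); case: (Y w.1); case: (Y w.2).
pose Xc' : pred T := fun u => ~~ X u && (u != v).
have cXc : cutE' v Xc' <= 4.
  apply: leq_trans Xc; apply: sub_count => w /=; rewrite /Xc'.
  by case: (w.1 == v); case: (w.2 == v); case: (X w.1); case: (X w.2).
have nYc : ~~ Yc' v by rewrite /Yc' eqxx andbF.
have nXc : ~~ Xc' v by rewrite /Xc' eqxx andbF.
have Q1 := quad X Y p q r t pe pV qV rV tV npv nqv ntv nrv nqr nXv nYv Xn Yn Xc Yc.
have Q2 : {in V, forall u, X u -> Yc' u -> u = q} \/ {in V, forall u, ~~ X u -> ~~ Yc' u -> u != v -> u = r}.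
  apply: (quad X Yc' q p t r) => //.
  - by rewrite Xq Xp nXr nXt.
  - by rewrite /Yc' nYq nqv nYt ntv Yp Yr.
have pe3 : perm_eq (nbr v) [:: p; r; q; t].
  apply: perm_trans pe _; by apply/permP => P /=; genlia.
have pe4 : perm_eq (nbr v) [:: r; t; p; q].
  apply: perm_trans pe _; by apply/permP => P /=; genlia.
have pe5 : perm_eq (nbr v) [:: q; t; p; r].
  apply: perm_trans pe _; by apply/permP => P /=; genlia.
case: Q1 => Q1; case: Q2 => Q2.
- rewrite (small_adj vV pe nXv Xn Xc) // => u uV' Xu.
  have [Yu|nYu] := boolP (Y u); first by rewrite (Q1 u) ?eqxx.
  rewrite (Q2 u) ?eqxx ?orbT // /Yc' nYu; by apply: contraNneq nXv => <-.
- rewrite (small_adj vV pe3 nYv Yn Yc) ?orbT // => u uV' Yu.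
  have [Xu|nXu] := boolP (X u); first by rewrite (Q1 u) ?eqxx.
  rewrite (Q2 u) ?eqxx ?orbT // /Yc' ?Yu //; by apply: contraNneq nYv => <-.
- rewrite (small_adj vV pe5 nYc _ cYc) ?orbT //; first by rewrite /Yc' nYq nYt nqv ntv Yp Yr.
  move=> u uV' /andP[nYu nuv]; have [Xu|nXu] := boolP (X u).
    by rewrite (Q2 u) ?eqxx // /Yc' nYu.
  by rewrite (Q1 u) ?eqxx ?orbT.
rewrite (small_adj vV pe4 nXc _ cXc) ?orbT //; first by rewrite /Xc' nXr nXt nrv ntv Xp Xq.
move=> u uV' /andP[nXu nuv]; have [Yu|nYu] := boolP (Y u).
  by rewrite (Q2 u) ?eqxx // /Yc' Yu.
by rewrite (Q1 u) ?eqxx ?orbT.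
Qed.

(** Three neighbours [v], [b], [c] of [a] lie outside the bad set, so removing [a] from it lowers
    the cut to at most 4. Then only [d] is left in it, and a cut of 4 forces the fourth edge of [a]
    to end there. *)
Lemma center v a b c d : v \in V -> perm_eq (nbr v) [:: a; b; c; d] ->
  b \in nbr a -> c \in nbr a -> bad v a d b c -> d \in nbr a.
Proof.
move=> vV pe ba ca [X [nXv /and4P[Xa Xd nXb nXc] X1 X2 Xc]].
have [] := perm_nbr vV pe; rewrite /= !inE !negb_or => /and4P[/and3P[nab nac nad] /andP[nbc nbd] ncd _] nb.
have [nav aV va] : [/\ a != v, a \in V & v \in nbr a] by apply: nb; rewrite inE eqxx.
have [nbv bV vb] : [/\ b != v, b \in V & v \in nbr b] by apply: nb; rewrite !inE eqxx orbT.
have [ncv cV vc] : [/\ c != v, c \in V & v \in nbr c] by apply: nb; rewrite !inE eqxx !orbT.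
have [ndv dV vd] : [/\ d != v, d \in V & v \in nbr d] by apply: nb; rewrite !inE eqxx !orbT.
have [nna una] := prime_simple aV.
have [a' pa] : exists a', perm_eq (nbr a) [:: v; b; c; a'].
  apply: perm4 => //; first exact: reg.
    by rewrite /= !inE negb_or ![v == _]eq_sym nbv ncv nbc.
  by move=> u; rewrite !inE => /or3P[]/eqP->.
have a'n : a' \in nbr a by rewrite (perm_mem pa) !inE eqxx !orbT.
have a'V := nbrV a'n; have na'a := nbr_neq aV a'n.
pose X' : pred T := fun u => X u && (u != a).
have e1 : cutE X = cutE' v X + 2.
  by rewrite (cutE_nbr v) (count_perm4 _ pe) (negbTE nXv) Xa Xd (negbTE nXb) (negbTE nXc).
have nX'a : ~~ X' a by rewrite /X' eqxx andbF.
have e3 : cutE (predU1 a X') = cutE X.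
  by apply: eq_cutE => u _; rewrite /= /X'; case: eqP => [->|_]; rewrite ?andbT.
have e2 := toggle aV nX'a.
rewrite e3 !(count_perm4 _ pa) /= /X' (negbTE nXv) (negbTE nXb) (negbTE nXc) /= na'a andbT -/X' in e2.
have c2 : 1 < count (predC X') V.
  by apply: (two_in vV bV); rewrite /= /X' ?(negbTE nXv) ?(negbTE nXb) // eq_sym.
have X'd : X' d by rewrite /X' Xd eq_sym.
have [Xa'|nXa'] := boolP (X a').
  rewrite Xa' /= in e2.
  have H : ~~ (1 < count X' V).
    by apply/negP => c1; have := prE c1 c2; clear -e1 e2 Xc; lia.
  have : a' = d by apply: (small_in dV X'd H a'V); rewrite /X' Xa'.
  by move=> <-.
rewrite (negbTE nXa') /= in e2.
have H : ~~ (1 < count X' V).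
  by apply/negP => c1; have := prE c1 c2; clear -e1 e2 Xc; lia.
have : cutE X' = 4.
  rewrite -(cut1 dV); apply: eq_cutE => u uV' /=; apply/idP/eqP => [X'u|->//].
  exact: (small_in dV X'd H uV').
by clear -e1 e2 Xc; lia.
Qed.

Definition irred v := exists p q r t,
  [/\ perm_eq (nbr v) [:: p; q; r; t], bad v p q r t, bad v p r q t & bad v p t q r].

Lemma irred_two v p q r t : v \in V -> perm_eq (nbr v) [:: p; q; r; t] -> bad v p t q r ->
  (q \in nbr p) || (t \in nbr r) -> (r \in nbr p) || (t \in nbr q) ->
  exists a b c d, perm_eq (nbr v) [:: a; b; c; d] /\ {subset [:: b; c; d] <= nbr a}.
Proof.
move=> vV pe b3.
have [_ nb] := perm_nbr vV pe.
have npv : p != v by have [] := nb p; rewrite ?inE ?eqxx.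
have nqv : q != v by have [] := nb q; rewrite ?inE ?eqxx ?orbT.
have nrv : r != v by have [] := nb r; rewrite ?inE ?eqxx ?orbT.
have ntv : t != v by have [] := nb t; rewrite ?inE ?eqxx ?orbT.
have b3s : bad v q r p t by apply: badS.
have fin a b c d : perm_eq (nbr v) [:: a; b; c; d] -> bad v a d b c ->
    b \in nbr a -> c \in nbr a ->
    exists a b c d, perm_eq (nbr v) [:: a; b; c; d] /\ {subset [:: b; c; d] <= nbr a}.
  move=> pe' bd ba ca; exists a, b, c, d; split=> // u; rewrite !inE => /or3P[]/eqP-> //.
  exact: center pe' ba ca bd.
have sw p' q' r' t' : bad v p' q' r' t' -> bad v p' q' t' r'.
  move=> [X [x1 /and4P[x2 x3 x4 x5] x6 x7 x8]].
  by exists X; split=> //; rewrite x2 x3 x4 x5.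
case/orP => A1; case/orP => A2.
- exact: fin pe b3 A1 A2.
- have pe' : perm_eq (nbr v) [:: q; p; t; r].
    by apply: perm_trans pe _; apply/permP => P /=; genlia.
  by apply: fin pe' b3s _ A2; rewrite nbr_sym.
- have pe' : perm_eq (nbr v) [:: r; t; p; q].
    by apply: perm_trans pe _; apply/permP => P /=; genlia.
  by apply: fin pe' (sw _ _ _ _ (badC b3s)) A1 _; rewrite nbr_sym.
have pe' : perm_eq (nbr v) [:: t; r; q; p].
  by apply: perm_trans pe _; apply/permP => P /=; genlia.
by apply: fin pe' (sw _ _ _ _ (badC b3)) _ _; rewrite nbr_sym.
Qed.

(** Applied to each two of the three bad sets, [uncross] yields adjacencies belonging to two
    different pairings. These share a vertex, and [center] joins it to the remaining neighbour as
    well. *)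
Lemma irred_center v : v \in V -> irred v ->
  exists a b c d, perm_eq (nbr v) [:: a; b; c; d] /\ {subset [:: b; c; d] <= nbr a}.
Proof.
move=> vV [p [q [r [t [pe b1 b2 b3]]]]].
have two := irred_two vV.
have sw p' q' r' t' : bad v p' q' r' t' -> bad v p' q' t' r'.
  move=> [X [x1 /and4P[x2 x3 x4 x5] x6 x7 x8]].
  by exists X; split=> //; rewrite x2 x3 x4 x5.
have pe2 : perm_eq (nbr v) [:: p; q; t; r].
  by apply: perm_trans pe _; apply/permP => P /=; genlia.
have pe3 : perm_eq (nbr v) [:: p; r; t; q].
  by apply: perm_trans pe _; apply/permP => P /=; genlia.
have U1 := uncross vV pe b1 b2.
have U2 := uncross vV pe2 (sw _ _ _ _ b1) b3.
have U3 := uncross vV pe3 (sw _ _ _ _ b2) (sw _ _ _ _ b3).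
rewrite (nbr_sym r t) in U2; rewrite (nbr_sym q t) (nbr_sym q r) in U3.
have [A1|nA1] := boolP ((q \in nbr p) || (t \in nbr r)).
  have [A2|nA2] := boolP ((r \in nbr p) || (t \in nbr q)); first exact: (two p q r t).
  apply: (two p q t r) => //; first by rewrite (nbr_sym r t).
  by move: U3 nA2; do 4!case: (_ \in _).
apply: (two p r t q) => //; rewrite ?(nbr_sym q t) ?(nbr_sym q r).
  by move: U1 nA1; do 4!case: (_ \in _).
by move: U2 nA1; do 4!case: (_ \in _).
Qed.

(* The 4-regular form of a splitter theorem: in a prime graph on at least six vertices some vertex has
   a splitting that is again prime. Otherwise uncrossing the bad sets produces a [K4] around a vertex. *)
Lemma chain : 6 <= size V -> ~ {in V, forall v, irred v}.
Proof.
move=> V6 irr.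
have [v vV] : exists v, v \in V by case: (V) V4 => // v l _; exists v; rewrite mem_head.
have [a [b [c [d [pe sub]]]]] := irred_center vV (irr v vV).
have [] := perm_nbr vV pe; rewrite /= !inE !negb_or => /and4P[/and3P[nab nac nad] /andP[nbc nbd] ncd _] nb.
have [nav aV va] : [/\ a != v, a \in V & v \in nbr a] by apply: nb; rewrite inE eqxx.
have [nbv bV vb] : [/\ b != v, b \in V & v \in nbr b] by apply: nb; rewrite !inE eqxx orbT.
have [ncv cV vc] : [/\ c != v, c \in V & v \in nbr c] by apply: nb; rewrite !inE eqxx !orbT.
have [ndv dV vd] : [/\ d != v, d \in V & v \in nbr d] by apply: nb; rewrite !inE eqxx !orbT.
have ba : b \in nbr a by apply: sub; rewrite inE eqxx.
have ab : a \in nbr b by rewrite nbr_sym.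
(* Four mutually adjacent vertices have a cut of 16 - 12 = 4, which is too small as soon as two
   vertices remain outside; this is why six vertices are assumed. *)
have K4 p : p \in [:: c; d] -> p \notin nbr b.
  move=> pcd; apply/negP => pb.
  have pV : p \in V by move: pcd; rewrite !inE => /orP[]/eqP->.
  have pa : p \in nbr a by apply: sub; rewrite inE pcd orbT.
  have pv : p \in nbr v by rewrite (perm_mem pe) !inE; move: pcd; rewrite !inE => /orP[] ->; rewrite ?orbT.
  have npa := nbr_neq aV pa; have npb := nbr_neq bV pb; have npv := nbr_neq vV pv.
  have bv : b \in nbr v by rewrite nbr_sym.
  have av : a \in nbr v by rewrite nbr_sym.
  have cnt u l : u \in V -> uniq l -> {subset l <= nbr u} ->
      count (mem l) (nbr u) = size l /\ count (predC (mem l)) (nbr u) = 4 - size l.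
    move=> uV' ul sl; have [_ un] := prime_simple uV'; have e := count_subset un ul sl.
    by split=> //; have := count_predC (mem l) (nbr u); rewrite (reg uV') e; clear; lia.
  have ext u l : cutE (predU1 u (mem l)) = cutE (mem (u :: l)).
    by apply: eq_cutE => w _; rewrite /= inE.
  have n1 : b \notin [:: p] by rewrite inE eq_sym.
  have n2 : a \notin [:: b; p] by rewrite !inE negb_or nab eq_sym.
  have n3 : v \notin [:: a; b; p] by rewrite !inE !negb_or ![v == _]eq_sym nav nbv.
  have tog u l : u \in V -> u \notin l ->
      cutE (mem (u :: l)) + count (mem l) (nbr u) = cutE (mem l) + count (predC (mem l)) (nbr u).
    by move=> uV' ul; rewrite -ext; apply: toggle.
  have t1 := tog _ _ bV n1; have t2 := tog _ _ aV n2; have t3 := tog _ _ vV n3.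
  have ub : uniq [:: b; p] by rewrite cons_uniq n1.
  have ua : uniq [:: a; b; p] by rewrite cons_uniq n2.
  have sb : {subset [:: p] <= nbr b} by move=> u; rewrite !inE => /eqP->.
  have sa : {subset [:: b; p] <= nbr a} by move=> u; rewrite !inE => /orP[]/eqP->.
  have sv : {subset [:: a; b; p] <= nbr v} by move=> u; rewrite !inE => /or3P[]/eqP->.
  have [/= s1 s2] := cnt b [:: p] bV isT sb.
  have [/= s3 s4] := cnt a [:: b; p] aV ub sa.
  have [/= s5 s6] := cnt v [:: a; b; p] vV ua sv.
  rewrite s1 s2 in t1; rewrite s3 s4 in t2; rewrite s5 s6 in t3.
  have t0 : cutE (mem [:: p]) = 4.
    by rewrite -(cut1 pV); apply: eq_cutE => u _; rewrite /= inE.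
  have t4 : cutE (mem [:: v; a; b; p]) = 4 by clear -t0 t1 t2 t3; lia.
  have u4 : uniq [:: v; a; b; p].
    by rewrite cons_uniq n3.
  have c4 : count (mem [:: v; a; b; p]) V = 4.
    by rewrite count_subset // => u; rewrite !inE => /or4P[]/eqP->.
  have := prE (X := mem [:: v; a; b; p]); rewrite c4 t4 => /(_ isT).
  have := count_predC (mem [:: v; a; b; p]) V; rewrite c4; clear -V6; lia.
(* There is a centre [a2] around [b] too. Whether it is [v], [a] or another vertex, it forces one of
   [c], [d] to be adjacent to [b], against [K4]. *)
have [a2 [b2 [c2 [d2 [pe2 sub2]]]]] := irred_center bV (irr b bV).
have inb u : (u \in nbr b) = (u \in [:: a2; b2; c2; d2]) by rewrite (perm_mem pe2).
have other x y : exists2 z, z \in nbr b & (z != x) && (z != y).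
  have [_ ub] := prime_simple bV.
  have : 0 < count (predC (mem [:: x; y])) (nbr b).
    have := count_predC (mem [:: x; y]) (nbr b); rewrite (reg bV).
    have : count (mem [:: x; y]) (nbr b) <= 2.
      rewrite -size_filter; apply: (@uniq_leq_size _ _ [:: x; y]); rewrite ?filter_uniq // => u.
      by rewrite mem_filter => /andP[].
    clear; lia.
  by rewrite -has_count => /hasP[z zb]; rewrite /= !inE negb_or; exists z.
have nba u : u \in nbr a -> u != v -> u != b -> u \in [:: c; d].
  have [_ una] := prime_simple aV.
  have p4 : perm_eq [:: v; b; c; d] (nbr a).
    apply: uniq_perm; rewrite //=.
      by rewrite !inE !negb_or ![v == _]eq_sym nbv ncv ndv nbc nbd ncd.
    have us : uniq [:: v; b; c; d] by rewrite /= !inE !negb_or ![v == _]eq_sym nbv ncv ndv nbc nbd ncd.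
    have ss : {subset [:: v; b; c; d] <= nbr a}.
      by move=> w; rewrite inE => /orP[/eqP->|/sub].
    by have [] := uniq_min_size us ss; rewrite ?(reg aV).
  by rewrite -(perm_mem p4) !inE => /or4P[]/eqP->; rewrite ?eqxx ?orbT.
have nbv' u : u \in nbr v -> u != a -> u != b -> u \in [:: c; d].
  by rewrite (perm_mem pe) !inE => /or4P[]/eqP->; rewrite ?eqxx ?orbT.
have a2b : a2 \in nbr b by rewrite inb inE eqxx.
have na2b := nbr_neq bV a2b.
have sub2' u : u \in nbr b -> u != a2 -> u \in nbr a2.
  by rewrite inb inE => /orP[/eqP->|/sub2 //]; rewrite eqxx.
have [E1|na2v] := eqVneq a2 v.
  have [z zb /andP[nzv nza]] := other v a.
  have zv : z \in nbr v by rewrite -E1; apply: sub2'; rewrite // E1.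
  by have := K4 z (nbv' z zv nza (nbr_neq bV zb)); rewrite zb.
have [E1|na2a] := eqVneq a2 a.
  have [z zb /andP[nzv nza]] := other v a.
  have za : z \in nbr a by rewrite -E1; apply: sub2'; rewrite // E1.
  by have := K4 z (nba z za nzv (nbr_neq bV zb)); rewrite zb.
have a2v : a2 \in nbr v by rewrite nbr_sym; apply: sub2'; rewrite // eq_sym.
by have := K4 a2 (nbv' a2 a2v na2a na2b); rewrite a2b.
Qed.
End Multigraph.

(** * Prime words are rigid *)

Section Cuts.
Variable T : eqType.
Implicit Types (s t A B l : seq T) (a b v w : T) (X : pred T) (Q : pred (T * T)).

Fixpoint pw a l : seq (T * T) := if l is b :: l' then (a, b) :: pw b l' else [::].

(* Consecutive letters of the cyclic word are the edges of a 4-regular multigraph on its chords. *)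
Definition cp s := if s is a :: l then pw a (rcons l a) else [::].

Definition cut X s := cutE (cp s) X.

Lemma pw_cat a u l : pw a (u ++ l) = pw a u ++ pw (last a u) l.
Proof. by elim: u a => //= b u IH a; rewrite IH. Qed.

Lemma cp_perm s t : crot s t -> perm_eq (cp s) (cp t).
Proof.
move=> /crotP[[|a u] [[|b l] [-> ->]]]; rewrite ?cats0 //=.
rewrite -!cats1 -!catA /= !pw_cat /= !pw_cat /=; apply/permP => P.
by rewrite !count_cat /= !count_cat /=; genlia.
Qed.

Lemma cut_crot X s t : crot s t -> cut X s = cut X t.
Proof. by move=> /cp_perm/permP; apply. Qed.

(** Edges are listed in the direction of reading. Reversing an arc turns some of them around, so
    only tests blind to direction are preserved. *)
Definition symq Q := forall a b, Q (a, b) = Q (b, a).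

Lemma count_pw_rev Q a b l : symq Q ->
  count Q (pw a (rcons l b)) = count Q (pw b (rcons (rev l) a)).
Proof.
move=> sQ; elim: l a => [|c l IH] a /=; first by rewrite sQ.
rewrite rev_cons -[rcons (rcons _ _) _]cats1 pw_cat last_rcons count_cat /= IH sQ; lia.
Qed.

Lemma cp_arcs v A B : cp (v :: A ++ v :: B) = pw v (rcons A v) ++ pw v (rcons B v).
Proof. by rewrite /= rcons_cat /= -cat_rcons pw_cat last_rcons. Qed.

Lemma count_lc Q w s : symq Q -> dow s -> w \in s -> count Q (cp (lc w s)) = count Q (cp s).
Proof.
move=> sQ ds ws; have [P [A [B [E wP wA wB]]]] := dow_split ds ws.
rewrite E lcE //.
have c1 l : crot (P ++ w :: l ++ w :: B) (w :: l ++ w :: (B ++ P)).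
  by have := crot_cat P (w :: l ++ w :: B); rewrite cat_cons -catA.
rewrite !(permP (cp_perm (c1 _))) !cp_arcs !count_cat.
by congr (_ + _); rewrite count_pw_rev // revK.
Qed.

Lemma count_cp_rev Q s : symq Q -> count Q (cp (rev s)) = count Q (cp s).
Proof.
move=> sQ; case: s => // a l; rewrite rev_cons.
have c1 : crot (rcons (rev l) a) (a :: rev l).
  by rewrite -cats1; apply: (crot_cat _ [:: a]).
by rewrite (permP (cp_perm c1)) /= count_pw_rev // revK.
Qed.

Lemma symq_cut X : symq (fun e => X e.1 != X e.2).
Proof. by move=> a b /=; rewrite eq_sym. Qed.

Lemma cut_lc X w s : dow s -> w \in s -> cut X (lc w s) = cut X s.
Proof. by move=> ds ws; apply: count_lc => //; apply: symq_cut. Qed.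

Lemma cut_rev X s : cut X (rev s) = cut X s.
Proof. by apply: count_cp_rev; apply: symq_cut. Qed.

Lemma cut_dih X s t : dih s t -> cut X s = cut X t.
Proof. by move=> [/cut_crot->|/cut_crot <-] //; rewrite cut_rev. Qed.

Lemma odd_pw X a l : odd (cutE (pw a l) X) = X a (+) X (last a l).
Proof.
rewrite /cutE; elim: l a => [|b l IH] a /=; first by rewrite addbb.
by rewrite oddD IH; case: (X a); case: (X b); case: (X _).
Qed.

Lemma cut_even X s : ~~ odd (cut X s).
Proof. by rewrite /cut; case: s => // a l; rewrite odd_pw last_rcons addbb. Qed.

Lemma cutC X s : cut (predC X) s = cut X s.
Proof. by apply: eq_count => e /=; case: (X e.1); case: (X e.2). Qed.

Lemma map_fst_pw a l : map fst (pw a l) = belast a l.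
Proof. by elim: l a => //= b l IH a; rewrite IH. Qed.

Lemma map_snd_pw a l : map snd (pw a l) = l.
Proof. by elim: l a => //= b l IH a; rewrite IH. Qed.

Lemma map_fst_cp s : map fst (cp s) = s.
Proof. by case: s => // a l; rewrite /cp map_fst_pw belast_rcons. Qed.

Lemma map_snd_cp s : perm_eq (map snd (cp s)) s.
Proof. by case: s => // a l; rewrite /cp map_snd_pw perm_rcons. Qed.

(** Letters are counted with multiplicity, so more than two of them means at least two chords. The
    bound 4 is the largest cut that a share can have. *)
Definition prime_word s :=
  forall X, 2 < count X s -> 2 < count (predC X) s -> 4 < cut X s.

Lemma prime_crot s t : crot s t -> prime_word s -> prime_word t.
Proof.
move=> st pr X; rewrite -(cut_crot _ st) -!(permP (crot_perm st)); exact: pr.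
Qed.

Lemma prime_dih s t : dih s t -> prime_word s -> prime_word t.
Proof.
move=> st pr X; rewrite -(cut_dih _ st) -!(permP (dih_perm st)); exact: pr.
Qed.

Lemma prime_lc w s : dow s -> w \in s -> prime_word s -> prime_word (lc w s).
Proof. move=> ds ws pr X; rewrite cut_lc // !(permP (lc_perm ds ws)); exact: pr. Qed.

Lemma count_undup X s : dow s -> count X s = 2 * count X (undup s).
Proof.
move=> /dowP ds; rewrite -!sum1_count big_distrr /= -big_undup_iterop_count /=.
rewrite big_mkcond [RHS]big_mkcond; apply: eq_big_seq => p; rewrite mem_undup => ps.
by case: ifP => // _; rewrite ds.
Qed.

Section Prime.
Variable s : seq T.
Hypotheses (ds : dow s) (prs : prime_word s) (s8 : 8 <= size s).

Let E := cp s.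
Let V := undup s.

Lemma uV_ : uniq V. Proof. exact: undup_uniq. Qed.

Lemma VE_ : {in E, forall e, (e.1 \in V) && (e.2 \in V)}.
Proof.
move=> e eE; rewrite !mem_undup -{1}(map_fst_cp s) map_f //=.
by rewrite -(perm_mem (map_snd_cp s)) map_f.
Qed.

Lemma reg_ : {in V, forall v, size (nbr E v) = 4}.
Proof.
move=> v; rewrite mem_undup => vs; rewrite /nbr size_cat !size_map !size_filter.
have c1 := count_map fst (pred1 v) E; have c2 := count_map snd (pred1 v) E.
rewrite map_fst_cp (dowP _ ds) // in c1; rewrite (permP (map_snd_cp s)) (dowP _ ds) // in c2.
by rewrite -[count _ _]c1 -[X in _ + X]c2.
Qed.

Lemma prE_ X : 1 < count X V -> 1 < count (predC X) V -> 6 <= cutE E X.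
Proof.
move=> h1 h2; have h : 4 < cut X s.
  by apply: prs; rewrite count_undup // -[2]/(2 * 1) ltn_mul2l.
have := cut_even X s; rewrite -/(cut X s); move: h.
by move: (cut X s) => [|[|[|[|[|[|n]]]]]].
Qed.

Lemma size_V : size s = 2 * size V.
Proof. by rewrite -(count_predT s) count_undup // count_predT. Qed.

Lemma V4_ : 4 <= size V.
Proof. by move: s8; rewrite size_V; lia. Qed.

Lemma prime_cut4 X a b : a \in s -> b \in s -> X a -> ~~ X b -> 4 <= cut X s.
Proof.
move=> as_ bs Xa nXb.
have aV : a \in V by rewrite mem_undup.
have bV : b \in V by rewrite mem_undup.
have c1 v : v \in V -> cut (pred1 v) s = 4 := cut1 uV_ VE_ reg_ prE_ V4_ (v := v).
have [h1|h1] := boolP (1 < count X V); last first.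
  rewrite -(c1 a aV); apply/eq_leq/esym; apply: (eq_cutE VE_) => u uV' /=.
  apply/idP/eqP => [Xu|->//]; exact: (small_in aV Xa h1 uV').
have [h2|h2] := boolP (1 < count (predC X) V); first by apply: leq_trans (prE_ h1 h2).
rewrite -(c1 b bV) -(cutC X); apply/eq_leq/esym; apply: (eq_cutE VE_) => u uV' /=.
apply/idP/eqP => [Xu|->//]; exact: (small_in (X := predC X) bV nXb h2 uV').
Qed.

(** A vertex and its four distinct neighbours are five chords. *)
Lemma prime_size : 10 <= size s.
Proof.
have [v vV] : exists v, v \in V by case: V V4_ => // v l _; exists v; rewrite mem_head.
have [vn un] := prime_simple uV_ VE_ reg_ prE_ V4_ vV.
have : uniq (v :: nbr E v) by rewrite cons_uniq vn.
have : {subset v :: nbr E v <= V}.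
  by move=> u; rewrite inE => /orP[/eqP->|] //; apply: (nbrV VE_).
move=> sub uu; have := uniq_leq_size uu sub; rewrite /= reg_ // size_V; lia.
Qed.

Lemma prime_noloop v A B : crot s (v :: A ++ v :: B) -> v \in s -> A != [::].
Proof.
move=> cs vs; have vV : v \in V by rewrite mem_undup.
have [vn _] := prime_simple uV_ VE_ reg_ prE_ V4_ vV.
apply/eqP => A0; subst A; case/negP: vn.
have : (v, v) \in E by rewrite (perm_mem (cp_perm cs)) /= mem_head.
by move=> vE; rewrite mem_cat; apply/orP; left; apply/mapP; exists (v, v) => //; rewrite mem_filter eqxx.
Qed.

End Prime.


Definition badw s := bad (cp s) (undup s).

Lemma badw_transfer s t v p q r (u : T) : perm_eq s t ->
  (forall Q, symq Q -> count Q (cp s) = count Q (cp t)) -> badw s v p q r u -> badw t v p q r u.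
Proof.
move=> pe H [X [h1 h2 h3 h4 h5]].
have pu := permP (perm_undup (perm_mem pe)).
exists X; rewrite -!pu; split=> //.
rewrite /cutE' -H // => a b /=; rewrite [X a == X b]eq_sym.
by case: (a != v); case: (b != v).
Qed.

Lemma pw_notin v a A' X : v \notin a :: A' -> cutE' (pw a A') v X = cutE (pw a A') X.
Proof.
rewrite /cutE' /cutE; elim: A' a => //= b A' IH a; rewrite inE negb_or => /andP[va vb].
by rewrite IH // (eq_sym a) va; move: vb; rewrite inE negb_or eq_sym => /andP[-> _].
Qed.

Lemma cutE_cat (E1 E2 : seq (T * T)) X : cutE (E1 ++ E2) X = cutE E1 X + cutE E2 X.
Proof. exact: count_cat. Qed.

Lemma cutE'_cat v (E1 E2 : seq (T * T)) X :
  cutE' (E1 ++ E2) v X = cutE' E1 v X + cutE' E2 v X.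
Proof. exact: count_cat. Qed.

Lemma pw_rcons a l b : pw a (rcons l b) = rcons (pw a l) (last a l, b).
Proof. by rewrite -cats1 pw_cat cats1. Qed.

Lemma cut_del a A' b B' X : cut X ((a :: A') ++ b :: B') =
  cutE (pw a A') X + (X (last a A') != X b) + cutE (pw b B') X + (X (last b B') != X a).
Proof.
rewrite /cut /= rcons_cat /= pw_cat cutE_cat /= pw_rcons -cats1 /cutE /= count_cat /=.
by rewrite addn0 !addnA.
Qed.

Lemma cut_full v a A' b B' X : cut X (v :: (a :: A') ++ v :: b :: B') =
  cutE (pw a A') X + (X v != X a) + (X (last a A') != X v) +
  (cutE (pw b B') X + (X v != X b) + (X (last b B') != X v)).
Proof.
rewrite /cut cp_arcs cutE_cat /=; congr (_ + _).
  rewrite pw_rcons -cats1 /cutE /= count_cat /=; clear; lia.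
rewrite pw_rcons -cats1 /cutE /= count_cat /=; clear; lia.
Qed.

Lemma cut'_full v a A' b B' X : v \notin a :: A' -> v \notin b :: B' ->
  cutE' (cp (v :: (a :: A') ++ v :: b :: B')) v X = cutE (pw a A') X + cutE (pw b B') X.
Proof.
move=> vA vB; rewrite cp_arcs cutE'_cat /=; congr (_ + _).
  by rewrite pw_rcons -cats1 cutE'_cat pw_notin // /cutE' /= !eqxx !andbF !addn0.
by rewrite pw_rcons -cats1 cutE'_cat pw_notin // /cutE' /= !eqxx !andbF !addn0.
Qed.

Lemma nbr_full v a A' b B' : v \notin a :: A' -> v \notin b :: B' ->
  perm_eq (nbr (cp (v :: (a :: A') ++ v :: b :: B')) v)
    [:: last a A'; b; a; last b B'].
Proof.
have nil c L : v \notin c :: L -> nbr (pw c L) v = [::].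
  move=> vL; rewrite /nbr !(@eq_in_filter _ _ pred0) ?filter_pred0 // => e eL /=.
    apply: contraNF vL => /eqP<-; rewrite inE; apply/orP; right.
    by rewrite -(map_snd_pw c L) map_f.
  apply: contraNF vL => /eqP<-; apply: mem_belast.
  by rewrite -map_fst_pw map_f.
have cat E1 E2 : perm_eq (nbr (E1 ++ E2) v) (nbr E1 v ++ nbr E2 v).
  rewrite /nbr !filter_cat !map_cat -!catA perm_cat2l perm_catCA //.
move=> vA vB; rewrite cp_arcs.
have arc c L : v \notin c :: L -> perm_eq (nbr (pw v (rcons (c :: L) v)) v) [:: c; last c L].
  move=> vL; rewrite -[pw _ _]/([:: (v, c)] ++ pw c (rcons L v)) pw_rcons -cats1.
  apply: perm_trans (cat _ _) _; apply: perm_trans (perm_cat (perm_refl _) (cat _ _)) _.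
  rewrite nil //= /nbr /= eqxx.
  have [n1 n2] : c != v /\ last c L != v.
    split; apply: contraNneq vL => <-; by rewrite ?mem_head ?mem_last.
  by rewrite (negbTE n1) (negbTE n2).
apply: perm_trans (cat _ _) _; apply: perm_trans (perm_cat (arc _ _ vA) (arc _ _ vB)) _.
by apply/permP => P /=; genlia.
Qed.

(** Deleting [v] joins [last a A'] to [b] and [last b B'] to [a]. A set violating primeness of the
    shorter word, or else its complement, is bad for this pairing once [v] is removed from it. *)
Lemma del_bad v a A' b B' (s := v :: (a :: A') ++ v :: b :: B') :
  dow s -> prime_word s -> 8 <= size s -> v \notin a :: A' -> v \notin b :: B' ->
  ~ prime_word ((a :: A') ++ b :: B') -> badw s v (last a A') b a (last b B').
Proof.
move=> ds prs s8 vA vB npr; apply: NNPP => nbad; apply: npr => X h1 h2.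
rewrite ltnNge; apply/negP => h3; apply: nbad.
pose X0 : pred T := fun u => X u && (u != v); pose X1 : pred T := fun u => ~~ X u && (u != v).
have inA (u : T) : u \in a :: A' -> u != v by move=> uA; apply: contraNneq vA => <-.
have inB (u : T) : u \in b :: B' -> u != v by move=> uB; apply: contraNneq vB => <-.
have [na nb] : a != v /\ b != v by split; [apply: inA|apply: inB]; rewrite mem_head.
have [nla nlb] : last a A' != v /\ last b B' != v by split; [apply: inA|apply: inB]; rewrite mem_last.
have pe (P : pred T) : count P s = 2 * P v + count P ((a :: A') ++ b :: B').
  by rewrite /s /= !count_cat /=; genlia.
have cX0 : count X0 s = count X ((a :: A') ++ b :: B').
  rewrite pe /X0 eqxx andbF add0n; apply: eq_in_count => u; rewrite mem_cat => /orP[/inA|/inB] ->;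
  by rewrite andbT.
have cX1 : count X1 s = count (predC X) ((a :: A') ++ b :: B').
  rewrite pe /X1 eqxx andbF add0n; apply: eq_in_count => u; rewrite mem_cat => /orP[/inA|/inB] ->;
  by rewrite andbT.
have sub (P P' : pred T) : (forall u, P u -> P' u) -> count P s <= count P' s by move=> H; apply: sub_count.
have h4 : 6 <= cut X0 s.
  apply: (prE_ ds prs); have := count_undup X0 ds; have := count_undup (predC X0) ds; rewrite cX0.
    by clear -h1; lia.
  have : count X1 s <= count (predC X0) s.
    by apply: sub => u /andP[Xu _]; rewrite /= /X0 (negbTE Xu).
  by rewrite cX1; clear -h2; lia.
have h5 : 6 <= cut X1 s.
  apply: (prE_ ds prs); have := count_undup X1 ds; have := count_undup (predC X1) ds; rewrite cX1.
    by clear -h2; lia.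
  have : count X0 s <= count (predC X1) s.
    by apply: sub => u /andP[Xu _]; rewrite /= /X1 Xu.
  by rewrite cX0; clear -h1; lia.
have eqE c L (P P' : pred T) : {in c :: L, P =1 P'} -> cutE (pw c L) P = cutE (pw c L) P'.
  rewrite /cutE; elim: L c => //= d L IH c E0; rewrite IH; last by move=> u uL; apply: E0; rewrite inE uL orbT.
  by rewrite !E0 // ?inE ?eqxx ?orbT.
have [a0 b0] : cutE (pw a A') X0 = cutE (pw a A') X /\ cutE (pw b B') X0 = cutE (pw b B') X.
  by split; apply: eqE => u; [move/inA|move/inB] => nu; rewrite /X0 nu andbT.
have [a1 b1] : cutE (pw a A') X1 = cutE (pw a A') X /\ cutE (pw b B') X1 = cutE (pw b B') X.
  split.
  - rewrite (eqE _ _ X1 (predC X)); last by move=> u /inA nu; rewrite /X1 nu andbT.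
    by apply: eq_count => e /=; case: (X e.1); case: (X e.2).
  - rewrite (eqE _ _ X1 (predC X)); last by move=> u /inB nu; rewrite /X1 nu andbT.
    by apply: eq_count => e /=; case: (X e.1); case: (X e.2).
rewrite cut_full a0 b0 /X0 eqxx andbF na nb nla nlb !andbT in h4.
rewrite cut_full a1 b1 /X1 eqxx andbF na nb nla nlb !andbT in h5.
rewrite cut_del in h3.
have u0 : 1 < count X0 (undup s).
  by have := count_undup X0 ds; rewrite cX0; clear -h1; lia.
have u1 : 1 < count X1 (undup s).
  by have := count_undup X1 ds; rewrite cX1; clear -h2; lia.
have c0 := cut'_full X0 vA vB; have c1 := cut'_full X1 vA vB; rewrite a0 b0 in c0; rewrite a1 b1 in c1.
have [E1|E1] := boolP (X (last a A')).
  exists X0; split=> //.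
  - by rewrite /X0 eqxx andbF.
  - rewrite /X0 na nb nla nlb !andbT E1; move: h3 h4 h5; rewrite E1.
    by case: (X b); case: (X a); case: (X (last b B')) => //=; clear; lia.
  - apply: leq_trans u1 _; apply: sub_count => u /andP[Xu nu]; by rewrite /X0 (negbTE Xu).
  - rewrite c0; move: h3 h4 h5; rewrite E1.
    by case: (X b); case: (X a); case: (X (last b B')) => //=; clear; lia.
exists X1; split=> //.
- by rewrite /X1 eqxx andbF.
- rewrite /X1 na nb nla nlb !andbT E1; move: h3 h4 h5; rewrite (negbTE E1).
  by case: (X b); case: (X a); case: (X (last b B')) => //=; clear; lia.
- apply: leq_trans u0 _; apply: sub_count => u /andP[Xu nu]; by rewrite /X1 Xu.
- rewrite c1; move: h3 h4 h5; rewrite (negbTE E1).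
  by case: (X b); case: (X a); case: (X (last b B')) => //=; clear; lia.
Qed.

End Cuts.

(** * The place of a chord in a prime word *)

Section Placement.
Variable T : eqType.
Implicit Types (s t A B l : seq T) (a b v w : T) (X : pred T).

Lemma cutE_block X (b : bool) a l : all (fun u => X u == b) l -> cutE (pw a l) X <= 1.
Proof.
have H l' c : all (fun u => X u == b) l' -> X c = b -> cutE (pw c l') X = 0.
  elim: l' c => //= d l' IH c /andP[/eqP Xd al] Xc.
  by rewrite /cutE /= Xc Xd eqxx; apply: IH.
case: l => //= d l /andP[/eqP Xd al]; rewrite /cutE /= -/(cutE _ X) H // addn0.
by case: (_ != _).
Qed.

Lemma cutE_pw_cat X a l l' : cutE (pw a (l ++ l')) X = cutE (pw a l) X + cutE (pw (last a l) l') X.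
Proof. by rewrite pw_cat cutE_cat. Qed.

Lemma cut_path X s c : head c s = c -> cut X s = cutE (pw c (rcons s c)) X.
Proof. by case: s => [|d l] /= E; rewrite /cut /cutE /= ?E ?eqxx. Qed.

(** Each of the four blocks and the closing step changes sides at most once, which gives five; a cut
    is even. *)
Lemma cut_le4 X al be ga de :
  all X al -> all X ga -> all (predC X) be -> all (predC X) de -> cut X (al ++ be ++ ga ++ de) <= 4.
Proof.
move=> Xal Xga Xbe Xde; have ev := cut_even X (al ++ be ++ ga ++ de).
case Es: (al ++ be ++ ga ++ de) ev => [|c s] // ev.
suff : cut X (c :: s) <= 5 by move: (cut X (c :: s)) ev => [|[|[|[|[|[|n]]]]]].
rewrite (@cut_path _ _ c) // -cats1 -Es -!catA.
have T1 l : all X l -> all (fun u => X u == true) l by apply: sub_all => u ->.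
have F1 l : all (predC X) l -> all (fun u => X u == false) l by apply: sub_all => u /negbTE->.
rewrite !cutE_pw_cat.
have h1 d := cutE_block d (T1 _ Xal); have h2 d := cutE_block d (T1 _ Xga).
have h3 d := cutE_block d (F1 _ Xbe); have h4 d := cutE_block d (F1 _ Xde).
have h5 d : cutE (pw d [:: c]) X <= 1 by apply: (@cutE_block X (X c)); rewrite /= eqxx.
have := h1 c; have := h2 (last (last c al) be); have := h3 (last c al).
have := h4 (last (last (last c al) be) ga); have := h5 (last (last (last (last c al) be) ga) de).
clear; lia.
Qed.

Lemma cut_le2 X al be : all X al -> all (predC X) be -> cut X (al ++ be) <= 2.
Proof.
move=> Xal Xbe; have ev := cut_even X (al ++ be).
case Es: (al ++ be) ev => [|c s] // ev.
suff : cut X (c :: s) <= 3 by move: (cut X (c :: s)) ev => [|[|[|[|n]]]].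
rewrite (@cut_path _ _ c) // -cats1 -Es -!catA.
have T1 l : all X l -> all (fun u => X u == true) l by apply: sub_all => u ->.
have F1 l : all (predC X) l -> all (fun u => X u == false) l by apply: sub_all => u /negbTE->.
rewrite !cutE_pw_cat.
have := cutE_block c (T1 _ Xal); have := cutE_block (last c al) (F1 _ Xbe).
have : cutE (pw (last (last c al) be) [:: c]) X <= 1.
  by apply: (@cutE_block X (X c)); rewrite /= eqxx.
clear; lia.
Qed.

Lemma evn_part t u r : dow t -> perm_eq t (u ++ r) -> evn u ->
  [/\ count (mem u) t = size u, count (predC (mem u)) t = size r,
      all (mem u) u, all (predC (mem u)) r & dow u].
Proof.
move=> dt pe ev; have [du _ dis] := dow_evn (etrans (esym (dow_perm pe)) dt) ev.
have au : all (mem u) u by apply/allP.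
have ar : all (predC (mem u)) r.
  by apply/allP => p pr /=; apply: contraL pr; apply: dis.
split=> //; rewrite (permP pe) count_cat.
  rewrite -[count _ r]/(count (mem u) r).
  have -> : count (mem u) r = 0 by apply/eqP; rewrite -leqn0 leqNgt -has_count -all_predC.
  by rewrite addn0; apply/eqP; rewrite -all_count.
have -> : count (predC (mem u)) u = 0.
  apply/eqP; rewrite -leqn0 leqNgt -has_count; apply/hasPn => p pu /=; by rewrite negbK.
by rewrite add0n; apply/eqP; rewrite -all_count.
Qed.

Lemma prime_share t al be ga de : dow t -> prime_word t ->
  crot t (al ++ be ++ ga ++ de) -> evn (al ++ ga) ->
  size (al ++ ga) <= 2 \/ size (be ++ de) <= 2.
Proof.
move=> dt pr ct ev.
have pe : perm_eq t ((al ++ ga) ++ (be ++ de)).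
  apply: perm_trans (crot_perm ct) _; apply/permP => P; rewrite !count_cat; clear; lia.
have [c1 c2 a1 a2 _] := evn_part dt pe ev.
have := pr (mem (al ++ ga)); rewrite c1 c2 (cut_crot _ ct).
move: a1 a2; rewrite !all_cat => /andP[x1 x2] /andP[x3 x4].
have := cut_le4 x1 x2 x3 x4; clear; lia.
Qed.

Section Fixed.
Variable t : seq T.
Hypotheses (dt : dow t) (pr : prime_word t) (t8 : 8 <= size t).

Lemma prime_closed al be : crot t (al ++ be) -> evn al -> al = [::] \/ be = [::].
Proof.
move=> ct ev.
have [c1 c2 a1 a2 _] := evn_part dt (crot_perm ct) ev.
case: al ct ev c1 c2 a1 a2 => [|a al] ct ev c1 c2 a1 a2; first by left.
case: be ct c2 a2 => [|b be] ct c2 a2; first by right.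
have ab : (a \in t) && (b \in t) by rewrite !(perm_mem (crot_perm ct)) !mem_cat !mem_head orbT.
case/andP: ab => ain bin.
have := @prime_cut4 _ t dt pr t8 (mem (a :: al)) a b ain bin.
rewrite [mem _ a]mem_head => /(_ isT); rewrite (cut_crot _ ct).
have nb : ~~ mem (a :: al) b by move: a2 => /= /andP[].
move=> /(_ nb) => K; have := leq_trans K (cut_le2 a1 a2); by [].
Qed.

Lemma evn_cons2 v l : evn l -> evn (v :: v :: l).
Proof. by move=> ev p /=; rewrite addnA oddD; case: (v == p) => /=; rewrite ev. Qed.

Lemma evn_perm l l' : perm_eq l l' -> evn l -> evn l'.
Proof. by move=> /permP pe ev p; rewrite -pe. Qed.

(** If the ends of [v] could move inwards past [a1] and [a3] with the same crossings, then [a1] and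
    [a3] would form a share both with and without [v]. Primeness leaves at most one chord inside or
    outside of each, too few for eight letters unless nothing moves. *)
Lemma place_same v (a1 a2 a3 : seq T) B : crot t (v :: (a1 ++ a2 ++ a3) ++ v :: B) ->
  evn (a1 ++ a3) -> a1 ++ a3 = [::].
Proof.
move=> ct ev; have sz := perm_size (crot_perm ct).
have vt : v \in t by rewrite (perm_mem (crot_perm ct)) mem_head.
have := @prime_share t (v :: a1) a2 (a3 ++ [:: v]) B dt pr.
rewrite /= -!catA /= => H1.
have ct1 : crot t (v :: a1 ++ a2 ++ a3 ++ v :: B) by rewrite -!catA in ct.
have ev1 : evn (v :: a1 ++ a3 ++ [:: v]).
  apply: evn_perm (evn_cons2 v ev); apply/permP => P /=; rewrite !count_cat /=; clear; lia.
have {H1} H1 := H1 ct1 ev1.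
have H2 := @prime_share t a1 a2 a3 (v :: B ++ [:: v]) dt pr.
have ct2 : crot t (a1 ++ a2 ++ a3 ++ v :: B ++ [:: v]).
  apply: crot_trans ct1 _; have := crot_cat [:: v] (a1 ++ a2 ++ a3 ++ v :: B).
  by rewrite -!catA /= -?catA.
have {H2} H2 := H2 ct2 ev.
have nB : B <> [::].
  move=> B0; subst B.
  have ct3 : crot t (v :: [::] ++ v :: (a1 ++ a2 ++ a3)).
    by apply: crot_trans ct _; apply: (crot_cat (v :: _) [:: v]).
  by have := prime_noloop dt pr t8 ct3 vt.
have szB : 0 < size B by case: (B) nB.
apply: size0nil; move: H1 H2 sz t8; rewrite /= ?size_cat /= ?size_cat /= ?size_cat /=; clear -szB; lia.
Qed.

(** Here both ends of [v] move in the same direction around the circle. In the second outcome they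
    have exchanged their places, so the word is again the same. *)
Lemma place_cross v al be ga de : crot t (v :: (al ++ be) ++ v :: (ga ++ de)) ->
  evn (al ++ ga) -> al ++ ga = [::] \/ be ++ de = [::].
Proof.
move=> ct ev; have sz := perm_size (crot_perm ct).
have H1 := @prime_share t (v :: al) be (v :: ga) de dt pr.
have ct1 : crot t ((v :: al) ++ be ++ (v :: ga) ++ de) by rewrite /= -!catA in ct *.
have ev1 : evn ((v :: al) ++ v :: ga).
  apply: evn_perm (evn_cons2 v ev); apply/permP => P /=; rewrite !count_cat /=; clear; lia.
have {H1} H1 := H1 ct1 ev1.
have H2 := @prime_share t al (be ++ [:: v]) ga (de ++ [:: v]) dt pr.
have ct2 : crot t (al ++ (be ++ [:: v]) ++ ga ++ de ++ [:: v]).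
  apply: crot_trans ct1 _; have := crot_cat [:: v] (al ++ be ++ (v :: ga) ++ de).
  by rewrite -!catA /= -?catA.
have {H2} H2 := H2 ct2 ev.
have : size (al ++ ga) = 0 \/ size (be ++ de) = 0.
  move: H1 H2 sz t8; rewrite /= ?size_cat /= ?size_cat /= ?size_cat /=; clear; lia.
by case=> /size0nil; [left|right].
Qed.

(** Meant for an additional chord with ends around [a2] that crosses no chord of the word. *)
Lemma place_empty v (a1 a2 a3 : seq T) B : crot t (v :: (a1 ++ a2 ++ a3) ++ v :: B) ->
  evn a2 -> a2 = [::].
Proof.
move=> ct ev; have := @prime_closed a2 (a3 ++ v :: B ++ v :: a1).
case=> //.
  apply: crot_trans ct _; have := crot_cat (v :: a1) (a2 ++ a3 ++ v :: B).
  by rewrite -!catA /= -?catA.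
by move/(congr1 size); rewrite size_cat /= addnS.
Qed.

(** The additional chord now has its ends on different arcs of [v]: it encloses [be], one end of [v]
    and [ga], and crosses at most [v]. *)
Lemma place_empty_cross v al be ga de : crot t (v :: (al ++ be) ++ v :: (ga ++ de)) ->
  evn (be ++ ga) -> be ++ ga = [::] \/ al ++ de = [::].
Proof.
move=> ct ev; have sz := perm_size (crot_perm ct).
have H1 := @prime_share t be [:: v] ga (de ++ v :: al) dt pr.
have ct1 : crot t (be ++ [:: v] ++ ga ++ de ++ v :: al).
  apply: crot_trans ct _; have := crot_cat (v :: al) (be ++ v :: ga ++ de).
  by rewrite -!catA /= -?catA.
have {H1} H1 := H1 ct1 ev.
have ev2 : evn (al ++ de).
  move=> p; have /permP/(_ (pred1 p)) := crot_perm ct1; move: (ev p).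
  rewrite /= !count_cat /= !count_cat /= => e1 e2.
  have : ~~ odd (count_mem p t) by case: (dow_count p dt) => ->.
  rewrite e2 !oddD; move: e1; rewrite !oddD.
  by do 5!case: (odd _).
have H2 := @prime_share t al (be ++ v :: ga) de [:: v] dt pr.
have ct2 : crot t (al ++ (be ++ v :: ga) ++ de ++ [:: v]).
  apply: crot_trans ct _; have := crot_cat [:: v] (al ++ be ++ v :: ga ++ de).
  by rewrite -!catA /= -?catA.
have {H2} H2 := H2 ct2 ev2.
have : size (be ++ ga) = 0 \/ size (al ++ de) = 0.
  move: H1 H2 sz t8; rewrite /= ?size_cat /= ?size_cat /= ?size_cat /=; clear; lia.
by case=> /size0nil; [left|right].
Qed.

End Fixed.
End Placement.

(** * Reinsertion of a chord and reduction of prime words *)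

Section Rigidity.
Variable T : eqType.
Implicit Types (s t A B l : seq T) (a b v w : T) (X : pred T).

Lemma cat_eq_cases (A B u w : seq T) : A ++ B = u ++ w ->
  (exists c, A = u ++ c /\ w = c ++ B) \/ (exists c, u = A ++ c /\ B = c ++ w).
Proof.
elim: A u => [|a A IH] [|b u] /=.
- by move=> ->; left; exists [::].
- by move=> ->; right; exists (b :: u).
- by move=> <-; left; exists (a :: A).
move=> [<- /IH[[c [-> ->]]|[c [-> ->]]]]; [left|right]; by exists c.
Qed.

Lemma cat_nil2 (u w : seq T) : u ++ w = [::] -> u = [::] /\ w = [::].
Proof. by case: u => //= ->. Qed.

(** Two pairs of cut points on one circle, up to the naming of the arcs: the second pair lies on one
    arc of the first, or has one point on each. *)
Definition placed A B A' B' :=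
  (exists a1 a2 a3 : seq T, [/\ A = a1 ++ a2 ++ a3, A' = a2 & B' = a3 ++ B ++ a1]) \/
  (exists al be ga de : seq T, [/\ A = al ++ be, B = ga ++ de, A' = be ++ ga & B' = de ++ al]).

Lemma placed_cases A B A' B' : crot (A ++ B) (A' ++ B') ->
  [\/ placed A B A' B', placed A B B' A', placed B A A' B' | placed B A B' A'].
Proof.
move=> /crotP[u [w [E1 E2]]].
case: (cat_eq_cases E1) => [[c [E3 E4]]|[c [E3 E4]]];
  case: (cat_eq_cases E2) => [[d [E5 E6]]|[d [E5 E6]]]; subst.
- by constructor 2; left; exists d, B', c; rewrite -?catA.
- case: (cat_eq_cases E5) => [[e [E7 E8]]|[e [E7 E8]]]; subst.
    by constructor 1; left; exists u, A', e; rewrite -?catA.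
  by constructor 1; right; exists u, c, e, d.
- case: (cat_eq_cases E6) => [[e [E7 E8]]|[e [E7 E8]]]; subst.
    by constructor 2; right; exists d, e, c, w.
  by constructor 4; left; exists e, B', w; rewrite -?catA.
by constructor 3; left; exists c, A', d; rewrite -?catA.
Qed.

Lemma crs_arcs s v A B x : dow s -> crot s (v :: A ++ v :: B) -> v \notin A -> v \notin B ->
  x != v -> crs s v x = odd (count_mem x A).
Proof.
move=> ds cs vA vB nxv; rewrite (crs_crot _ _ ds cs) crs_arc //; exact: dow_crot ds.
Qed.

Lemma crot_half v A B : crot (v :: A ++ v :: B) (v :: B ++ v :: A).
Proof. exact: (crot_cat (v :: A) (v :: B)). Qed.

(** Words that agree without [v] differ in a pair of cut points. Equal crossings make the stretches
    over which these move closed, and primeness then leaves only the original place. *)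
Lemma reinsert s t v A B A' B' : dow s -> prime_word s -> 8 <= size s ->
  crot s (v :: A ++ v :: B) -> v \notin A -> v \notin B ->
  dow t -> crot t (v :: A' ++ v :: B') -> v \notin A' -> v \notin B' ->
  (forall x, x != v -> crs s v x = crs t v x) ->
  crot (A ++ B) (A' ++ B') -> crot s t.
Proof.
move=> ds ps s8 cs vA vB dt ct vA' vB' E.
wlog pl : A B A' B' cs vA vB ct vA' vB' / placed A B A' B'.
  move=> H c0; have cs2 := crot_trans cs (crot_half _ _ _).
  have ct2 := crot_trans ct (crot_half _ _ _).
  have c1 := crot_trans (crot_cat B A) (crot_trans c0 (crot_cat A' B')).
  have c2 := crot_trans (crot_cat B A) c0.
  have c3 := crot_trans c0 (crot_cat A' B').
  by case: (placed_cases c0) => pl; [apply: H pl _|apply: H pl _|apply: H pl _|apply: H pl _].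
move=> _.
have ev x : x != v -> odd (count_mem x A) = odd (count_mem x A').
  by move=> nx; rewrite -(crs_arcs ds cs) // -(crs_arcs dt ct) // E.
case: pl => [[a1 [a2 [a3 [EA EA' EB']]]]|[al [be [ga [de [EA EB EA' EB']]]]]]; subst.
  have ev1 : evn (a1 ++ a3).
    move=> x; have [->|/ev] := eqVneq x v.
      by rewrite !mem_cat !negb_or in vA; rewrite count_cat; case/and3P: vA => /count_memPn-> _ /count_memPn->.
    by rewrite !count_cat !oddD; do 3!case: (odd _).
  have [a10 a30] := cat_nil2 (place_same ds ps s8 cs ev1).
  subst; rewrite /= !cats0 in cs ct; exact: crot_trans cs (crot_sym ct).
have ev1 : evn (al ++ ga).
  move=> x; have [->|/ev] := eqVneq x v.
    rewrite !mem_cat !negb_or in vA vB; rewrite count_cat.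
    by case/andP: vA => /count_memPn-> _; case/andP: vB => /count_memPn->.
  by rewrite !count_cat !oddD; do 3!case: (odd _).
have [] := place_cross ds ps s8 cs ev1 => /cat_nil2[a10 a30]; subst.
  rewrite /= ?cats0 in cs ct; exact: crot_trans cs (crot_sym ct).
rewrite /= !cats0 in cs ct; exact: crot_trans (crot_trans cs (crot_half _ _ _)) (crot_sym ct).
Qed.

Lemma last_rev v l : last v (rev l) = head v l.
Proof. by case: l => // a l; rewrite rev_cons last_rcons. Qed.

Lemma head_rev v l : head v (rev l) = last v l.
Proof. by case: (lastP l) => // l' z; rewrite rev_rcons last_rcons. Qed.

Lemma filter_arcs v A B : v \notin A -> v \notin B ->
  filter (predC1 v) (v :: A ++ v :: B) = A ++ B.
Proof.
have F l : v \notin l -> filter (predC1 v) l = l.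
  by move=> vl; apply/all_filterP/allP => x xl /=; apply: contraNneq vl => <-.
by move=> vA vB; rewrite /= eqxx /= filter_cat /= eqxx /= !F.
Qed.

(** An induction principle for prime words with at least six chords. The three splittings of the
    vertex [v] are deletion, reversal of an arc at [v] followed by deletion, and the latter after a
    reversal at a chord [w] crossing [v]. If none of them kept a word prime, all vertices would be
    obstructed, against [chain]. *)
Lemma reduce (P : seq T -> Prop) :
  (forall s t, crot s t -> P t -> P s) ->
  (forall w s, dow s -> w \in s -> P (lc w s) -> P s) ->
  (forall s v, dow s -> prime_word s -> 12 <= size s -> v \in s ->
     prime_word (filter (predC1 v) s) -> P s) ->
  forall s, dow s -> prime_word s -> 12 <= size s -> P s.
Proof.
move=> Pcrot Plc Pdel s ds ps s12; apply: NNPP => nP.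
have s8 : 8 <= size s by apply: leq_trans s12.
apply: (chain (uV_ s) (VE_ (s := s)) (reg_ ds) (prE_ ds ps) (V4_ ds s8)).
  by move: s12; rewrite size_V //; clear; lia.
move=> v; rewrite mem_undup => vs.
(* Deleting [v], or reversing an arc at [v] and then deleting [v], would keep the word prime. *)
have D u A B : dow u -> prime_word u -> 12 <= size u -> ~ P u ->
    u = v :: A ++ v :: B -> v \notin A -> v \notin B ->
    badw u v (last v A) (head v B) (head v A) (last v B).
  move=> du pu u12 nPu E vA vB; have u8 : 8 <= size u by apply: leq_trans u12.
  have vu : v \in u by rewrite E mem_head.
  have nA : A != [::] by apply: (prime_noloop du pu u8 (B := B)) vu; rewrite -E; apply: crot_refl.
  have nB : B != [::] by apply: (prime_noloop du pu u8 (B := A)) vu; rewrite E; apply: crot_half.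
  case: A B E vA vB nA nB => [|a A] [|b B] // E vA vB _ _; rewrite E in du pu u8 *.
  apply: del_bad => // pd; apply: nPu; apply: (Pdel _ v) => //; rewrite E //.
  by rewrite filter_arcs.
have L u A B : dow u -> prime_word u -> 12 <= size u -> ~ P u ->
    u = v :: A ++ v :: B -> v \notin A -> v \notin B ->
    badw u v (head v A) (head v B) (last v A) (last v B).
  move=> du pu u12 nPu E vA vB; have vu : v \in u by rewrite E mem_head.
  have El : lc v u = v :: rev A ++ v :: B by rewrite E; apply: (@lcE _ v [::]).
  apply: (@badw_transfer _ (lc v u)); first exact: lc_perm.
    by move=> Q sQ; apply: count_lc.
  have := D (lc v u) (rev A) B (lc_dow du vu) (prime_lc du vu pu).
  rewrite (perm_size (lc_perm du vu)) => /(_ u12 _ El).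
  rewrite last_rev head_rev.
  by apply=> //; [move=> /(Plc _ _ du vu)|rewrite mem_rev].
have [A [B [cs vA vB]]] := dow_arcs ds vs.
set u := v :: A ++ v :: B in cs.
have du : dow u := dow_crot cs ds.
have pu : prime_word u := prime_crot cs ps.
have zu : size u = size s by rewrite (perm_size (crot_perm cs)).
have u12 : 12 <= size u by rewrite zu.
have nPu : ~ P u by move=> Pu; apply: nP; apply: Pcrot cs Pu.
have tr p q r z : badw u v p q r z -> badw s v p q r z.
  apply: badw_transfer => [|Q _]; first by rewrite perm_sym; apply: crot_perm.
  by rewrite (permP (cp_perm cs)).
have b1 := tr _ _ _ _ (D u A B du pu u12 nPu erefl vA vB).
have b3 := tr _ _ _ _ (L u A B du pu u12 nPu erefl vA vB).
have u8 : 8 <= size u by apply: leq_trans u12.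
have vu : v \in u by rewrite mem_head.
have nA : A != [::] by apply: (prime_noloop du pu u8 (B := B)) vu; apply: crot_refl.
have nB : B != [::] by apply: (prime_noloop du pu u8 (B := A)) vu; apply: crot_half.
(* A chord crossing [v] exists, as otherwise the arc [A] would be a closed interval of a prime
   word. *)
have [w wA] : exists w, odd (count_mem w A).
  apply: NNPP => H; case: (prime_closed du pu u8 (al := A) (be := v :: B ++ [:: v])) => //.
  - by have := crot_cat [:: v] (A ++ v :: B); rewrite -catA.
  - by move=> x; apply/negP => ox; apply: H; exists x.
  - by move=> A0; rewrite A0 in nA.
have nwv : w != v by apply: contraTneq wA => ->; rewrite (count_memPn vA).
have cA : count_mem w A = 1 /\ count_mem w B = 1.
  have := dow_count w du; rewrite /u /= count_cat /= eq_sym (negbTE nwv); move: wA.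
  by case: (count_mem w A) => [|[|[|k]]] //= _ [] E; lia.
have wsplit l : count_mem w l = 1 -> exists l1 l2, [/\ l = l1 ++ w :: l2, w \notin l1 & w \notin l2].
  move=> c1; have wl : w \in l by rewrite -has_pred1 has_count c1.
  case/splitPr: wl c1 => l1 l2; rewrite count_cat /= eqxx => c1.
  by exists l1, l2; split=> //; apply/count_memPn; lia.
have [[A1 [A2 [EA wA1 wA2]]] [B1 [B2 [EB wB1 wB2]]]] : (exists l1 l2, [/\ A = l1 ++ w :: l2, w \notin l1 & w \notin l2]) /\
   (exists l1 l2, [/\ B = l1 ++ w :: l2, w \notin l1 & w \notin l2]).
  by split; apply: wsplit; case: cA.
have Elc : lc w u = v :: (A1 ++ w :: rev B1) ++ v :: (rev A2 ++ w :: B2).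
  have -> : u = (v :: A1) ++ w :: (A2 ++ v :: B1) ++ w :: B2.
    by rewrite /u EA EB /= -!catA /= -?catA.
  rewrite lcE; last 2 first.
  - by rewrite inE negb_or nwv.
  - by rewrite mem_cat inE !negb_or wA2 nwv.
  by rewrite rev_cat rev_cons cat_rcons /= -!catA /= -?catA.
have wu : w \in u by rewrite /u EA inE mem_cat mem_cat mem_head !orbT.
have [vA1 vA2] : v \notin A1 /\ v \notin A2.
  by move: vA; rewrite EA mem_cat inE !negb_or => /and3P[].
have [vB1 vB2] : v \notin B1 /\ v \notin B2.
  by move: vB; rewrite EB mem_cat inE !negb_or => /and3P[].
have b2 : badw s v (head v A) (last v A) (head v B) (last v B).
  apply/tr/(@badw_transfer _ (lc w u)); first exact: lc_perm.
    by move=> Q sQ; apply: count_lc.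
  have := L (lc w u) _ _ (lc_dow du wu) (prime_lc du wu pu).
  rewrite (perm_size (lc_perm du wu)) => /(_ _ _ u12 _ Elc).
  have -> : head v (A1 ++ w :: rev B1) = head v A by rewrite EA; case: (A1).
  have -> : head v (rev A2 ++ w :: B2) = last v A.
    by rewrite EA last_cat /=; case: (lastP A2) => // A3 z; rewrite rev_rcons last_rcons.
  have -> : last v (A1 ++ w :: rev B1) = head v B.
    by rewrite EB last_cat /= last_rev; case: (B1).
  have -> : last v (rev A2 ++ w :: B2) = last v B by rewrite EB !last_cat.
  apply.
  - by move=> /(Plc _ _ du wu).
  - by rewrite mem_cat inE !negb_or vA1 mem_rev vB1 eq_sym nwv.
  - by rewrite mem_cat inE !negb_or vB2 mem_rev vA2 eq_sym nwv.
have pn : perm_eq (nbr (cp s) v) [:: last v A; head v B; head v A; last v B].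
  have pnu : perm_eq (nbr (cp u) v) [:: last v A; head v B; head v A; last v B].
    rewrite /u; case: (A) (B) nA nB vA vB => [|a A'] [|b B'] // _ _ va vb; exact: nbr_full.
  apply: perm_trans pnu; rewrite /nbr.
  by apply: perm_cat; apply: perm_map; apply: perm_filter; apply: cp_perm.
have nv p : p \in [:: last v A; head v B; head v A; last v B] -> p != v.
  rewrite -(perm_mem pn); apply: (nbr_neq (uV_ s) (VE_ (s := s)) (reg_ ds) (prE_ ds ps) (V4_ ds s8)).
  by rewrite mem_undup.
exists (last v A), (head v B), (head v A), (last v B); split=> //.
  exact: badC b2.
have sw p q r z : badw s v p q r z -> badw s v p q z r.
  move=> [X [x1 /and4P[x2 x3 x4 x5] x6 x7 x8]].
  by exists X; split=> //; rewrite x2 x3 x4 x5.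
apply: sw; apply: badS b3; apply: nv; by rewrite !inE eqxx ?orbT.
Qed.

End Rigidity.

(* Rigidity for five chords is checked by computation, over the words in which the labels
   [0 .. k-1] make their last occurrences in decreasing order. *)
Fixpoint gen n k : seq (seq nat) :=
  if n is n'.+1 then
    flatten [seq [seq c :: w | c <- iota 0 k & count_mem c w < 2] | w <- gen n' k] ++
    (if k is k'.+1 then [seq k' :: w | w <- gen n' k'] else [::])
  else if k is 0 then [:: [::]] else [::].

Fixpoint ins1 (k : nat) w : seq (seq nat) :=
  (k :: w) :: if w is c :: w' then [seq c :: u | u <- ins1 k w'] else [::].

Fixpoint ins2 (k : nat) w : seq (seq nat) :=
  [seq k :: u | u <- ins1 k w] ++ if w is c :: w' then [seq c :: u | u <- ins2 k w'] else [::].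

(** Builds the competitors of [s] chord by chord, discarding a word as soon as the newest chord has
    wrong crossings. *)
Fixpoint cands (s : seq nat) k : seq (seq nat) :=
  if k is k'.+1 then
    [seq w <- flatten [seq ins2 k u | u <- cands s k']
      | all (fun j => crs w j k == crs s j k) (iota 0 k)]
  else [:: [:: 0; 0]].

Definition dihb (s t : seq nat) :=
  has (fun n => (t == rot n s) || (t == rot n (rev s))) (iota 0 10).

(** With five chords, one side of a violating set consists of exactly two, so pairs suffice. *)
Definition primeb5 (s : seq nat) :=
  all (fun j => all (fun k => 4 < cut (pred2 j k) s) (iota j.+1 (4 - j))) (iota 0 5).

Definition check5 := all (fun s => if primeb5 s then all (dihb s) (cands s 4) else true) (gen 10 5).

Lemma check5_true : check5.
Proof. by vm_compute. Qed.

(** * Rigidity by induction from five chords *)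

Section Relabel.
Variable T : eqType.
Implicit Types (s t l : seq T).

(** Since [undup] keeps last occurrences, putting a letter in front of a word does not change the
    labels of the old letters; the recursion of [gen] depends on this. *)
Definition lab s (p : T) := index p (rev (undup s)).

Lemma lab_inj s : {in s &, injective (lab s)}.
Proof.
move=> p q; rewrite -2!(mem_undup s) -2!(mem_rev (undup s)) /lab => pL qL E.
by rewrite -(nth_index p pL) E nth_index.
Qed.

Lemma gen_complete l : (forall p, count_mem p l <= 2) ->
  map (lab l) l \in gen (size l) (size (undup l)).
Proof.
elim: l => // c l IH H.
have Hl p : count_mem p l <= 2 by have := H p; rewrite /=; lia.
have {IH} IH := IH Hl.
have ci : count_mem (lab l c) (map (lab l) l) = count_mem c l.
  rewrite count_map; have [cl|ncl] := boolP (c \in l).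
    apply: eq_in_count => q ql /=; rewrite -[LHS]/(lab l q == lab l c).
    by rewrite (inj_in_eq (@lab_inj l)).
  rewrite (count_memPn ncl); apply/eqP; rewrite -leqn0 leqNgt -has_count.
  apply/hasPn => q ql /=; rewrite -[X in ~~ X]/(lab l q == lab l c) /lab.
  rewrite [index c _]memNindex ?mem_rev ?mem_undup //; apply: contraNneq ncl => E.
  by move: ql; rewrite -mem_undup -mem_rev -index_mem E ltnn.
rewrite /= mem_cat; have [cl|ncl] := boolP (c \in l).
  have -> : [seq lab (c :: l) i | i <- l] = [seq lab l i | i <- l].
    by apply: eq_map => q; rewrite /lab /= cl.
  apply/orP; left; apply/flatten_mapP; exists (map (lab l) l) => //.
  have -> : lab (c :: l) c = lab l c by rewrite /lab /= cl.
  apply: map_f; rewrite mem_filter ci mem_iota /= add0n; apply/andP; split.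
    by have := H c; rewrite /= eqxx; lia.
  by rewrite /lab -size_rev index_mem mem_rev mem_undup.
rewrite /= orbC /lab /= (negbTE ncl) rev_cons; apply/orP; left.
have -> : [seq index i (rcons (rev (undup l)) c) | i <- l] = [seq lab l i | i <- l].
  apply/eq_in_map => q ql; rewrite /lab -cats1 index_cat mem_rev mem_undup ql //.
rewrite -cats1 index_cat mem_rev mem_undup (negbTE ncl) /= eqxx addn0 size_rev.
exact: map_f.
Qed.

Lemma ins1_complete (k : nat) w : count_mem k w = 1 -> w \in ins1 k (filter (predC1 k) w).
Proof.
elim: w => //= c w IH; have [->|nck] := eqVneq c k => /= E.
  have -> : filter (predC1 k) w = w.
    by apply/all_filterP/allP => q qw /=; apply: contraTneq qw => ->; apply/count_memPn; move: E => /=; lia.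
  by case: (w) => [|? ?]; rewrite inE eqxx.
by rewrite inE; apply/orP; right; apply: map_f; apply: IH; move: E => /=; lia.
Qed.

Lemma ins2_complete (k : nat) w : count_mem k w = 2 -> w \in ins2 k (filter (predC1 k) w).
Proof.
elim: w => //= c w IH; have [->|nck] := eqVneq c k => /= E.
  have H : k :: w \in [seq k :: u | u <- ins1 k (filter (predC1 k) w)].
    by apply: map_f; apply: ins1_complete; move: E => /=; lia.
  by case: (filter _ w) H => [|? ?] H; rewrite mem_cat H.
rewrite -[X in _ \in X]/([seq k :: u | u <- ins1 k (c :: filter (predC1 k) w)] ++
  [seq c :: u | u <- ins2 k (filter (predC1 k) w)]).
by rewrite mem_cat; apply/orP; right; apply: map_f; apply: IH; move: E => /=; lia.
Qed.

Lemma cands_complete (s t : seq nat) n :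
  (forall j, j <= n -> count_mem j t = 2) ->
  (forall j k, j < k -> k <= n -> crs t j k = crs s j k) ->
  filter (fun j => j <= n) t \in cands s n.
Proof.
elim: n => [|n IH] c2 H.
  rewrite /= inE; have := c2 0 isT.
  have -> : count_mem 0 t = size (filter (fun j => j <= 0) t).
    by rewrite size_filter; apply: eq_count => -[].
  have : all (pred1 0) (filter (fun j => j <= 0) t).
    by apply/allP => j; rewrite mem_filter leqn0 => /andP[].
  by case: (filter _ t) => [|a [|b [|]]] //= /and3P[/eqP-> /eqP->].
have {}IH : filter (fun j => j <= n) t \in cands s n.
  by apply: IH => [j jn|j k jk kn]; [apply: c2|apply: H => //]; lia.
set w := filter _ t.
have E : filter (fun j => j <= n) t = filter (predC1 n.+1) w.
  rewrite /w -filter_predI; apply: eq_filter => j /=; lia.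
rewrite -[cands s n.+1]/([seq w <- flatten [seq ins2 n.+1 u | u <- cands s n] |
  all (fun j => crs w j n.+1 == crs s j n.+1) (iota 0 n.+1)]) mem_filter; apply/andP; split.
  apply/allP => j; rewrite mem_iota add0n => jn.
  by rewrite crs_filter ?H // ltnW.
apply/flatten_mapP; exists (filter (fun j => j <= n) t) => //.
rewrite E; apply: ins2_complete; rewrite count_filter -(c2 n.+1 (leqnn _)).
by apply: eq_count => j /=; case: eqP => // ->; rewrite leqnn.
Qed.

Lemma cut_map (f : T -> nat) s X : cut X (map f s) = cut (fun p => X (f p)) s.
Proof.
case: s => // c l; rewrite /cut /= -map_rcons.
move: (rcons l c) => l'; elim: l' c => //= b l' IH c; rewrite /cutE /=; congr (_ + _); exact: IH.
Qed.

Lemma prime_word_map (f : T -> nat) s : prime_word s -> prime_word (map f s).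
Proof. by move=> ps X; rewrite cut_map !count_map; apply: ps. Qed.

Definition rigid s := forall t, same_gr s t -> dih s t.

Lemma rigid5 s : dow s -> prime_word s -> size s = 10 -> rigid s.
Proof.
move=> ds ps s10 t [pe H].
set f := lab s; set s' := map f s; set t' := map f t.
have dt : dow t by rewrite -(dow_perm pe).
have us : size (undup s) = 5 by have := size_V ds; rewrite s10; lia.
have fi : {in s &, injective f} := @lab_inj s.
have c2 p : p \in s -> count_mem p s = 2 by apply: dowP.
have sg : s' \in gen 10 5.
  rewrite -s10 -us; apply: gen_complete => p.
  by have [/c2->|/count_memPn->] := boolP (p \in s).
have lt5 p : p \in s -> f p < 5.
  by move=> ps'; rewrite /f /lab -us -size_rev index_mem mem_rev mem_undup.
have sur j : j < 5 -> exists2 p, p \in s & f p = j.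
  rewrite -us -size_rev => jL; have [x0 _] : exists x0, x0 \in s.
    by case: (s) s10 => // a l _; exists a; rewrite mem_head.
  exists (nth x0 (rev (undup s)) j).
    by rewrite -(mem_undup s) -mem_rev mem_nth.
  by rewrite /f /lab index_uniq // rev_uniq undup_uniq.
have cnt u j : perm_eq s u -> j < 5 -> count_mem j (map f u) = 2.
  move=> pu /sur[p pS <-]; rewrite count_map -(c2 _ pS) (permP pu).
  apply: eq_in_count => q; rewrite -(perm_mem pu) => qS /=.
  by rewrite -[LHS]/(f q == f p) (inj_in_eq fi).
have cr j k : j < 5 -> k < 5 -> j != k -> crs t' j k = crs s' j k.
  move=> /sur[p pS <-] /sur[q qS <-] npq.
  have fi2 u : perm_eq s u -> {in [:: p, q & u] &, injective f}.
    have sub : {subset [:: p, q & s] <= s} by move=> z; rewrite !inE => /or3P[/eqP->|/eqP->|].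
    move=> pu z1 z2; rewrite !inE -!(perm_mem pu) => h1 h2.
    by apply: fi; apply: sub; rewrite !inE.
  rewrite /crs !inv_map; [|exact: fi2|exact: fi2].
  by have := H p q; rewrite /crs => -> //; apply: contraNneq npq => ->.
have ps' : prime_word s' by apply: prime_word_map.
have pb : primeb5 s'.
  apply/allP => j; rewrite mem_iota add0n => j5; apply/allP => k; rewrite mem_iota => /andP[jk k5].
  have {}k5 : k < 5 by lia.
  have njk : j != k by lia.
  have c4 : count (pred2 j k) s' = 4.
    have -> : count (pred2 j k) s' = count_mem j s' + count_mem k s'.
      elim: (s') => //= a l ->; have [->|] := eqVneq a j; first by rewrite (negbTE njk) /=; lia.
      by move=> _ /=; lia.
    by rewrite !cnt.
  apply: ps'; first by rewrite c4.
  by have := count_predC (pred2 j k) s'; rewrite c4 size_map s10; lia.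
have := allP check5_true _ sg; rewrite pb => /allP/(_ t') D.
have : dihb s' t'.
  apply: D; have -> : t' = filter (fun j => j <= 4) t'.
    apply/esym/all_filterP/allP => _ /mapP[p pT ->]; apply: lt5; by rewrite (perm_mem pe).
  apply: cands_complete => [j j4|j k jk k4]; first exact: cnt.
  by apply: cr; lia.
have back u : perm_eq s u -> forall n, t' = rot n (map f u) -> t = rot n u.
  move=> pu n; rewrite -map_rot /t' => E.
  have [x0 _] : exists x0, x0 \in s by case: (s) s10 => // a l _; exists a; rewrite mem_head.
  have K v : {subset v <= s} -> map (nth x0 (rev (undup s))) (map f v) = v.
    move=> sv; rewrite -map_comp -[RHS]map_id; apply/eq_in_map => p /sv pS /=.
    by rewrite /f /lab nth_index // mem_rev mem_undup.
  rewrite -(K t) ?E ?K // => p; rewrite ?mem_rot -?(perm_mem pu) -?(perm_mem pe) //.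
move=> /hasP[n _] /orP[/eqP E|/eqP E].
  by left; exists n; apply: back.
right; exists n; apply: back; first by rewrite perm_sym perm_rev.
by rewrite map_rev.
Qed.

Theorem prime_rigid s : dow s -> prime_word s -> 10 <= size s -> rigid s.
Proof.
move En: (size s) => n; elim/ltn_ind: n s En => n IH s En ds ps s10.
have [s12|s12] := leqP 12 (size s); last first.
  by apply: rigid5 => //; have := dow_even ds; move: s10 s12; rewrite En; case: n {IH En} => [|[|[|[|[|[|[|[|[|[|[|[|n]]]]]]]]]]]].
(* The length stays fixed inside [reduce]: rotation and reversal of arcs preserve it, and only
   deletion calls the outer induction. *)
apply: (reduce (P := fun s => dow s -> size s = n -> rigid s)) (ds) (ps) s12 ds En.
- move=> s1 t1 c1 r1 d1 n1 t g1.
  have d2 : dow t1 := dow_crot c1 d1.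
  apply: (@dih_trans _ _ t1); first by left.
  apply: r1 => //; first by rewrite -(perm_size (crot_perm c1)).
  exact: same_gr_trans (same_gr_sym (same_gr_crot d1 c1)) g1.
- move=> w s1 d1 w1 r1 _ n1 t g1; apply: (dih_of_lc d1 w1); first by case: g1.
  apply: r1; rewrite ?(perm_size (lc_perm d1 w1)) ?lc_dow //; exact: same_gr_lc.
move=> s1 v d1 p1 s12' vs1 pf _ n1 t g1.
have [A [B [cs vA vB]]] := dow_arcs d1 vs1.
have fAB := crot_filter (predC1 v) cs; rewrite filter_arcs // in fAB.
have sf : size s1 = (size (filter (predC1 v) s1)).+2.
  by rewrite (perm_size (crot_perm cs)) (perm_size (crot_perm fAB)) /= !size_cat /= !addnS.
have rf : rigid (filter (predC1 v) s1).
  apply: IH (erefl) (dow_filter _ d1) pf _; first by rewrite -n1 sf.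
  by move: s12'; rewrite sf.
have s8 : 8 <= size s1 by apply: leq_trans s12'.
(* Rigidity of the shorter word holds up to reversal; replacing [t] by its mirror image leaves only
   rotations to treat. *)
suff fin u : same_gr s1 u -> crot (filter (predC1 v) s1) (filter (predC1 v) u) -> crot s1 u.
  have [c1|c1] := rf _ (same_gr_filter (predC1 v) g1); first by left; apply: fin.
  have dt : dow t by case: g1 => pe _; rewrite -(dow_perm pe).
  have g2 : same_gr s1 (rev t).
    by apply: same_gr_trans g1 (same_gr_dih dt _); right; apply: crot_refl.
  right; rewrite -[t]revK; apply: crot_rev; apply: fin => //.
  by rewrite filter_rev; have := crot_rev c1; rewrite revK.
move=> g2 c1; have [pe H] := g2; have du : dow u by rewrite -(dow_perm pe).
have vu : v \in u by rewrite -(perm_mem pe).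
have [A' [B' [cu vA' vB']]] := dow_arcs du vu.
apply: (reinsert d1 p1 s8 cs vA vB du cu vA' vB') => [x nx|].
  by apply: H; rewrite eq_sym.
apply: crot_trans (crot_sym fAB) _; apply: crot_trans c1 _.
by have := crot_filter (predC1 v) cu; rewrite filter_arcs.
Qed.

End Relabel.

(** * The crossings determine the value *)

Section Move.
Variables (C : numClosedFieldType) (R : algType C) (x : 'I_3 -> R).
Hypothesis sx : sl2_triple x.
Variable T : eqType.
Implicit Types (m : T -> nat) (s t u A B : seq T) (v : T).

Lemma wval_crot m s t : dow s -> crot s t -> wval x m s = wval x m t.
Proof. by move=> ds /crotP[u [w [E ->]]]; subst s; apply: wval_rot. Qed.

Lemma wval_dih m s t : dow s -> dih s t -> wval x m s = wval x m t.
Proof.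
move=> ds [|c]; first exact: wval_crot.
by rewrite -(wval_rev sx) //; apply: wval_crot => //; rewrite (dow_perm (v := s)) // perm_rev.
Qed.

(** The move is a composite of two mutations, of the share with strands [v a2 v] and [B] and of the
    share with strands [a2] and [B]: each turns them over, and the net effect is on [v] only. *)
Lemma wval_move_same m (a1 a2 a3 : seq T) B v :
  dow (v :: (a1 ++ a2 ++ a3) ++ v :: B) -> evn (a1 ++ a3) ->
  wval x m (v :: (a1 ++ a2 ++ a3) ++ v :: B) = wval x m (v :: a2 ++ v :: a3 ++ B ++ a1).
Proof.
move=> ds ev.
have pe : perm_eq (v :: (a1 ++ a2 ++ a3) ++ v :: B) (v :: a2 ++ v :: a3 ++ B ++ a1).
  apply/permP => P; rewrite /= ?count_cat /= ?count_cat; clear; lia.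
have ev2 : evn (v :: a2 ++ v :: B).
  move=> p; have := dow_count p ds; have := ev p; rewrite /= ?count_cat /= ?count_cat; clear.
  by move=> h [] E; move: h; lia.
have ev1 : evn (a2 ++ B).
  by move=> p; have := ev2 p; rewrite /= ?count_cat /=; clear; case: (v == p) => /=; lia.
have d2 : dow ((v :: a2 ++ [:: v]) ++ a3 ++ B ++ a1).
  rewrite (dow_perm pe) in ds; by rewrite /= -!catA.
have -> : v :: a2 ++ v :: a3 ++ B ++ a1 = (v :: a2 ++ [:: v]) ++ a3 ++ B ++ a1.
  by rewrite /= -!catA.
rewrite (wval_swap sx m d2); last by rewrite /= -!catA.
have -> : rev (v :: a2 ++ [:: v]) = v :: rev a2 ++ [:: v].
  by rewrite rev_cons rev_cat /= -cats1.
have E1 : rev B ++ a3 ++ (v :: rev a2 ++ [:: v]) ++ a1 =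
     rev B ++ (a3 ++ [:: v]) ++ rev a2 ++ (v :: a1) by rewrite /= -!catA.
have d3 : dow (rev B ++ (a3 ++ [:: v]) ++ rev a2 ++ (v :: a1)).
  rewrite -E1; rewrite (@dow_perm _ _ ((v :: a2 ++ [:: v]) ++ a3 ++ B ++ a1)) //.
  apply/permP => P; rewrite /= ?count_cat /= ?count_cat ?count_rev /=; clear; lia.
rewrite E1 (wval_swap sx m d3); last first.
  by move=> p; have := ev1 p; rewrite ?count_cat ?count_rev addnC.
rewrite !revK.
apply: wval_crot => //; apply: crot_trans (crot_half _ _ _) _.
have := crot_cat (v :: B ++ v :: a1) (a2 ++ a3); rewrite /= -!catA /= -?catA; exact.
Qed.

Lemma wval_move_cross m (al be ga de : seq T) v :
  dow (v :: (al ++ be) ++ v :: ga ++ de) -> evn (al ++ ga) ->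
  wval x m (v :: (al ++ be) ++ v :: ga ++ de) = wval x m (v :: (be ++ ga) ++ v :: de ++ al).
Proof.
move=> ds ev.
have E1 : v :: (al ++ be) ++ v :: ga ++ de = (v :: al) ++ be ++ (v :: ga) ++ de.
  by rewrite /= -!catA.
rewrite E1 in ds *.
rewrite (wval_swap sx m ds); last first.
  by move=> p; have := ev p; rewrite /= ?count_cat /=; clear; case: (v == p) => /=; lia.
have E2 : rev (v :: ga) ++ be ++ rev (v :: al) ++ de =
   rev ga ++ (v :: be) ++ rev al ++ (v :: de).
  by rewrite !rev_cons -!cats1 -!catA.
have d3 : dow (rev ga ++ (v :: be) ++ rev al ++ (v :: de)).
  rewrite (@dow_perm _ _ ((v :: al) ++ be ++ (v :: ga) ++ de)) //.
  apply/permP => P; rewrite /= ?count_cat /= ?count_cat ?count_rev /=; clear; lia.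
rewrite E2 (wval_swap sx m d3); last first.
  by move=> p; have := ev p; rewrite ?count_cat ?count_rev addnC.
rewrite !revK; apply: wval_crot.
  rewrite (@dow_perm _ _ ((v :: al) ++ be ++ (v :: ga) ++ de)) //.
  apply/permP => P; rewrite /= ?count_cat /= ?count_cat /=; clear; lia.
have := crot_cat al (v :: be ++ ga ++ v :: de); rewrite /= -!catA /= -?catA; exact.
Qed.

(** The counterpart of [reinsert] without primeness: other places for [v] may exist, but mutations
    reach them. *)
Lemma wval_reinsert m s t v A B A' B' : dow s ->
  crot s (v :: A ++ v :: B) -> v \notin A -> v \notin B ->
  dow t -> crot t (v :: A' ++ v :: B') -> v \notin A' -> v \notin B' ->
  (forall y, y != v -> crs s v y = crs t v y) ->
  crot (A ++ B) (A' ++ B') -> wval x m s = wval x m t.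
Proof.
move=> ds cs vA vB dt ct vA' vB' E.
wlog pl : A B A' B' cs vA vB ct vA' vB' / placed A B A' B'.
  move=> H c0; have cs2 := crot_trans cs (crot_half _ _ _).
  have ct2 := crot_trans ct (crot_half _ _ _).
  have c1 := crot_trans (crot_cat B A) (crot_trans c0 (crot_cat A' B')).
  have c2 := crot_trans (crot_cat B A) c0.
  have c3 := crot_trans c0 (crot_cat A' B').
  by case: (placed_cases c0) => pl; [apply: H pl _|apply: H pl _|apply: H pl _|apply: H pl _].
move=> _.
have ev y : odd (count_mem y A) = odd (count_mem y A').
  have [->|ny] := eqVneq y v; first by rewrite (count_memPn vA) (count_memPn vA').
  by rewrite -(crs_arcs ds cs) // -(crs_arcs dt ct) // E.
rewrite (wval_crot m ds cs) (wval_crot m dt ct).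
have {}ds := dow_crot cs ds; have {}dt := dow_crot ct dt.
case: pl => [[a1 [a2 [a3 [EA EA' EB']]]]|[al [be [ga [de [EA EB EA' EB']]]]]]; subst.
  apply: wval_move_same => // y; have := ev y.
  by rewrite ?count_cat !oddD; do 3!case: (odd _).
apply: wval_move_cross => // y; have := ev y.
by rewrite ?count_cat !oddD; do 3!case: (odd _).
Qed.

Lemma wval_move m s t v : dow s -> same_gr s t ->
  crot (filter (predC1 v) s) (filter (predC1 v) t) -> wval x m s = wval x m t.
Proof.
move=> ds [pe E] c0; have dt : dow t by rewrite -(dow_perm pe).
have [vs|nvs] := boolP (v \in s); last first.
  have F u : v \notin u -> filter (predC1 v) u = u.
    by move=> vu; apply/all_filterP/allP => y yu /=; apply: contraNneq vu => <-.
  have nvt : v \notin t by rewrite -(perm_mem pe).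
  by rewrite !F // in c0; apply: wval_crot.
have vt : v \in t by rewrite -(perm_mem pe).
have [A [B [cs vA vB]]] := dow_arcs ds vs.
have [A' [B' [ct vA' vB']]] := dow_arcs dt vt.
apply: (wval_reinsert m ds cs vA vB dt ct vA' vB') => [y ny|]; first by apply: E; rewrite eq_sym.
have := crot_filter (predC1 v) cs; have := crot_filter (predC1 v) ct; rewrite !filter_arcs // => c2 c1.
exact: crot_trans (crot_sym c1) (crot_trans c0 c2).
Qed.

End Move.

(** * Splits of a word into two shares *)

Section Splits.
Variable T : eqType.
Implicit Types (s t u A B E l : seq T) (a b v y : T) (X P : pred T).

Lemma inv_notinl a b s : a \notin s -> inv a b s = 0.
Proof.
by elim: s => //= c s IH; rewrite inE negb_or eq_sym => /andP[/negbTE-> /IH->].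
Qed.

Lemma inv_notinr a b s : b \notin s -> inv a b s = 0.
Proof.
elim: s => //= c s IH; rewrite inE negb_or => /andP[_ bs].
by rewrite (count_memPn bs) muln0 IH.
Qed.

Lemma all_notin X s a : all X s -> ~~ X a -> a \notin s.
Proof. by move=> /allP H; apply: contra; apply: H. Qed.

Lemma all_predC_notin X s a : all (predC X) s -> X a -> a \notin s.
Proof. by move=> H Xa; apply: all_notin H _; rewrite /= negbK. Qed.

Definition split4 X s (al B ga E : seq T) :=
  [/\ crot s (al ++ B ++ ga ++ E), all X al, all X ga, all (predC X) B & all (predC X) E].

(** Only bridges of the inner share and bridges of the outer share cross, and all of them do: the
    crossings between the two sides form a block of rank at most one. *)
Lemma crs_split X s al B ga E y a : dow s -> split4 X s al B ga E -> ~~ X y -> X a ->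
  crs s y a = odd (count_mem y B) && odd (count_mem a ga).
Proof.
move=> ds [cs Xal Xga XB XE] ny Xa; rewrite (crs_crot _ _ ds cs) /crs !inv_cat !count_cat.
have yal := all_notin Xal ny; have yga := all_notin Xga ny.
have aB := all_predC_notin XB Xa; have aE := all_predC_notin XE Xa.
rewrite (inv_notinl _ yal) (inv_notinl _ yga) (inv_notinr _ aB) (inv_notinr _ aE).
by rewrite (count_memPn yal) (count_memPn yga) (count_memPn aE) !mul0n !addn0 !add0n oddM.
Qed.

Lemma first_split P l : has P l ->
  exists l1 c l2, [/\ l = l1 ++ c :: l2, P c & all (predC P) l1].
Proof.
elim: l => //= c l IH; have [Pc _|nPc /= /IH[l1 [d [l2 [-> Pd al]]]]] := boolP (P c).
  by exists [::], c, l.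
by exists (c :: l1), d, l2; rewrite /= nPc.
Qed.

Lemma runs X s a b : a \in s -> b \in s -> X a -> ~~ X b ->
  exists rho c sg, [/\ crot s (rho ++ c :: sg), all (predC X) rho, rho != [::], X c & X (last c sg)].
Proof.
move=> as_ bs Xa nXb; have [s' cs] := crot_to as_.
have : has (predC X) s'.
  apply/hasP; exists b => //; move: bs; rewrite (perm_mem (crot_perm cs)) inE.
  by case/orP => // /eqP E; rewrite -E (negbTE nXb) in Xa.
case/first_split => l1 [b' [l2 [E nb' al1]]].
have : has X (l2 ++ a :: l1) by rewrite has_cat /= Xa orbT.
case/first_split => m1 [c [m2 [E2 Xc am1]]].
exists (b' :: m1), c, m2; split=> //=; last 2 first.
- by apply/andP; split.
- have := congr1 (last a) E2; rewrite !last_cat /= => <-.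
  by have /allP := al1; case/lastP: (l1) => // l z /(_ z); rewrite mem_rcons mem_head last_rcons /= negbK; apply.
apply: crot_trans cs _; rewrite E -E2; exact: (crot_cat (a :: l1) (b' :: l2)).
Qed.

Lemma form X l :
  (exists a1 a2 a3 : seq T, [/\ l = a1 ++ a2 ++ a3, all (predC X) a1, all X a2 & all (predC X) a3]) \/
  (exists p x1 r x2 q, [/\ l = p ++ x1 :: r ++ x2 :: q, X x1, X x2, r != [::] & all (predC X) r]).
Proof.
elim: l => [|c l [[a1 [a2 [a3 [-> h1 h2 h3]]]]|[p [x1 [r [x2 [q [-> h1 h2 h3 h4]]]]]]]].
- by left; exists [::], [::], [::].
- have [Xc|nXc] := boolP (X c); last by left; exists (c :: a1), a2, a3; rewrite /= nXc.
  case: a2 h2 => [|x a2] h2.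
    by left; exists [::], [:: c], (a1 ++ a3); rewrite /= Xc all_cat h1.
  case: a1 h1 => [|z a1] h1.
    by left; exists [::], (c :: x :: a2), a3; split=> //; move: h2; rewrite /= Xc.
  by right; exists [::], c, (z :: a1), x, (a2 ++ a3); split=> //; case/andP: h2.
by right; exists (c :: p), x1, r, x2, q.
Qed.

Lemma cutE_step X a b (l1 l2 : seq T) :
  (X a != X b) + cutE (pw b l2) X <= cutE (pw a (l1 ++ b :: l2)) X.
Proof.
rewrite -cat_rcons cutE_pw_cat last_rcons leq_add2r.
by have := odd_pw X a (rcons l1 b); rewrite last_rcons; case: (cutE _ _) => [|n] //; case: (X a); case: (X b).
Qed.

(** Besides the run [rho], the complement of [X] either forms one further block or has two more
    runs; the latter makes six changes of side around the circle. *)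
Lemma split4_of_cut X s a b : a \in s -> b \in s -> X a -> ~~ X b -> cut X s <= 4 ->
  exists al B ga E, split4 X s al B ga E.
Proof.
move=> as_ bs Xa nXb c4; have [rho [c [sg [cs Xr nr Xc Xl]]]] := runs as_ bs Xa nXb.
have nn l : all (predC (predC X)) l = all X l by apply: eq_all => z; rewrite /= negbK.
case: (form (predC X) (c :: sg)) => [[a1 [a2 [a3 [E]]]]|].
  rewrite !nn => h1 h2 h3; exists a1, a2, a3, rho; split=> //.
  apply: crot_trans cs _; rewrite E; have := crot_cat rho (a1 ++ a2 ++ a3).
  by rewrite -!catA.
case=> p [y1 [r [y2 [q [E n1 n2 nr' hr]]]]]; rewrite nn in hr.
case: rho nr cs Xr => // z rho _ cs /= /andP[nz _].
case: r nr' hr E => // w r _ /= /andP[Xw _] E.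
case: p E => [[E _]|c' p [_ E]]; first by rewrite /= -E Xc in n1.
move: c4; rewrite (cut_crot _ cs) /cut /= rcons_cat rcons_cons.
have [q' [d [Eq Xd]]] : exists q' d, y2 :: q = y2 :: rcons q' d /\ X d.
  have {}Xl : X (last y2 q) by move: Xl; rewrite E last_cat /= last_cat.
  case/lastP: q {E} Xl => [|q' d]; first by rewrite /= (negbTE n2).
  by rewrite last_rcons => Xd; exists q', d.
rewrite Eq in E.
have -> : rcons sg z = p ++ y1 :: [::] ++ w :: r ++ y2 :: q' ++ d :: [::] ++ [:: z].
  by rewrite E rcons_cat /= rcons_cat /= -!cats1 -!catA.
have h1 := cutE_step X z c rho (p ++ y1 :: [::] ++ w :: r ++ y2 :: q' ++ d :: [::] ++ [:: z]).
have h2 := cutE_step X c y1 p ([::] ++ w :: r ++ y2 :: q' ++ d :: [::] ++ [:: z]).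
have h3 := cutE_step X y1 w [::] (r ++ y2 :: q' ++ d :: [::] ++ [:: z]).
have h4 := cutE_step X w y2 r (q' ++ d :: [::] ++ [:: z]).
have h5 := cutE_step X y2 d q' ([::] ++ [:: z]).
have h6 := cutE_step X d z [::] [::].
rewrite Xc (negbTE nz) in h1; rewrite Xc (negbTE n1) in h2; rewrite (negbTE n1) Xw in h3.
rewrite Xw (negbTE n2) in h4; rewrite (negbTE n2) Xd in h5; rewrite Xd (negbTE nz) in h6.
move: h1 h2 h3 h4 h5 h6; rewrite !cat0s; clear; lia.
Qed.

Lemma split4_counts X s al B ga E : split4 X s al B ga E ->
  count X s = size (al ++ ga) /\ count (predC X) s = size (B ++ E).
Proof.
move=> [cs Xal Xga XB XE]; rewrite !(permP (crot_perm cs)) !count_cat !size_cat.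
have F P l : all P l -> count P l = size l by move=> h; apply/eqP; rewrite -all_count.
have Z P l : all (predC P) l -> count P l = 0.
  by move=> h; apply/eqP; rewrite -leqn0 leqNgt -has_count -all_predC.
have Z2 P l : all P l -> count (predC P) l = 0.
  by move=> h; apply: Z; apply: sub_all h => z /= ->.
rewrite (F _ _ Xal) (F _ _ Xga) (F _ _ XB) (F _ _ XE) (Z _ _ XB) (Z _ _ XE) (Z2 _ _ Xal) (Z2 _ _ Xga).
by rewrite !addn0 !add0n.
Qed.

Lemma split4_filter X s al B ga E : split4 X s al B ga E ->
  crot (filter X s) (al ++ ga) /\ crot (filter (predC X) s) (B ++ E).
Proof.
move=> [cs Xal Xga XB XE].
have F P l : all P l -> filter P l = l by move/all_filterP.
have Z P l : all (predC P) l -> filter P l = [::].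
  by move=> h; apply/eqP; rewrite -size_eq0 size_filter -leqn0 leqNgt -has_count -all_predC.
have Z2 P l : all P l -> filter (predC P) l = [::].
  by move=> h; apply: Z; apply: sub_all h => z /= ->.
split; [have := crot_filter X cs|have := crot_filter (predC X) cs]; rewrite !filter_cat.
  by rewrite (F _ _ Xal) (F _ _ Xga) (Z _ _ XB) (Z _ _ XE) /= cats0.
by rewrite (F _ _ XB) (F _ _ XE) (Z2 _ _ Xal) (Z2 _ _ Xga).
Qed.

Lemma count_filter1 P s a : count_mem a (filter P s) = P a * count_mem a s.
Proof.
rewrite count_filter; case Pa: (P a); rewrite ?mul1n ?mul0n.
  by apply: eq_count => z /=; case: eqP => // ->.
by rewrite (eq_count (a2 := pred0)) ?count_pred0 // => z /=; case: eqP => // ->.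
Qed.

Lemma filter_with X l y : all (predC X) l -> count_mem y l = 1 ->
  filter (predU1 y X) l = [:: y].
Proof.
elim: l => //= c l IH /andP[nc al]; rewrite (negbTE nc) orbF eq_sym [y == c]eq_sym.
have [->|_ /(IH al)//] := eqVneq c y; move=> [/eqP c0]; congr (_ :: _).
apply/eqP; rewrite -size_eq0 size_filter -leqn0 leqNgt -has_count; apply/hasPn => z zl /=.
rewrite (negbTE (allP al z zl)) orbF; apply: contraTneq zl => ->.
by apply/count_memPn/eqP.
Qed.

(* A chord outside [X] that crosses [X] becomes the only trace of the complement of [X]. *)
Lemma split4_with X s al B ga E y a : dow s -> split4 X s al B ga E ->
  ~~ X y -> X a -> crs s y a ->
  [/\ count_mem y B = 1, count_mem y E = 1 &
      crot (filter (predU1 y X) s) (y :: ga ++ y :: al)].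
Proof.
move=> ds sp ny Xa; rewrite (crs_split ds sp ny Xa) => /andP[oB _].
have [cs Xal Xga XB XE] := sp.
have c1 : count_mem y B = 1 /\ count_mem y E = 1.
  have := dow_count y ds; rewrite (permP (crot_perm cs)) !count_cat.
  rewrite (count_memPn (all_notin Xal ny)) (count_memPn (all_notin Xga ny)).
  case: (count_mem y B) oB => [|[|[|n]]] //=; clear; lia.
case: c1 => cB cE; split=> //.
have := crot_filter (predU1 y X) cs; rewrite !filter_cat (filter_with XB cB) (filter_with XE cE).
have F l : all X l -> filter (predU1 y X) l = l.
  by move=> h; apply/all_filterP; apply: sub_all h => z /= ->; rewrite orbT.
rewrite (F _ Xal) (F _ Xga) => h; apply: crot_trans h _.
have := crot_cat al (y :: ga ++ [:: y]); by rewrite /= -!catA.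
Qed.

Lemma split4C X s al B ga E : split4 X s al B ga E -> split4 (predC X) s B ga E al.
Proof.
move=> [cs h1 h2 h3 h4]; split=> //; last 2 first.
- by apply: sub_all h2 => z /= ->.
- by apply: sub_all h1 => z /= ->.
by apply: crot_trans cs _; have := crot_cat al (B ++ ga ++ E); rewrite -!catA.
Qed.

End Splits.

(** * Disconnected diagrams *)

Section Disconnected.
Variable T : eqType.
Implicit Types (s t u A B E l : seq T) (a b v y : T) (X P : pred T).

Definition disc X s := forall a b, X a -> ~~ X b -> crs s a b = false.

Lemma dow_is_evn s : dow s -> evn s.
Proof. by move=> ds p; case: (dow_count p ds) => ->. Qed.

(* Take [X] minimal. A chord outside [X] has all of [X] on one side of it, so a maximal run of letters
   outside [X] is closed. *)
Lemma disc_interval X s a b : dow s -> disc X s -> a \in s -> b \in s -> X a -> ~~ X b ->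
  exists rho sg, [/\ crot s (rho ++ sg), evn rho, rho != [::] & sg != [::]].
Proof.
move En: (count X s) => n; elim/ltn_ind: n X a b En => n IH X a b En ds dX as_ bs Xa nXb.
have [rho [c [sg [cs Xr nr Xc Xl]]]] := runs as_ bs Xa nXb.
have [ev|nev] := classic (evn rho); first by exists rho, (c :: sg).
have [z oz] : exists z, odd (count_mem z rho).
  by apply: NNPP => H; apply: nev => p; apply/negP => op; apply: H; exists p.
have zr : z \in rho by rewrite -has_pred1 has_count; case: (count_mem z rho) oz.
have nXz : ~~ X z := allP Xr z zr.
have zsg : z \in c :: sg.
  rewrite -has_pred1 has_count; have := dow_count z ds.
  rewrite (permP (crot_perm cs)) count_cat; case: (count_mem z rho) oz => [|[|[|k]]] //= _; clear; lia.
case/splitPr: zr cs Xr nr oz => r1 r2 cs Xr nr oz.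
have [q1 [q2 E]] : exists q1 q2, c :: sg = q1 ++ z :: q2.
  by case/splitPr: zsg => q1 q2; exists q1, q2.
rewrite E -catA /= in cs.
have Xc1 : c \in q1.
  by case: q1 E {cs} => [[E _]|d q1 [-> _]]; [rewrite -E Xc in nXz|rewrite mem_head].
have Xl2 : last c sg \in q2.
  have -> : last c sg = last z q2 by have := congr1 (last c) E; rewrite last_cat.
  have : X (last z q2) by have := congr1 (last c) E; rewrite last_cat /= => <-.
  by case: (q2) => [|d l] /=; [rewrite (negbTE nXz)|rewrite mem_last].
have cz : crot s (z :: (r2 ++ q1) ++ z :: (q2 ++ r1)).
  by apply: crot_trans cs _; have := crot_cat r1 (z :: r2 ++ q1 ++ z :: q2); rewrite /= -!catA /= -?catA.
have dz := dow_crot cz ds.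
have [Xr1 Xr2] : all (predC X) r1 /\ all (predC X) r2.
  by move: Xr; rewrite all_cat /= => /and3P[].
have cnt (u : T) : X u -> count_mem u q1 = 0 \/ count_mem u q1 = 2 /\ u \notin q2.
  move=> Xu; have nuz : u != z by apply: contraTneq Xu => ->.
  have : crs s z u = false.
    by rewrite crs_sym 1?eq_sym // dX.
  have [zA zB] : z \notin r2 ++ q1 /\ z \notin q2 ++ r1.
    by have := dowP _ dz z (mem_head _ _); rewrite /= eqxx count_cat /= eqxx => h;
      split; apply/count_memPn; move: h; clear; lia.
  rewrite (crs_arcs ds cz) // count_cat (count_memPn (all_predC_notin Xr2 Xu)).
  have := dow_count u dz; rewrite /= eq_sym (negbTE nuz) count_cat /= count_cat eq_sym (negbTE nuz) count_cat.
  rewrite (count_memPn (all_predC_notin Xr2 Xu)).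
  case: (count_mem u q1) => [|[|[|k]]] //= h _; first by left.
    by right; split=> //; apply/count_memPn; move: h; clear; lia.
  by exfalso; move: h; clear; lia.
pose X' := predI X (mem q1).
have nl : last c sg \notin q1.
  by case: (cnt _ Xl) => [/count_memPn//|[_]]; rewrite Xl2.
apply: (IH (count X' s) _ X' c (last c sg) erefl) => //.
- rewrite -En -(size_filter X) -(count_predC (mem q1) (filter X s)) !count_filter.
  rewrite -[X in X < _]addn0 -addnS leq_add //.
    by apply/eq_leq/eq_count => p; apply: andbC.
  rewrite -has_count; apply/hasP; exists (last c sg); last by rewrite /= nl.
  by rewrite (perm_mem (crot_perm cs)) !(inE, mem_cat) Xl2 !orbT.
- move=> p q /andP[Xp pq1] nq; have [Xq|nXq] := boolP (X q); last exact: dX.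
  have nq1 : q \notin q1 by move: nq; rewrite /X' /= Xq.
  have [/count_memPn/negP//|[c2 np2]] := cnt p Xp.
  have c3 : crot s (q1 ++ (z :: q2 ++ r1 ++ z :: r2)).
    by apply: crot_trans cz _; have := crot_cat (z :: r2) (q1 ++ z :: q2 ++ r1); rewrite /= -!catA /= -?catA.
  rewrite (crs_crot _ _ ds c3) /crs inv_cat (inv_notinr _ nq1) c2 oddD oddM /= addbF add0n.
  rewrite -[_ + _]/(inv p q (z :: q2 ++ r1 ++ z :: r2)) inv_notinl //.
  rewrite !(inE, mem_cat) !negb_or np2 (all_predC_notin Xr1 Xp) (all_predC_notin Xr2 Xp) andbT /=.
  by rewrite andbb; apply: contraTneq Xp => ->.
- by rewrite (perm_mem (crot_perm cs)) !(inE, mem_cat) Xc1 !orbT.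
- by rewrite (perm_mem (crot_perm cs)) !(inE, mem_cat) Xl2 !orbT.
- by rewrite /X' /= Xc.
- by rewrite /X' /= (negbTE nl) andbF.
Qed.


Lemma disc_filter P X s : disc X s -> disc X (filter P s).
Proof.
move=> dX a b Xa nXb; have [Pa|nPa] := boolP (P a); last first.
  by rewrite /crs inv_notinl // mem_filter (negbTE nPa).
have [Pb|nPb] := boolP (P b); last by rewrite /crs inv_notinr // mem_filter (negbTE nPb).
by rewrite crs_filter // dX.
Qed.

Lemma filter_mem_cat (u v : seq T) : {in u, forall p, p \notin v} ->
  filter (mem u) (u ++ v) = u /\ filter (predC (mem u)) (u ++ v) = v.
Proof.
move=> dis; have E1 : filter (mem u) u = u by apply/all_filterP/allP.
have E2 : filter (predC (mem u)) v = v.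
  by apply/all_filterP/allP => p pv /=; apply: contraL pv; apply: dis.
have E3 : filter (mem u) v = [::].
  apply/eqP; rewrite -size_eq0 size_filter -leqn0 leqNgt -has_count; apply/hasPn => p pv /=.
  by apply: contraL pv; apply: dis.
have E4 : filter (predC (mem u)) u = [::].
  apply/eqP; rewrite -size_eq0 size_filter -leqn0 leqNgt -has_count; apply/hasPn => p pu /=.
  by rewrite negbK.
by rewrite !filter_cat E1 E2 E3 E4 cats0.
Qed.

Lemma disc_crot X s t : dow s -> crot s t -> disc X s -> disc X t.
Proof. by move=> ds cs dX a b Xa nXb; rewrite -(crs_crot _ _ ds cs) dX. Qed.

End Disconnected.

Section Product.
Variables (C : numClosedFieldType) (R : algType C) (x : 'I_3 -> R).
Hypothesis sx : sl2_triple x.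
Variable T : eqType.
Implicit Types (m : T -> nat) (s t u A B : seq T) (v : T) (X P : pred T).
Local Open Scope ring_scope.

Lemma wval_nil m : wval x m [::] = 1.
Proof. by rewrite /wval /W /= /xp big_nil. Qed.

Lemma wval_comm m (u v : seq T) : dow (u ++ v) -> evn u -> wval x m u * wval x m v = wval x m v * wval x m u.
Proof.
move=> ds ev; have [du dv dis] := dow_evn ds ev.
rewrite -(wval_cat x m ds) // wval_rot // wval_cat //; last exact: dow_is_evn.
by rewrite dow_catC.
Qed.

Lemma wval_disc m X s : dow s -> disc X s ->
  wval x m s = wval x m (filter X s) * wval x m (filter (predC X) s).
Proof.
move En: (size s) => n; elim/ltn_ind: n s En => n IH s En ds dX.
have tr P u : ~~ has P u -> filter P u = [::] /\ filter (predC P) u = u.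
  move=> h; have al : all (predC P) u by rewrite all_predC.
  by split; [apply/eqP; rewrite -size_eq0 size_filter -leqn0 leqNgt -has_count|apply/all_filterP].
have nn : filter (predC (predC X)) s = filter X s by apply: eq_filter => z; rewrite /= negbK.
have [/hasP[a as_ Xa]|/tr[-> ->]] := boolP (has X s); last by rewrite wval_nil GRing.mul1r.
have [/hasP[b bs nXb]|/tr] := boolP (has (predC X) s); last first.
  by rewrite nn => -[-> ->]; rewrite wval_nil GRing.mulr1.
have [rho [sg [cs ev nr ns]]] := disc_interval ds dX as_ bs Xa nXb.
have drs := dow_crot cs ds; have [dr dsg dis] := dow_evn drs ev.
have [Er Es] := filter_mem_cat dis.
have dXrs := disc_crot ds cs dX.
have dXr : disc X rho by rewrite -Er; apply: disc_filter.
have dXs : disc X sg by rewrite -Es; apply: disc_filter.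
have sz : (size s = size rho + size sg)%N by rewrite (perm_size (crot_perm cs)) size_cat.
have [zr zs] : (0 < size rho)%N /\ (0 < size sg)%N by split; rewrite lt0n size_eq0.
rewrite (wval_crot sx m ds cs) wval_cat //.
rewrite (IH (size rho)) // ?(IH (size sg) _ sg) //; try by (rewrite -En sz; lia).
have evf P u : evn u -> evn (filter P u).
  by move=> eu p; rewrite count_filter1 oddM negb_and eu orbT.
have cf P : wval x m (filter P s) = wval x m (filter P rho) * wval x m (filter P sg).
  have c2 := crot_filter P cs; rewrite (wval_crot sx m (dow_filter P ds) c2) filter_cat.
  by rewrite wval_cat // -?filter_cat; [apply: dow_filter|apply: evf].
rewrite !cf -!GRing.mulrA; congr (_ * _); rewrite !GRing.mulrA; congr (_ * _).
(* Choosing the complement of [X] on [rho] and [X] on [sg] presents the two middle factors as the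
   values of disjoint closed words, which commute by rotation. *)
pose P p := if p \in rho then ~~ X p else X p.
have E1 : filter (predC X) rho = filter P rho.
  by apply: eq_in_filter => p pr; rewrite /P pr.
have E2 : filter X sg = filter P sg.
  by apply: eq_in_filter => p ps; rewrite /P ifN //; apply: contraL ps; apply: dis.
by rewrite E1 E2; apply: wval_comm; rewrite -?filter_cat; [apply: dow_filter|apply: evf].
Qed.

End Product.

Section SmallWords.
Variable T : eqType.
Implicit Types (s t u A B E l : seq T) (a b v y : T) (X P : pred T).

Lemma small_crot s t : dow s -> size s <= 4 -> same_gr s t -> crot s t.
Proof.
move=> ds s4 [pe H]; have dt : dow t by rewrite -(dow_perm pe).
case: s ds s4 pe H => [|v s0] ds s4 pe H.
  by have := perm_size pe; case: (t) => // _; apply: crot_refl.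
set s := v :: s0 in ds s4 pe H *; have vs : v \in s := mem_head _ _.
have vt : v \in t by rewrite -(perm_mem pe).
have [A [B [cs vA vB]]] := dow_arcs ds vs; have [A' [B' [ct vA' vB']]] := dow_arcs dt vt.
have dAB : dow (A ++ B).
  by rewrite -(filter_arcs vA vB); apply: dow_filter; apply: dow_crot ds.
have peAB : perm_eq (A ++ B) (A' ++ B').
  rewrite -(filter_arcs vA vB) -(filter_arcs vA' vB'); apply: perm_filter.
  by apply: perm_trans _ (perm_trans pe (crot_perm ct)); rewrite perm_sym; apply: crot_perm.
have sz : size (A ++ B) <= 2.
  by move: s4; rewrite (perm_size (crot_perm cs)) /= !size_cat /=; clear; lia.
have szE := perm_size peAB.
have par y : odd (count_mem y A) = odd (count_mem y A').
  have [->|ny] := eqVneq y v; first by rewrite (count_memPn vA) (count_memPn vA').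
  by rewrite -(crs_arcs ds cs) // -(crs_arcs dt ct) // H // eq_sym.
have [w Hw] : exists w, all (pred1 w) (A ++ B).
  case EA: (A ++ B) dAB sz => [|w l] dAB sz; first by exists v.
  exists w; rewrite all_count; have := dowP _ dAB w (mem_head _ _) => -> /=.
  have := count_size (pred1 w) (w :: l); rewrite (dowP _ dAB w (mem_head _ _)) /=; move: sz => /=; clear; lia.
have Hw' : all (pred1 w) (A' ++ B') by rewrite -(perm_all _ peAB).
apply: crot_trans cs (crot_trans _ (crot_sym ct)).
move: Hw Hw'; rewrite !all_cat => /andP[/all_pred1P EA /all_pred1P EB] /andP[/all_pred1P EA' /all_pred1P EB'].
have := par w; have evAB : ~~ odd (size (A ++ B)) := dow_even dAB.
rewrite EA EB EA' EB' !count_nseq /= eqxx !mul1n.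
move: sz szE evAB; rewrite !size_cat.
case: (size A) => [|[|[|i]]]; case: (size B) => [|[|[|j]]] //;
case: (size A') => [|[|[|i']]]; case: (size B') => [|[|[|j']]] // _ _ _ _; try exact: crot_refl;
try exact: crot_half.
Qed.

End SmallWords.

(** * Twin and pendant chords *)

Section Twins.
Variable T : eqType.
Implicit Types (s t u A B E l : seq T) (a b c y z : T) (X P : pred T).

(* Either [a] and [b] cross the same other chords, or [b] crosses no chord except possibly [a]. *)
Definition twin s a b :=
  (forall c, c != a -> c != b -> crs s b c = crs s a c) \/
  (forall c, c != a -> c != b -> crs s b c = false).

Lemma same_gr_twin s t a b : same_gr s t -> twin s a b -> twin t a b.
Proof.
move=> [_ H] [tw|tw]; [left|right] => c ca cb; rewrite -!H; try by rewrite eq_sym.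
  exact: tw. exact: tw.
Qed.

Lemma same_gr_insert s t b A B : dow s -> dow t -> b \in s -> b \in t ->
  crot (filter (predC1 b) s) (filter (predC1 b) t) ->
  crot t (b :: A ++ b :: B) -> b \notin A -> b \notin B ->
  (forall c, c != b -> crs s b c = odd (count_mem c A)) -> same_gr s t.
Proof.
move=> ds dt bs bt cf ct bA bB H.
have Hb c : c != b -> crs s b c = crs t b c by move=> ncb; rewrite H // (crs_arcs dt ct).
split=> [|c d ncd].
  apply/allP => z _; apply/eqP; have [->|nzb] := eqVneq z b.
    by rewrite (dowP _ ds) // (dowP _ dt).
  have := permP (crot_perm cf) (pred1 z); by rewrite !count_filter1 /= nzb !mul1n.
have [E|ncb] := eqVneq c b; first by rewrite E Hb // -E eq_sym.
have [E|ndb] := eqVneq d b.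
  by rewrite E in ncd *; rewrite crs_sym // [RHS]crs_sym // Hb.
rewrite -(crs_filter (P := predC1 b)) // -[RHS](crs_filter (P := predC1 b)) //.
exact: crs_crot (dow_filter _ ds) cf.
Qed.

(** The new place of [b] is explicit: beside both ends of [a] for a twin, around one end of [a] or
    isolated next to it for a pendant chord; whether [a] and [b] cross decides between the
    variants. *)
Lemma twin_split s a b : dow s -> a \in s -> b \in s -> a != b -> twin s a b ->
  exists t al B ga E, [/\ same_gr s t, crot (filter (predC1 b) s) (filter (predC1 b) t)
    & split4 (pred2 a b) t al B ga E].
Proof.
move=> ds as_ bs nab tw; have [A [B [cs aA aB]]] := dow_arcs ds as_.
pose A0 := filter (predC1 b) A; pose B0 := filter (predC1 b) B.
have bA : b \notin A0 by rewrite mem_filter /= eqxx.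
have bB : b \notin B0 by rewrite mem_filter /= eqxx.
have aA0 : a \notin A0 by rewrite mem_filter (negbTE aA) andbF.
have aB0 : a \notin B0 by rewrite mem_filter (negbTE aB) andbF.
have fA : filter (predC1 b) A0 = A0 by rewrite filter_id.
have fB : filter (predC1 b) B0 = B0 by rewrite filter_id.
have cf : crot (filter (predC1 b) s) (a :: A0 ++ a :: B0).
  by have := crot_filter (predC1 b) cs; rewrite /= nab filter_cat /= nab.
have XA l : a \notin l -> b \notin l -> all (predC (pred2 a b)) l.
  move=> al bl; apply/allP => z zl /=; rewrite negb_or.
  by apply/andP; split; apply: contraTneq zl => ->.
have XA0 := XA _ aA0 bA; have XB0 := XA _ aB0 bB.
have fin (t al ga A' B' : seq T) : t = al ++ A0 ++ ga ++ B0 ->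
    all (pred2 a b) al -> all (pred2 a b) ga ->
    filter (predC1 b) t = a :: A0 ++ a :: B0 -> count_mem b (al ++ ga) = 2 ->
    crot t (b :: A' ++ b :: B') -> b \notin A' -> b \notin B' ->
    (forall c, c != b -> crs s b c = odd (count_mem c A')) ->
    exists t al B ga E, [/\ same_gr s t, crot (filter (predC1 b) s) (filter (predC1 b) t)
    & split4 (pred2 a b) t al B ga E].
  move=> Et Xal Xga ft cb ct bA' bB' H; exists t, al, A0, ga, B0.
  have cft : crot (filter (predC1 b) s) (filter (predC1 b) t) by rewrite ft.
  split=> //; last by rewrite Et; split=> //; apply: crot_refl.
  have cbt : count_mem b t = 2.
    by rewrite Et !count_cat (count_memPn bA) (count_memPn bB) -cb count_cat; clear; lia.
  have dt : dow t.
    apply/dowP => z zt; have [->//|nzb] := eqVneq z b.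
    have := permP (crot_perm cft) (pred1 z); rewrite !count_filter1 /= nzb !mul1n => E.
    by case: (dow_count z ds) => E2; rewrite -E // E2; move: zt; rewrite -has_pred1 has_count -E E2.
  apply: (same_gr_insert (b := b) (A := A') (B := B')) => //.
  by rewrite -has_pred1 has_count cbt.
have nba : b != a by rewrite eq_sym.
have cA c : c != b -> count_mem c A0 = count_mem c A.
  by move=> ncb; rewrite count_filter1 /= ncb mul1n.
have cAa c : c != a -> crs s a c = odd (count_mem c A).
  exact: (crs_arcs ds cs aA aB).
move: (crs s a b) (crs_sym ds nab) => e eba; case: e eba => eba; case: tw => tw.
- apply: (fin ([:: a; b] ++ A0 ++ [:: a; b] ++ B0) [:: a; b] [:: a; b] (A0 ++ [:: a]) (B0 ++ [:: a])).
  + by [].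
  + by rewrite /= !eqxx orbT.
  + by rewrite /= !eqxx orbT.
  + by rewrite /= !filter_cat /= eqxx nab fA fB.
  + by rewrite /= eqxx (negbTE nab).
  + by have := crot_cat [:: a] (b :: A0 ++ [:: a; b] ++ B0); rewrite /= -!catA.
  + by rewrite mem_cat inE negb_or bA.
  + by rewrite mem_cat inE negb_or bB.
  move=> c ncb; rewrite count_cat /= addn0 cA //.
  have [->|nca] := eqVneq c a; first by rewrite -eba (count_memPn aA).
  by rewrite tw // addn0 cAa.
- apply: (fin ([:: b; a; b] ++ A0 ++ [:: a] ++ B0) [:: b; a; b] [:: a] [:: a] (A0 ++ a :: B0)).
  + by [].
  + by rewrite /= !eqxx !orbT.
  + by rewrite /= !eqxx.
  + by rewrite /= !filter_cat /= eqxx nab fA fB.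
  + by rewrite /= eqxx (negbTE nab).
  + exact: crot_refl.
  + by rewrite inE.
  + by rewrite mem_cat inE !negb_or bA nba.
  move=> c ncb; rewrite /= addn0.
  have [->|nca] := eqVneq c a; first by rewrite -eba.
  by rewrite tw.
- apply: (fin ([:: a; b] ++ A0 ++ [:: b; a] ++ B0) [:: a; b] [:: b; a] A0 (a :: B0 ++ [:: a])).
  + by [].
  + by rewrite /= !eqxx orbT.
  + by rewrite /= !eqxx orbT.
  + by rewrite /= !filter_cat /= eqxx nab fA fB.
  + by rewrite /= eqxx (negbTE nab).
  + by have := crot_cat [:: a] (b :: A0 ++ [:: b; a] ++ B0); rewrite /= -!catA.
  + by [].
  + by rewrite inE mem_cat inE !negb_or bB nba.
  move=> c ncb; rewrite cA //.
  have [->|nca] := eqVneq c a; first by rewrite -eba (count_memPn aA).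
  by rewrite tw // cAa.
apply: (fin ([:: b; b; a] ++ A0 ++ [:: a] ++ B0) [:: b; b; a] [:: a] [::] (a :: A0 ++ a :: B0)).
+ by [].
+ by rewrite /= !eqxx !orbT.
+ by rewrite /= !eqxx.
+ by rewrite /= !filter_cat /= eqxx nab fA fB.
+ by rewrite /= eqxx (negbTE nab).
+ exact: crot_refl.
+ by [].
+ by rewrite inE mem_cat inE !negb_or bA bB nba.
move=> c ncb /=; have [->|nca] := eqVneq c a; first by rewrite -eba.
by rewrite tw.
Qed.

(** By [crs_split] each of [a] and [b] crosses, among the outer chords, either none or exactly those
    of odd multiplicity in [B]. *)
Lemma twin_of_split s a b al B ga E : dow s -> a != b ->
  split4 (pred2 a b) s al B ga E -> twin s a b \/ twin s b a.
Proof.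
move=> ds nab sp.
have H c d : c != a -> c != b -> (d == a) || (d == b) ->
    crs s d c = odd (count_mem c B) && odd (count_mem d ga).
  move=> nca ncb dab; have ncd : c != d by case/orP: dab => /eqP->.
  rewrite crs_sym 1?eq_sym //; apply: (crs_split ds sp) => //=.
  by rewrite negb_or nca.
have Ha c nca ncb := H c a nca ncb (introT orP (or_introl (eqxx a))).
have Hb c nca ncb := H c b nca ncb (introT orP (or_intror (eqxx b))).
case oa: (odd (count_mem a ga)); case ob: (odd (count_mem b ga)).
- by left; left => c nca ncb; rewrite Ha // Hb // oa ob.
- by left; right => c nca ncb; rewrite Hb // ob andbF.
- by right; right => c nca ncb; rewrite Ha // oa andbF.
- by left; right => c nca ncb; rewrite Hb // ob andbF.
Qed.

End Twins.

(** * Two words with a common split *)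

Section CommonSplit.
Variables (C : numClosedFieldType) (R : algType C) (x : 'I_3 -> R).
Hypothesis sx : sl2_triple x.
Variable T : eqType.
Implicit Types (m : T -> nat) (s t u A B E : seq T) (a b y z : T) (X P : pred T).

Definition invariant n := forall s t m,
  size s < n -> dow s -> same_gr s t -> wval x m s = wval x m t.

(** Expanding the outer share of [s1] turns it into the weighted chord [y]. The remaining words
    consist of [X] and [y], are shorter than [s1], and have the same graph for [s1] as for [s2], so
    the inner share can be exchanged. *)
Lemma wval_half n X s1 s2 al1 B1 ga1 E1 al2 B2 ga2 E2 y a m : invariant n ->
  dow s1 -> same_gr s1 s2 -> size s1 = n ->
  split4 X s1 al1 B1 ga1 E1 -> split4 X s2 al2 B2 ga2 E2 ->
  X a -> ~~ X y -> crs s1 y a -> 2 < count (predC X) s1 ->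
  wval x m s1 = wval x m (al2 ++ B1 ++ ga2 ++ E1).
Proof.
move=> IH ds1 g12 s1n sp1 sp2 Xa nXy cya c3.
have ds2 : dow s2 by case: g12 => pe _; rewrite -(dow_perm pe).
have nya : y != a by apply: contraNneq nXy => ->.
have [_ _ f1] := split4_with ds1 sp1 nXy Xa cya.
have cya2 : crs s2 y a by case: g12 => _ <-.
have [_ _ f2] := split4_with ds2 sp2 nXy Xa cya2.
have [cs1 Xal1 Xga1 XB1 XE1] := sp1; have [cs2 Xal2 Xga2 XB2 XE2] := sp2.
have [p1 _] := split4_filter sp1; have [p2 _] := split4_filter sp2.
have pag : perm_eq (al1 ++ ga1) (al2 ++ ga2).
  apply: perm_trans (crot_perm p2); rewrite perm_sym; apply: perm_trans (crot_perm p1).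
  by case: g12 => pe _; rewrite perm_sym; apply: perm_filter.
have d1 := dow_crot cs1 ds1.
have d2 : dow (al2 ++ B1 ++ ga2 ++ E1).
  rewrite (@dow_perm _ _ (al1 ++ B1 ++ ga1 ++ E1)) //; apply/permP => P.
  by have := permP pag P; rewrite !count_cat; clear; lia.
have dBE : dow (B1 ++ E1).
  by rewrite -(dow_perm (crot_perm (proj2 (split4_filter sp1)))); apply: dow_filter.
have nBE p : p \in B1 ++ E1 -> ~~ X p.
  by rewrite mem_cat => /orP[/(allP XB1)|/(allP XE1)].
have dis l : all X l -> {in B1 ++ E1, forall p, p \notin l}.
  by move=> Xl p /nBE; apply: all_notin.
rewrite (wval_crot sx m ds1 cs1) (wval_rot sx m d1) -!catA.
rewrite (wval_rot sx m d2) -!catA.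
have [l Hl] := wval_subst sx m dBE.
have X1 : all X (ga1 ++ al1) by rewrite all_cat Xga1.
have X2 : all X (ga2 ++ al2) by rewrite all_cat Xga2.
rewrite (Hl y ga1 al1) ?(Hl y ga2 al2) ?(all_notin _ nXy) //; try exact: dis.
apply: eq_bigr => q _.
congr GRing.scale; congr GRing.mul; congr GRing.mul.
have dy1 : dow (y :: ga1 ++ y :: al1) by apply: dow_crot f1 (dow_filter _ ds1).
apply: IH => //.
  have [cX cnX] := split4_counts sp1.
  have := count_predC X s1; rewrite s1n cX; move: c3.
  by rewrite /= ?size_cat /= ?size_cat; clear; lia.
apply: same_gr_trans (same_gr_sym (same_gr_crot (dow_filter _ ds1) f1)) _.
apply: same_gr_trans (same_gr_filter _ g12) _.
exact: same_gr_crot (dow_filter _ ds2) f2.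
Qed.

(** [wval_half] is used for [s1], and for [s2] with inside and outside exchanged; both lead to the
    word with the inner share of [s2] and the outer share of [s1]. *)
Lemma wval_split n X s1 s2 al1 B1 ga1 E1 al2 B2 ga2 E2 y a m : invariant n ->
  dow s1 -> same_gr s1 s2 -> size s1 = n ->
  split4 X s1 al1 B1 ga1 E1 -> split4 X s2 al2 B2 ga2 E2 ->
  X a -> ~~ X y -> crs s1 y a -> 2 < count X s1 -> 2 < count (predC X) s1 ->
  wval x m s1 = wval x m s2.
Proof.
move=> IH ds1 g12 s1n sp1 sp2 Xa nXy cya c3 c3'; have [pe H] := g12.
have ds2 : dow s2 by rewrite -(dow_perm pe).
have nya : y != a by apply: contraNneq nXy => ->.
rewrite (wval_half m IH ds1 g12 s1n sp1 sp2 Xa nXy cya c3').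
rewrite (wval_half (X := predC X) (y := a) (a := y) m IH ds2 (same_gr_sym g12) _ (split4C sp2) (split4C sp1)) //.
- rewrite wval_rot //; first by rewrite -!catA.
  have [p1 _] := split4_filter sp1; have [p2 _] := split4_filter sp2.
  have [cs1 _ _ _ _] := sp1.
  have pag : perm_eq (al1 ++ ga1) (al2 ++ ga2).
    apply: perm_trans (crot_perm p2); rewrite perm_sym; apply: perm_trans (crot_perm p1).
    by rewrite perm_sym; apply: perm_filter.
  rewrite (@dow_perm _ _ (al1 ++ B1 ++ ga1 ++ E1)); first exact: dow_crot cs1 ds1.
  by apply/permP => P; have := permP pag P; rewrite !count_cat; clear; lia.
- by rewrite -(perm_size pe).
- by rewrite /= negbK.
- by rewrite crs_sym // 1?eq_sym // -H.
by rewrite (eq_count (a2 := X)) -?(permP pe) // => z; rewrite /= negbK.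
Qed.

End CommonSplit.

(** * Minimal splits and their transfer to another word *)

Section MinimalSplit.
Variable T : eqType.
Implicit Types (s t u A B E l : seq T) (a b c y z : T) (X P : pred T).

Definition is_split X s := [/\ 2 < count X s, 2 < count (predC X) s & cut X s <= 4].

Lemma min_split s : ~ prime_word s ->
  exists X, is_split X s /\ forall P, is_split P s -> count X s <= count P s.
Proof.
move=> np; have [X sX] : exists X, is_split X s.
  apply: NNPP => H; apply: np => X h1 h2; rewrite ltnNge; apply/negP => h3.
  by apply: H; exists X.
move En: (count X s) => n; elim/ltn_ind: n X sX En => n IH X sX En.
have [[P [sP lP]]|H] := classic (exists P, is_split P s /\ count P s < n).
  exact: IH lP _ sP erefl.
exists X; split=> // P sP; rewrite En leqNgt; apply/negP => lP.
by apply: H; exists P.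
Qed.

Lemma cut_collapse P u l y : u != [::] -> all (predC P) u -> ~~ P y ->
  cut P (u ++ l) = cut P (y :: l).
Proof.
case: u => // b u _ /= /andP[nb al] ny; rewrite /cut /= rcons_cat cutE_pw_cat.
have st c d l' : ~~ P c -> ~~ P d -> cutE (pw c (rcons l' d)) P = cutE (pw y (rcons l' y)) P.
  move=> nc nd; rewrite !pw_rcons -!cats1 !cutE_cat; congr (_ + _).
    by case: l' => //= e l'; rewrite /cutE /= (negbTE nc) (negbTE ny).
  case: l' => [|e l'] /=; first by rewrite /cutE /= (negbTE nc) (negbTE nd) (negbTE ny).
  by rewrite /cutE /= (negbTE nd) (negbTE ny).
have nl : ~~ P (last b u).
  by case: (lastP u) al => // u' z; rewrite all_rcons last_rcons => /andP[].
rewrite (st _ _ _ nl nb); suff -> : cutE (pw b u) P = 0 by [].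
elim: u b nb al {nl} => //= c u IH b nb /andP[nc al].
by rewrite /cutE /= (negbTE nb) (negbTE nc) /=; apply: IH.
Qed.

Lemma eq_in_cut P P' s : {in s, P =1 P'} -> cut P s = cut P' s.
Proof.
move=> E; apply: eq_in_count => e /VE_; rewrite !mem_undup => /andP[e1 e2].
by rewrite !E.
Qed.

(* A split of the word below is a split of [s] with fewer chords. *)
Lemma min_split_prime X s al B ga E y a : dow s -> split4 X s al B ga E ->
  ~~ X y -> X a -> crs s y a -> (forall P, is_split P s -> count X s <= count P s) ->
  prime_word (y :: ga ++ y :: al).
Proof.
move=> ds sp nXy Xa cya mX; have [cs Xal Xga XB XE] := sp.
have [cB cE _] := split4_with ds sp nXy Xa cya.
set t := y :: ga ++ y :: al.
suff main P : ~~ P y -> 2 < count P t -> 2 < count (predC P) t -> 4 < cut P t.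
  move=> P h1 h2; have [Py|nPy] := boolP (P y); last exact: main.
  rewrite -cutC; apply: main; rewrite /= ?negbK //.
  by rewrite (eq_count (a2 := P)) // => z; rewrite /= negbK.
move=> nPy h1 h2; rewrite ltnNge; apply/negP => h3.
pose P' := predI P X.
have cI l : all X l -> count P' l = count P l.
  move=> Xl; apply: eq_in_count => z zl; by rewrite /P' /= (allP Xl) // andbT.
have cI0 l : all (predC X) l -> count P' l = 0.
  move=> Xl; apply/eqP; rewrite -leqn0 leqNgt -has_count; apply/hasPn => z zl.
  by rewrite /P' /= (negbTE (allP Xl z zl)) andbF.
have cX : count X s = size al + size ga.
  by have [-> _] := split4_counts sp; rewrite size_cat.
have cP' : count P' s = count P al + count P ga.
  rewrite (permP (crot_perm cs)) !count_cat (cI al) // (cI ga) // (cI0 B) // (cI0 E) //.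
  by rewrite add0n addn0.
have pal := count_predC P al; have pga := count_predC P ga.
have hy1 : count P t = count P al + count P ga.
  by rewrite /t /= count_cat /= (negbTE nPy) add0n add0n addnC.
have hy2 : count (predC P) t = (count (predC P) al + count (predC P) ga).+2.
  rewrite /t /= count_cat /= nPy; clear; lia.
have nB : 0 < size B by case: (B) cB.
have nE : 0 < size E by case: (E) cE.
have ss := count_predC P' s.
have sz : size s = size al + size B + size ga + size E.
  by rewrite (perm_size (crot_perm cs)) !size_cat !addnA.
have : count X s <= count P' s.
  apply: mX; split.
  - by rewrite cP' -hy1.
  - move: h2 ss sz pal pga nB nE; rewrite hy2 cP'; clear; lia.
  apply: leq_trans h3; apply: eq_leq.
  have nP' u : all (predC X) u -> all (predC P') u.
    by apply: sub_all => z /= nz; rewrite negb_and nz orbT.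
  have nPy' : ~~ P' y by rewrite /P' /= (negbTE nPy).
  have c1 : crot s (B ++ (ga ++ E ++ al)).
    by apply: crot_trans cs _; have := crot_cat al (B ++ ga ++ E); rewrite -!catA.
  rewrite (cut_crot _ c1) (@cut_collapse _ _ _ y) ?nP' -?size_eq0 -?lt0n //.
  have c2 : crot (y :: ga ++ E ++ al) (E ++ (al ++ y :: ga)).
    by have := crot_cat (y :: ga) (E ++ al); rewrite /= -!catA.
  rewrite (cut_crot _ c2) (@cut_collapse _ _ _ y) ?nP' -?size_eq0 -?lt0n //.
  have c3 : crot (y :: al ++ y :: ga) t by apply: crot_half.
  rewrite (cut_crot _ c3); apply: eq_in_cut => z; rewrite /t inE mem_cat inE.
  have [->|nzy] /= := eqVneq z y; first by rewrite /P' /= (negbTE nPy).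
  move=> /orP[/(allP Xga)|/(allP Xal)] Xz; by rewrite /P' /= Xz andbT.
rewrite cX cP'; move: h2 pal pga; rewrite hy2; clear; lia.
Qed.

Definition connected s := forall P a b, a \in s -> b \in s -> P a -> ~~ P b ->
  exists c d, [/\ P c, ~~ P d & crs s c d].

(** * Recovering a split from its graph and a prime part *)

Section Arc.
Variables (X : pred T) (s : seq T) (y : T).
Hypotheses (ds : dow s) (con : connected s) (ny : ~~ X y).
Let t := filter (predU1 y X) s.
Hypotheses (pt : prime_word t) (t8 : 8 <= size t).
(** The rank-one condition of a split in terms of crossings alone, hence available in every word
    with the same graph. *)
Hypothesis (uni : forall z, ~~ X z ->
  (forall c, X c -> crs s z c = crs s y c) \/ (forall c, X c -> crs s z c = false)).
Let dt : dow t. Proof. exact: (dow_filter _ ds). Qed.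
Local Notation FX := (filter X).

Let evnFX l : (forall c, X c -> ~~ odd (count_mem c l)) -> evn (FX l).
Proof.
by move=> H c; rewrite count_filter1; case Xc: (X c); rewrite ?mul1n ?H // ?mul0n.
Qed.

Let crotFX A B : y \notin A -> y \notin B -> crot s (y :: A ++ y :: B) -> crot t (y :: FX A ++ y :: FX B).
Proof.
move=> yA yB cs; have := crot_filter (predU1 y X) cs.
have F l : y \notin l -> filter (predU1 y X) l = FX l.
  move=> yl; apply: eq_in_filter => z zl /=; suff /negbTE-> : z != y by [].
  by apply: contraNneq yl => <-.
rewrite -(F A) // -(F B) //; move=> h; apply: crot_trans h _.
by rewrite /= eqxx filter_cat /= eqxx; apply: crot_refl.
Qed.

Let ynX c : X c -> c != y. Proof. by move=> Xc; apply: contraNneq ny => <-. Qed.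

(** If [z] crosses [X] as [y] does, its ends are a possible place for [y] in [t]; otherwise they
    enclose a closed part of [t]. Primeness of [t] makes both trivial. *)
Lemma arc_same A B (l1 l2 l3 : seq T) z : ~~ X z -> crot s (y :: A ++ y :: B) ->
  y \notin A -> y \notin B -> A = l1 ++ z :: l2 ++ z :: l3 ->
  FX l2 = [::] \/ FX (l1 ++ l3) = [::].
Proof.
move=> nXz cs yA yB EA.
have cz : crot s (z :: l2 ++ z :: (l3 ++ y :: B ++ y :: l1)).
  apply: crot_trans cs _; rewrite EA.
  by have := crot_cat (y :: l1) (z :: l2 ++ z :: l3 ++ y :: B); rewrite /= -!catA /= -?catA /= -?catA.
have zc := dow_count z (dow_crot cz ds).
have [z2 z3] : z \notin l2 /\ z \notin l3 ++ y :: B ++ y :: l1.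
  by move: zc; rewrite /= eqxx count_cat /= eqxx => -[h|h]; split; apply/count_memPn; move: h; clear; lia.
have cA : crot t (y :: (FX l1 ++ FX l2 ++ FX l3) ++ y :: FX B).
  by have := crotFX yA yB cs; rewrite EA !filter_cat /= filter_cat /= (negbTE nXz).
have cz1 c : X c -> crs s z c = odd (count_mem c l2).
  by move=> Xc; rewrite (crs_arcs ds cz) //; apply: contraTneq Xc => ->.
have cy1 c : X c -> crs s y c = odd (count_mem c l1) (+) odd (count_mem c l2) (+) odd (count_mem c l3).
  move=> Xc; rewrite (crs_arcs ds cs) ?ynX // EA count_cat /= count_cat /=.
  have /negbTE-> : z != c by apply: contraNneq nXz => ->.
  by rewrite !add0n !oddD addbA.
case: (uni nXz) => H.
  right; rewrite filter_cat; apply: (place_same dt pt t8 cA); rewrite -filter_cat; apply: evnFX => c Xc.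
  have := H c Xc; rewrite cz1 // cy1 // count_cat oddD; by do 3!case: (odd _).
left; apply: (place_empty dt pt t8 cA); apply: evnFX => c Xc.
by rewrite -cz1 // H.
Qed.

Lemma arc_cross A B (l1 l2 k1 k2 : seq T) z : ~~ X z -> crot s (y :: A ++ y :: B) ->
  y \notin A -> y \notin B -> A = l1 ++ z :: l2 -> B = k1 ++ z :: k2 ->
  FX l1 = [::] \/ FX l2 = [::].
Proof.
move=> nXz cs yA yB EA EB.
have nyz : z != y.
  by apply: contraNneq yA => <-; rewrite EA mem_cat mem_head orbT.
have cz : crot s (z :: (l2 ++ y :: k1) ++ z :: (k2 ++ y :: l1)).
  apply: crot_trans cs _; rewrite EA EB.
  by have := crot_cat (y :: l1) (z :: l2 ++ y :: k1 ++ z :: k2); rewrite /= -!catA /= -?catA /= -?catA.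
have zc := dow_count z (dow_crot cz ds).
have [z2 z3] : z \notin l2 ++ y :: k1 /\ z \notin k2 ++ y :: l1.
  by move: zc; rewrite /= eqxx count_cat /= eqxx => -[h|h]; split; apply/count_memPn; move: h; clear; lia.
have cA : crot t (y :: (FX l1 ++ FX l2) ++ y :: (FX k1 ++ FX k2)).
  by have := crotFX yA yB cs; rewrite EA EB !filter_cat /= (negbTE nXz).
have cz1 c : X c -> crs s z c = odd (count_mem c l2) (+) odd (count_mem c k1).
  move=> Xc; rewrite (crs_arcs ds cz) //; last by apply: contraTneq Xc => ->.
  by rewrite count_cat /= eq_sym (negbTE (ynX Xc)) add0n oddD.
have cy1 c : X c -> crs s y c = odd (count_mem c l1) (+) odd (count_mem c l2).
  move=> Xc; rewrite (crs_arcs ds cs) ?ynX // EA count_cat /=.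
  have /negbTE-> : z != c by apply: contraNneq nXz => ->.
  by rewrite !add0n !oddD.
have get (P Q U V : seq T) : P ++ Q = [::] \/ U ++ V = [::] -> (P = [::] \/ U = [::]) /\ (Q = [::] \/ V = [::]).
  by case=> /cat_nil2[-> ->]; split; [left|left|right|right].
case: (uni nXz) => H.
  have ev : evn (FX l1 ++ FX k1).
    rewrite -filter_cat; apply: evnFX => c Xc; have := H c Xc; rewrite cz1 // cy1 // count_cat oddD.
    by do 3!case: (odd _).
  by have [] := get _ _ _ _ (place_cross dt pt t8 cA ev).
have ev : evn (FX l2 ++ FX k1).
  rewrite -filter_cat; apply: evnFX => c Xc; have := H c Xc; rewrite cz1 // count_cat oddD => ->.
  by [].
by have [[] h _] := get _ _ _ _ (place_empty_cross dt pt t8 cA ev); [right|left].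
Qed.

(** Were [X] to occupy two blocks of the arc, connectedness would give a chord [z] leaving the gap
    [r] between them. Wherever its other end lies, [z] separates [x1] from [x2], against [arc_same]
    or [arc_cross]. *)
Lemma arc_form A B : crot s (y :: A ++ y :: B) -> y \notin A -> y \notin B ->
  exists a1 a2 a3 : seq T, [/\ A = a1 ++ a2 ++ a3, all (predC X) a1, all X a2 & all (predC X) a3].
Proof.
move=> cs yA yB; case: (form X A) => // -[p [x1 [r [x2 [q [EA X1 X2 nr Xr]]]]]]; exfalso.
have has1 l c : c \in l -> X c -> FX l <> [::].
  by move=> cl Xc E; have : c \in FX l by [rewrite mem_filter Xc]; rewrite E.
have [ev|nev] := classic (evn r).
  have cr : crot s (r ++ (x2 :: q ++ y :: B ++ y :: p ++ [:: x1])).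
    apply: crot_trans cs _; rewrite EA.
    by have := crot_cat (y :: p ++ [:: x1]) (r ++ x2 :: q ++ y :: B); rewrite /= -!catA /= -?catA /= -?catA.
  have [dr _ dis] := dow_evn (dow_crot cr ds) ev.
  have [a ar] : exists a, a \in r by case: (r) nr => // a r' _; exists a; rewrite mem_head.
  have x1s : x1 \in s by rewrite (perm_mem (crot_perm cs)) EA !(inE, mem_cat) eqxx !orbT.
  have as_ : a \in s by rewrite (perm_mem (crot_perm cr)) mem_cat ar.
  have n1 : x1 \notin r by apply: all_predC_notin Xr X1.
  have [c [d [cR dR]]] := @con (mem r) a x1 as_ x1s ar n1.
  rewrite (crs_crot _ _ ds cr) /crs inv_cat inv_notinr // inv_notinl; last exact: dis.
  by rewrite (dowP _ dr _ cR) oddD oddM.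
have [z oz] : exists z, odd (count_mem z r).
  by apply: NNPP => H; apply: nev => c; apply/negP => oc; apply: H; exists c.
have zr : z \in r by rewrite -has_pred1 has_count; case: (count_mem z r) oz.
have nXz : ~~ X z := allP Xr z zr.
have nzy : z != y by apply: contraNneq yA => <-; rewrite EA !(inE, mem_cat) zr !orbT.
have zc := dow_count z ds; rewrite (permP (crot_perm cs)) /= EA in zc.
have n1 : x1 != z by apply: contraNneq nXz => <-.
have n2 : x2 != z by apply: contraNneq nXz => <-.
rewrite !count_cat /= !count_cat /= (negbTE n1) (negbTE n2) ?count_cat /= eq_sym (negbTE nzy) in zc.
case/splitPr: zr EA cs oz zc nr Xr => r1 r2 EA cs oz zc _ _.
have : [\/ z \in p, z \in q | z \in B].
  rewrite -!has_pred1 !has_count; move: oz zc.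
  case: (count_mem z p) => [|?]; last by constructor 1.
  case: (count_mem z q) => [|?]; last by constructor 2.
  case: (count_mem z B) => [|?]; last by constructor 3.
  by case: (count_mem z (r1 ++ z :: r2)) => [|[|[|n]]] // _; clear; lia.
have X1' l l' : FX (l ++ x1 :: l') <> [::] by apply: (has1 _ x1); rewrite // mem_cat mem_head orbT.
have X2' l l' : FX (l ++ x2 :: l') <> [::] by apply: (has1 _ x2); rewrite // mem_cat mem_head orbT.
case=> zin.
- case/splitPr: zin EA => p1 p2 EA.
  have E2 : A = p1 ++ z :: (p2 ++ x1 :: r1) ++ z :: (r2 ++ x2 :: q).
    by rewrite EA -?catA /= -?catA /= -?catA.
  have [|] := arc_same nXz cs yA yB E2; first exact: X1'.
  by rewrite catA; apply: X2'.
- case/splitPr: zin EA => q1 q2 EA.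
  have E2 : A = (p ++ x1 :: r1) ++ z :: (r2 ++ x2 :: q1) ++ z :: q2.
    by rewrite EA -?catA /= -?catA /= -?catA.
  have [|] := arc_same nXz cs yA yB E2; first exact: X2'.
  by rewrite -catA; apply: X1'.
have [k1 [k2 EB]] : exists k1 k2, B = k1 ++ z :: k2.
  by case/splitPr: zin => k1 k2; exists k1, k2.
have E2 : A = (p ++ x1 :: r1) ++ z :: (r2 ++ x2 :: q) by rewrite EA -?catA /= -?catA.
have [|] := arc_cross nXz cs yA yB E2 EB; [exact: X1'|exact: X2'].
Qed.

Lemma arcs_split : y \in s -> exists al B ga E, split4 X s al B ga E.
Proof.
move=> ys; have [A [B [cs yA yB]]] := dow_arcs ds ys.
have [a1 [a2 [a3 [EA h1 h2 h3]]]] := arc_form cs yA yB.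
have [b1 [b2 [b3 [EB k1 k2 k3]]]] := arc_form (crot_trans cs (crot_half _ _ _)) yB yA.
exists a2, (a3 ++ y :: b1), b2, (b3 ++ y :: a1); split=> //; rewrite ?all_cat /= ?ny ?h1 ?h3 ?k1 ?k3 //.
apply: crot_trans cs _; rewrite EA EB.
by have := crot_cat (y :: a1) (a2 ++ a3 ++ y :: b1 ++ b2 ++ b3); rewrite /= -!catA /= -?catA /= -?catA.
Qed.

End Arc.
End MinimalSplit.

(** * The induction on the number of chords *)

Section GraphDeterminesValue.
Variables (C : numClosedFieldType) (R : algType C) (x : 'I_3 -> R).
Hypothesis sx : sl2_triple x.
Variable T : eqType.
Implicit Types (m : T -> nat) (s t u A B E : seq T) (a b c d y z : T) (X P : pred T).

(** Without one chord at most two are left, and then the graph determines the cyclic word;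
    [wval_move] puts the chord back. *)
Lemma wval_small m s t : dow s -> same_gr s t -> size s <= 6 -> wval x m s = wval x m t.
Proof.
move=> ds g s6; case: s ds g s6 => [|v s0] ds g s6.
  by have := perm_size (proj1 g); case: t g.
apply: (wval_move sx m (v := v)) => //; apply: small_crot; first exact: dow_filter.
  move: s6; rewrite -(count_predC (pred1 v)) (dowP _ ds v (mem_head _ _)).
  by rewrite size_filter -[count (predC _) _]/(count (predC1 v) (v :: s0)); clear; lia.
exact: same_gr_filter.
Qed.

Lemma wval_disconnected m s t : invariant x T (size s) -> dow s -> same_gr s t -> ~ connected s ->
  wval x m s = wval x m t.
Proof.
move=> IH ds g nc; have [pe H] := g; have dt : dow t by rewrite -(dow_perm pe).
have [X [a [b [as_ bs Xa nXb dX]]]] : exists X a b,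
    [/\ a \in s, b \in s, X a, ~~ X b & disc X s].
  apply: NNPP => K; apply: nc => X a b as_ bs Xa nXb; apply: NNPP => K2; apply: K.
  exists X, a, b; split=> // c d Xc nXd; apply/negP => cd; apply: K2; by exists c, d.
have dXt : disc X t.
  by move=> c d Xc nXd; rewrite -H ?dX //; apply: contraNneq nXd => <-.
rewrite (wval_disc sx m ds dX) (wval_disc sx m dt dXt).
have sz := count_predC X s.
congr GRing.mul; apply: IH; try exact: dow_filter; try exact: same_gr_filter.
  rewrite size_filter -sz -[X in X < _]addn0 ltn_add2l -has_count.
  by apply/hasP; exists b.
rewrite size_filter -sz -[X in X < _]add0n ltn_add2r -has_count.
by apply/hasP; exists a.
Qed.

Lemma connected_cross s X a b : dow s -> connected s -> a \in s -> b \in s -> X a -> ~~ X b ->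
  exists y c, [/\ ~~ X y, X c & crs s y c].
Proof.
move=> ds con as_ bs Xa nXb; have [c [y [Xc ny cy]]] := con X a b as_ bs Xa nXb.
by exists y, c; split=> //; rewrite crs_sym //; apply: contraNneq ny => ->.
Qed.

Lemma wval_twin m s t a b : invariant x T (size s) -> dow s -> same_gr s t -> connected s ->
  8 <= size s -> a \in s -> b \in s -> a != b -> twin s a b -> wval x m s = wval x m t.
Proof.
move=> IH ds g con s8 as_ bs nab tw; have [pe H] := g.
have dt : dow t by rewrite -(dow_perm pe).
have [s' [al1 [B1 [ga1 [E1 [gs cs sp1]]]]]] := twin_split ds as_ bs nab tw.
have [t' [al2 [B2 [ga2 [E2 [gt ct sp2]]]]]] :
    exists t' al B ga E, [/\ same_gr t t', crot (filter (predC1 b) t) (filter (predC1 b) t')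
    & split4 (pred2 a b) t' al B ga E].
  by apply: twin_split; rewrite -?(perm_mem pe) //; apply: same_gr_twin g tw.
rewrite (wval_move sx m ds gs cs) (wval_move sx m dt gt ct).
have g' : same_gr s' t' := same_gr_trans (same_gr_sym gs) (same_gr_trans g gt).
have [pes Hs] := gs.
have ds' : dow s' by rewrite -(dow_perm pes).
have c4 : count (pred2 a b) s = 4.
  have -> : count (pred2 a b) s = count_mem a s + count_mem b s.
    elim: (s) => //= z l ->; have [->|] := eqVneq z a; first by rewrite (negbTE nab); clear; lia.
    by move=> _ /=; clear; lia.
  by rewrite !(dowP _ ds).
have c4' : 2 < count (predC (pred2 a b)) s.
  by move: s8; rewrite -(count_predC (pred2 a b) s) c4; clear; lia.
have [w ws nw] : exists2 w, w \in s & predC (pred2 a b) w.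
  by apply/hasP; rewrite has_count; apply: leq_trans c4'.
have Xa : pred2 a b a by rewrite /= eqxx.
have [y [c [ny Xc cyc]]] := connected_cross ds con as_ ws Xa nw.
apply: (wval_split sx m IH ds' g' _ sp1 sp2 Xc ny); rewrite -?(permP pes) ?c4 //.
  by rewrite -(perm_size pes).
by rewrite -Hs //; apply: contraNneq ny => ->.
Qed.

Lemma wval_min_split m s t : invariant x T (size s) -> dow s -> same_gr s t -> connected s ->
  (forall a b, a \in s -> b \in s -> a != b -> ~ twin s a b) -> ~ prime_word s ->
  wval x m s = wval x m t.
Proof.
move=> IH ds g con ntw np; have [pe H] := g.
have dt : dow t by rewrite -(dow_perm pe).
have [X [[h1 h2 h3] mX]] := min_split np.
have [[a as_ Xa] [b bs nXb]] : (exists2 a, a \in s & X a) /\ exists2 b, b \in s & predC X b.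
  by split; apply/hasP; rewrite has_count; [apply: leq_trans h1|apply: leq_trans h2].
have [al [B [ga [E sp]]]] := split4_of_cut as_ bs Xa nXb h3.
have [y [c [ny Xc cyc]]] := connected_cross ds con as_ bs Xa nXb.
(* An inner part of two chords would be a pair excluded by [ntw]. So there are at least three, four
   together with [y], which is the length that [prime_size] asks for. *)
have X6 : 6 <= count X s.
  have := count_undup X ds; have := size_filter X (undup s).
  case E0: (filter X (undup s)) => [|p [|q [|r l]]] /= <- cE; rewrite cE //; last by clear; lia.
  - by rewrite cE in h1.
  - by rewrite cE in h1.
  have : uniq (filter X (undup s)) by rewrite filter_uniq ?undup_uniq.
  rewrite E0 /= inE andbT => npq.
  have mem z : (z \in s) && X z = (z == p) || (z == q).
    by rewrite andbC -(mem_undup s) -mem_filter E0 !inE.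
  have /andP[ps Xp] : (p \in s) && X p by rewrite mem eqxx.
  have /andP[qs Xq] : (q \in s) && X q by rewrite mem eqxx orbT.
  have sp2 : split4 (pred2 p q) s al B ga E.
    have [cs Xal Xga XB XE] := sp.
    have sub l : {subset l <= s} -> {in l, pred2 p q =1 X}.
      by move=> ls z /ls zs; have := mem z; rewrite zs /= => ->.
    have S l : {subset l <= al ++ B ++ ga ++ E} -> {in l, pred2 p q =1 X}.
      by move=> ls; apply: sub => z /ls; rewrite -(perm_mem (crot_perm cs)).
    split=> //.
    - by rewrite (@eq_in_all _ _ X) //; apply: S => z; rewrite !mem_cat => ->.
    - by rewrite (@eq_in_all _ _ X) //; apply: S => z; rewrite !mem_cat => ->; rewrite !orbT.
    - have SB : {in B, pred2 p q =1 X} by apply: S => w; rewrite !mem_cat => ->; rewrite orbT.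
      by apply/allP => z zB; rewrite -[predC _ z]/(~~ pred2 p q z) SB //; apply: (allP XB).
    - have SE : {in E, pred2 p q =1 X} by apply: S => w; rewrite !mem_cat => ->; rewrite !orbT.
      by apply/allP => z zE; rewrite -[predC _ z]/(~~ pred2 p q z) SE //; apply: (allP XE).
  case: (twin_of_split ds npq sp2) => tw; first by case: (ntw p q).
  by case: (ntw q p) => //; rewrite eq_sym.
have pt := min_split_prime ds sp ny Xc cyc mX.
have [_ _ ft] := split4_with ds sp ny Xc cyc.
set u := y :: ga ++ y :: al in pt ft.
have du : dow u := dow_crot ft (dow_filter _ ds).
have u8 : 8 <= size u.
  have [cX _] := split4_counts sp; move: X6; rewrite cX /u /= !size_cat /=; clear; lia.
have u10 := prime_size du pt u8.
have rig := prime_rigid du pt u10.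
have g2 : same_gr u (filter (predU1 y X) t).
  apply: same_gr_trans (same_gr_filter _ g).
  exact: same_gr_sym (same_gr_crot (dow_filter _ ds) ft).
(* Rigidity makes the part of [t] on [X] and [y] prime, although nothing is known yet about the cut
   of [X] in [t]. *)
have dih2 := rig _ g2.
have pt2 := prime_dih dih2 pt.
have t8 : 8 <= size (filter (predU1 y X) t) by rewrite -(perm_size (dih_perm dih2)).
have cont : connected t.
  move=> P p q pt' qt Pp nPq; have [||d [e [Pd nPe cde]]] := con P p q _ _ Pp nPq.
  - by rewrite (perm_mem pe).
  - by rewrite (perm_mem pe).
  exists d, e; split=> //; rewrite -H //; by apply: contraNneq nPe => <-.
have uni z : ~~ X z ->
    (forall c, X c -> crs t z c = crs t y c) \/ (forall c, X c -> crs t z c = false).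
  move=> nz; have cH w d : ~~ X w -> X d -> crs t w d = odd (count_mem w B) && odd (count_mem d ga).
    move=> nw Xd; rewrite -H; last by apply: contraNneq nw => ->.
    exact: crs_split ds sp nw Xd.
  case oz: (odd (count_mem z B)); [left|right] => d Xd; rewrite !cH ?oz //.
  by have [-> _ _] := split4_with ds sp ny Xc cyc.
have yt : y \in t.
  have [cB _ _] := split4_with ds sp ny Xc cyc; have [cs _ _ _ _] := sp.
  by rewrite -(perm_mem pe) (perm_mem (crot_perm cs)) !mem_cat -(has_pred1 y B) has_count cB orbT.
have [al2 [B2 [ga2 [E2 sp2]]]] := arcs_split dt cont ny pt2 t8 uni yt.
exact: (wval_split sx m IH ds g erefl sp sp2 Xc ny cyc).
Qed.

Theorem same_gr_wval s t m : dow s -> same_gr s t -> wval x m s = wval x m t.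
Proof.
suff V n : invariant x T n by apply: (V (size s).+1).
elim: n => [//|n IH] {m}s {}t m; rewrite ltnS leq_eqVlt => /orP[/eqP sn|]; last exact: IH.
rewrite -sn in IH => ds g.
have [s6|s6] := leqP (size s) 6; first exact: wval_small.
have s8 : 8 <= size s.
  by have := dow_even ds; move: s6; case: (size s) => [|[|[|[|[|[|[|[|k]]]]]]]].
have [con|ncon] := classic (connected s); last exact: wval_disconnected.
have [[a [b [as_ bs nab tw]]]|ntw] :=
  classic (exists a b, [/\ a \in s, b \in s, a != b & twin s a b]).
  exact: wval_twin tw.
have [ps|np] := classic (prime_word s).
  by apply: wval_dih => //; apply: prime_rigid => //; apply: prime_size.
apply: wval_min_split => // a b as_ bs nab tw; apply: ntw; by exists a, b.
Qed.

End GraphDeterminesValue.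

(** * Shares *)

Lemma count1_split (T : eqType) (s : seq T) v : count_mem v s = 1 ->
  exists P Q : seq T, [/\ s = P ++ v :: Q, v \notin P & v \notin Q].
Proof.
move=> c1; have vs : v \in s by rewrite -has_pred1 has_count c1.
case/splitPr: vs c1 => P Q; rewrite count_cat /= eqxx => c1.
by exists P, Q; split=> //; apply/count_memPn; lia.
Qed.

Lemma count2_split (T : eqType) (s : seq T) v : count_mem v s = 2 ->
  exists P M Q : seq T, [/\ s = P ++ v :: M ++ v :: Q, v \notin P, v \notin M & v \notin Q].
Proof.
move=> c2; have vs : v \in s by rewrite -has_pred1 has_count c2.
case: (path.splitP vs) c2 => P R; rewrite cat_rcons count_cat /= eqxx => c2.
have [vP|vP] := boolP (v \in P).
  case/splitPr: vP c2 => A Q; rewrite count_cat /= eqxx -catA /= => c2.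
  by exists A, Q, R; split=> //; apply/count_memPn; lia.
have /count1_split[M [Q [-> vM vQ]]] : count_mem v R = 1 by rewrite (count_memPn vP) in c2; lia.
by exists P, M, Q.
Qed.

(** * Adjacency in a share as parity of crossings *)

Section Positions.
Variable I : share.
Local Notation n := (nch I).
Implicit Types (P Q s : seq 'I_n) (u v : 'I_n).

Lemma index_split P Q u v : u != v ->
  (index u (P ++ v :: Q) < size P) = (u \in P) /\ (size P < index u (P ++ v :: Q)) = (u \notin P).
Proof.
move=> nuv; rewrite index_cat /=; case: ifP => uP; first by rewrite index_mem uP ltnNge ltnW ?index_mem.
by rewrite eq_sym (negbTE nuv) addnS ltnNge leqW ?leq_addr // ltnS leq_addr.
Qed.

Lemma lstpos_split P Q u v : u != v -> u \in P ++ Q ->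
  (size P < lstpos (P ++ v :: Q) u) = (u \in Q) /\ (lstpos (P ++ v :: Q) u < size P) = (u \notin Q).
Proof.
move=> nuv; rewrite mem_cat => uPQ; rewrite /lstpos rev_cat rev_cons cat_rcons size_cat /=.
rewrite index_cat mem_rev size_rev /=; case: ifP => uQ.
  have : index u (rev Q) < size Q by rewrite -size_rev index_mem mem_rev.
  by clear; move=> H; split; lia.
have uP : u \in P by rewrite uQ orbF in uPQ.
have : 0 < size P by case: (P) uP.
by rewrite eq_sym (negbTE nuv); clear; move=> H; split; lia.
Qed.

Lemma fstposE P Q v : v \notin P -> fstpos (P ++ v :: Q) v = size P.
Proof. by move=> vP; rewrite /fstpos index_cat (negbTE vP) /= eqxx addn0. Qed.

Lemma lstposE P Q v : v \notin Q -> lstpos (P ++ v :: Q) v = size P.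
Proof.
move=> vQ; rewrite /lstpos rev_cat rev_cons cat_rcons index_cat mem_rev (negbTE vQ) /= eqxx.
by rewrite size_rev size_cat /= addn0 addnS addnK.
Qed.

Lemma inv_split P Q u v : u != v -> v \notin P -> v \notin Q ->
  inv u v (P ++ v :: Q) = count_mem u P.
Proof.
move=> nuv vP vQ; rewrite inv_cat /= !inv_notinr // eq_sym (negbTE nuv) eqxx (count_memPn vQ).
by rewrite mul0n !add0n muln1.
Qed.

Lemma inv_index s u v : u != v -> count_mem u s = 1 -> count_mem v s = 1 ->
  inv u v s = (index u s < index v s).
Proof.
move=> nuv cu /count1_split[P [Q [E vP vQ]]]; rewrite E in cu *.
rewrite inv_split //; have [h _] := index_split P Q nuv.
have -> : index v (P ++ v :: Q) = size P := fstposE Q vP.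
rewrite h -has_pred1 has_count; move: cu; rewrite count_cat.
by case: (count_mem u P) => [|[|k]]; clear; lia.
Qed.

Lemma inv_between s u v : u != v -> count_mem u s = 2 -> count_mem v s = 1 ->
  odd (inv u v s) = (fstpos s u < index v s) && (index v s < lstpos s u).
Proof.
move=> nuv cu /count1_split[P [Q [E vP vQ]]]; rewrite E in cu *.
have -> : index v (P ++ v :: Q) = size P := fstposE Q vP.
have cPQ : count_mem u P + count_mem u Q = 2.
  by move: cu; rewrite count_cat /= eq_sym (negbTE nuv).
have uPQ : u \in P ++ Q by rewrite -has_pred1 has_count count_cat cPQ.
have [h1 _] := index_split P Q nuv; have [h2 _] := lstpos_split nuv uPQ.
rewrite inv_split // h1 h2 -!has_pred1 !has_count; move: cPQ.
by case: (count_mem u P) => [|[|[|k]]]; case: (count_mem u Q) => [|[|[|j]]].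
Qed.

Lemma inv_alternate s u v : u != v -> count_mem u s = 2 -> count_mem v s = 2 ->
  let a1 := fstpos s u in let a2 := lstpos s u in
  let b1 := fstpos s v in let b2 := lstpos s v in
  odd (inv u v s) =
  ((a1 < b1) && (b1 < a2) && (a2 < b2)) || ((b1 < a1) && (a1 < b2) && (b2 < a2)).
Proof.
move=> nuv cu /count2_split[P [M [Q [E vP vM vQ]]]].
have E2 : s = (P ++ v :: M) ++ v :: Q by rewrite E -catA.
have b1 : fstpos s v = size P by rewrite E fstposE.
have b2 : lstpos s v = size (P ++ v :: M) by rewrite E2 lstposE.
have nvu : v != u by rewrite eq_sym.
have c2 : count_mem u P + count_mem u M + count_mem u Q = 2.
  by move: cu; rewrite E count_cat /= count_cat /= (negbTE nvu) !addnA !addn0.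
have m0 : [|| u \in P, u \in M | u \in Q].
  rewrite -!has_pred1 !has_count; move: c2; case: (count_mem u P) => [|k] //=.
  by case: (count_mem u M) => [|k] //=; rewrite !add0n => ->.
have m1 : u \in P ++ (M ++ v :: Q).
  by rewrite !mem_cat inE; case/or3P: m0 => ->; rewrite ?orbT.
have m2 : u \in (P ++ v :: M) ++ Q.
  by rewrite !mem_cat inE; case/or3P: m0 => ->; rewrite ?orbT.
have [x1 x2] := index_split P (M ++ v :: Q) nuv; have [y1 y2] := lstpos_split nuv m1.
have [z1 z2] := index_split (P ++ v :: M) Q nuv; have [w1 w2] := lstpos_split nuv m2.
rewrite -E in x1 x2 y1 y2; rewrite -E2 in z1 z2 w1 w2.
rewrite /= b1 b2 /fstpos x1 x2 y1 z1 w1 w2.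
rewrite E inv_cat /= (negbTE nvu) inv_split // inv_notinr // eqxx count_cat /= eqxx.
rewrite (count_memPn vM) (count_memPn vQ) !mem_cat !inE (negbTE nuv) /=.
rewrite -!has_pred1 !has_count; move: c2.
by case: (count_mem u P) => [|[|[|k]]]; case: (count_mem u M) => [|[|[|i]]];
  case: (count_mem u Q) => [|[|[|j]]].
Qed.

End Positions.

Section ShareGraph.
Variable I : share.
Implicit Types (u v : 'I_(nch I)).

Lemma share_count u : count_mem u (st1 I) + count_mem u (st2 I) = 2.
Proof. by rewrite -count_cat; have /forallP/(_ u)/eqP := share_ok I. Qed.

Lemma share_dow : dow (st1 I ++ st2 I).
Proof. by apply/dowP => u _; rewrite count_cat share_count. Qed.

Lemma arch_counts u : is_arch I u -> (count_mem u (st1 I) = 2 /\ count_mem u (st2 I) = 0) \/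
  (count_mem u (st1 I) = 0 /\ count_mem u (st2 I) = 2).
Proof.
rewrite /is_arch; have := share_count u.
by case: (count_mem u (st1 I)) => [|[|[|k]]] //= [E] _; [right|left].
Qed.

Lemma bridge_counts u : ~~ is_arch I u -> count_mem u (st1 I) = 1 /\ count_mem u (st2 I) = 1.
Proof.
by rewrite /is_arch negbK => /eqP E; have := share_count u; rewrite E => -[].
Qed.

Lemma crs_arch_bridge u v : u != v -> is_arch I u -> ~~ is_arch I v ->
  crs (st1 I ++ st2 I) u v = arch_bridge_adj u v.
Proof.
move=> nuv /arch_counts au /bridge_counts[v1 v2].
rewrite /crs inv_cat !oddD oddM /arch_bridge_adj /arch_strand /arch_on1.
case: au => -[u1 u2]; rewrite u1 /= addbF.
  have n2 : u \notin st2 I by apply/count_memPn.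
  by rewrite (inv_notinl v n2) addbF; apply: inv_between.
have n1 : u \notin st1 I by apply/count_memPn.
by rewrite (inv_notinl v n1) addFb; apply: inv_between.
Qed.

(** Once the strands are joined to one circle, bridges whose ends come in the same order on both
    strands do cross; hence the negation for two bridges. *)
Lemma crs_adj u v : u != v ->
  crs (st1 I ++ st2 I) u v = if is_arch I u || is_arch I v then adj I u v else ~~ adj I u v.
Proof.
move=> nuv; rewrite /adj nuv /=.
have [au|bu] := boolP (is_arch I u); have [av|bv] := boolP (is_arch I v) => /=.
- have nin w (t : seq 'I_(nch I)) : count_mem w t = 0 -> w \notin t by move/count_memPn.
  rewrite /crs inv_cat !oddD oddM /arch_arch_adj /arch_strand /arch_on1.
  case: (arch_counts au) (arch_counts av) => -[u1 u2] [] [v1 v2]; rewrite u1 v1 /= ?addbF.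
  + by rewrite (inv_notinl v (nin _ _ u2)) addbF inv_alternate.
  + by rewrite (inv_notinl v (nin _ _ u2)) (inv_notinr u (nin _ _ v1)).
  + by rewrite (inv_notinl v (nin _ _ u1)) (inv_notinr u (nin _ _ v2)).
  + by rewrite (inv_notinl v (nin _ _ u1)) addFb inv_alternate.
- exact: crs_arch_bridge.
- by rewrite crs_sym ?share_dow // crs_arch_bridge // eq_sym.
have [u1 u2] := bridge_counts bu; have [v1 v2] := bridge_counts bv.
rewrite /crs inv_cat u1 v2 !inv_index // !oddD /bridge_bridge_adj.
by do 2!case: (_ < _).
Qed.

End ShareGraph.

(** * The share closed by a separating chord *)

Section ClosedShare.

Lemma dow_map (T T' : eqType) (g : T -> T') (s : seq T) : injective g -> dow s -> dow (map g s).
Proof.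
move=> gi ds; apply/dowP => _ /mapP[p ps ->]; rewrite count_map -[RHS](dowP _ ds _ ps).
by apply: eq_count => q; apply: inj_eq.
Qed.

Lemma crs_map (T T' : eqType) (g : T -> T') (s : seq T) a b :
  injective g -> crs (map g s) (g a) (g b) = crs s a b.
Proof. by move=> gi; rewrite /crs inv_map // => ? ? _ _; apply: gi. Qed.

Lemma same_gr_map (T T' : eqType) (g : T -> T') (s t : seq T) :
  injective g -> same_gr s t -> same_gr (map g s) (map g t).
Proof.
move=> gi [pe H]; split=> [|a b nab]; first exact: perm_map.
have out c : c \notin map g s -> c \notin map g t by rewrite (perm_mem (perm_map g pe)).
have [/mapP[a0 _ Ea]|na] := boolP (a \in map g s); last by rewrite /crs !inv_notinl ?out.
have [/mapP[b0 _ Eb]|nb] := boolP (b \in map g s); last by rewrite /crs !inv_notinr ?out.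
rewrite Ea Eb !crs_map // H //; by apply: contraNneq nab => E; rewrite Ea Eb E.
Qed.

(* The share [I] closed up by one extra chord [None] separating its two strands. *)
Definition closure_word (I : share) : seq (option 'I_(nch I)) :=
  None :: map Some (st2 I) ++ None :: map Some (st1 I).

(** Expressed by [is_arch] and [adj] alone, so that graph isomorphisms preserve it by definition. *)
Definition closure_crs (I : share) (a b : option 'I_(nch I)) : bool :=
  match a, b with
  | Some u, Some v => if is_arch I u || is_arch I v then adj I u v else ~~ adj I u v
  | Some u, None | None, Some u => ~~ is_arch I u
  | None, None => false
  end.

Variable I : share.

Lemma closure_dow : dow (closure_word I).
Proof.
have Si : injective (@Some 'I_(nch I)) by move=> ? ? [].
have nN s : None \notin map (@Some 'I_(nch I)) s by apply/mapP => -[].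
apply/dowP => -[u|] _; rewrite /closure_word /= count_cat /=; last first.
  by rewrite !(count_memPn (nN _)).
have c s : count_mem (Some u) (map Some s) = count_mem u s.
  by rewrite count_map; apply: eq_count => v; apply: inj_eq.
by rewrite !c !add0n addnC share_count.
Qed.

Lemma mem_closure a : a \in closure_word I.
Proof.
case: a => [u|]; last exact: mem_head.
rewrite inE mem_cat inE /= !mem_map; try exact: Some_inj.
by rewrite orbC -mem_cat -has_pred1 has_count count_cat share_count.
Qed.

Lemma closure_crsE a b : a != b -> crs (closure_word I) a b = closure_crs a b.
Proof.
have Si : injective (@Some 'I_(nch I)) by move=> ? ? [].
have nN s : None \notin map (@Some 'I_(nch I)) s by apply/mapP => -[].
have N u : crs (closure_word I) None (Some u) = ~~ is_arch I u.
  rewrite crs_arc ?nN ?closure_dow // count_map.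
  rewrite (eq_count (a2 := pred1 u)) => [|v]; last exact: inj_eq.
  have [/arch_counts[[_ ->]|[_ ->]]|/bridge_counts[_ ->]] //= := boolP (is_arch I u).
case: a b => [u|] [v|] nab; [|by rewrite crs_sym ?closure_dow ?N|exact: N|by rewrite eqxx in nab].
have nuv : u != v by apply: contraNneq nab => ->.
rewrite -(crs_filter (P := predC1 None)) //= -crs_adj // -(crs_map _ _ _ Si).
  have F s : filter (predC1 None) (map (@Some 'I_(nch I)) s) = map Some s.
    by apply/all_filterP/allP => _ /mapP[w _ ->].
  by rewrite filter_cat /= !F crs_catC -?map_cat //; apply: dow_map => //; rewrite dow_catC share_dow.
Qed.

End ClosedShare.

Lemma same_gr_closure (I1 I2 : share) (f : 'I_(nch I1) -> 'I_(nch I2)) :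
  graph_iso f -> same_gr (map (omap f) (closure_word I1)) (closure_word I2).
Proof.
case=> -[g fK gK] ha had.
have Fi : injective (omap f) by apply: (can_inj (g := omap g)) => -[u|] //=; rewrite fK.
have sur a : exists b, a = omap f b by exists (omap g a); case: a => //= u; rewrite gK.
have dm := dow_map Fi (closure_dow I1).
split=> [|a b].
  apply/allP => a _; apply/eqP; have [b ->] := sur a.
  by rewrite (dowP _ dm) ?map_f ?mem_closure // (dowP _ (closure_dow I2)) // mem_closure.
have [a' ->] := sur a; have [b' ->] := sur b => nab.
rewrite crs_map // !closure_crsE //; last by apply: contraNneq nab => ->.
by case: a' b' {nab} => [u|] [v|] //=; rewrite !ha ?had.
Qed.

(** * The weight system as the value of a word *)

Section WeightAsValue.
Variables (C : numClosedFieldType) (A : algType C) (x : 'I_3 -> A).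
Local Open Scope ring_scope.

Lemma nsum_ffun (T : finType) (L : seq T) (F : (T -> 'I_3) -> A) f0 : uniq L ->
  nsum L F f0 =
  \sum_(phi : {ffun T -> 'I_3} | [forall p, (p \notin L) ==> (phi p == f0 p)]) F phi.
Proof.
elim: L f0 => [|p L IH] f0 /= => [_|/andP[pL uL]].
  rewrite (big_pred1 (finfun f0)) => [|phi].
    by congr F; apply: functional_extensionality => p; rewrite ffunE.
  apply/forallP/eqP => [H|-> p]; last by rewrite ffunE eqxx.
  by apply/ffunP => p; rewrite ffunE; apply/eqP/H.
rewrite (partition_big (fun phi : {ffun T -> 'I_3} => phi p) predT) //=.
apply: eq_bigr => a _; rewrite IH //; apply: eq_bigl => phi.
apply/forallP/andP => [H|[/forallP H /eqP Ep] q].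
  split; last by have := H p; rewrite pL upd_eq.
  apply/forallP => q; have := H q; rewrite inE negb_or.
  by have [//|nqp] := eqVneq q p; rewrite upd_neq.
have := H q; rewrite inE negb_or; have [->|nqp] := eqVneq q p; first by rewrite upd_eq Ep eqxx implybT.
by rewrite upd_neq.
Qed.

Lemma wsl2_W n (s : seq 'I_n) : (forall p, p \in s) -> wsl2 x s = W x s.
Proof.
move=> sin; rewrite /W nsum_ffun ?undup_uniq //; apply: eq_bigl => phi.
by apply/esym/forallP => p; rewrite mem_undup sin.
Qed.

Lemma W_map (T T' : eqType) (g : T -> T') (s : seq T) : injective g -> W x (map g s) = W x s.
Proof.
have WE (U : eqType) (t : seq U) : W x t = shop t [::] x 1.
  rewrite -(shop_nsum _ _ _ _ (fun=> ord0)) cats0; apply: eq_nsum => f.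
  by rewrite /xp big_nil !mulr1.
by move=> gi; rewrite !WE; apply: (@shop_map C A x T T' g s [::]) => ? ? _ _; apply: gi.
Qed.

Lemma wval1 (T : eqType) (s : seq T) : wval x (fun=> 1%N) s = W x s.
Proof.
rewrite /wval -(W_map (g := fun p => (p, 0%N)) s) => [|? ? []] //.
by congr W; rewrite /expand; elim: s => //= p s ->.
Qed.

End WeightAsValue.

(** Renaming the chords of [I] by [f] puts the joins of two isomorphic shares over one alphabet; the
    letter [None] stays free for the chord that will replace [H]. *)
Lemma wsl2_join (I H : share) (K : finType) (f : 'I_(nch I) -> K) (C : numClosedFieldType)
    (A : algType C) (x : 'I_3 -> A) : injective f ->
  let inI c : option (K + 'I_(nch H)) := Some (inl (f c)) in
  let inH c : option (K + 'I_(nch H)) := Some (inr c) in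
  wsl2 x (join I H) = wval x (fun=> 1)
    (map inI (st1 I) ++ map inH (st1 H) ++ map inI (st2 I) ++ map inH (st2 H)) /\
  dow (map inI (st1 I) ++ map inH (st1 H) ++ map inI (st2 I) ++ map inH (st2 H)).
Proof.
move=> fi inI inH.
pose g (k : 'I_(nch I + nch H)) :=
  match split k with inl c => inI c | inr c => inH c end.
have gl c : g (lshift _ c) = inI c by rewrite /g -[lshift _ c]/(unsplit (inl c)) unsplitK.
have gr c : g (rshift _ c) = inH c by rewrite /g -[rshift _ c]/(unsplit (inr c)) unsplitK.
have gi : injective g.
  move=> k l; rewrite -[k]splitK -[l]splitK.
  case: (split k) => c; case: (split l) => d; rewrite /= ?gl ?gr // => -[].
    by move/fi => ->.
  by move->.
have jdow p : count_mem p (join I H) = 2.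
  have cm n (h : 'I_n -> 'I_(nch I + nch H)) c s : injective h ->
      count_mem (h c) (map h s) = count_mem c s.
    by move=> hi; rewrite count_map; apply: eq_count => d; apply: inj_eq.
  rewrite -[p]splitK !count_cat; case: (split p) => c /=.
    have c0 s : count_mem (lshift (nch H) c) (map (@rshift (nch I) (nch H)) s) = 0.
      by apply/count_memPn/mapP => -[d _ /eqP]; rewrite eq_lrshift.
    by rewrite !c0 !cm ?add0n ?addn0 ?share_count //; apply: lshift_inj.
  have c0 s : count_mem (rshift (nch I) c) (map (@lshift (nch I) (nch H)) s) = 0.
    by apply/count_memPn/mapP => -[d _ /eqP]; rewrite eq_rlshift.
  by rewrite !c0 !cm ?add0n ?share_count //; apply: rshift_inj.
have Eg : map g (join I H) =
    map inI (st1 I) ++ map inH (st1 H) ++ map inI (st2 I) ++ map inH (st2 H).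
  by rewrite !map_cat -!map_comp; congr (_ ++ (_ ++ (_ ++ _))); apply: eq_map.
rewrite -Eg wval1 W_map // wsl2_W => [|p]; last by rewrite -has_pred1 has_count jdow.
by split=> //; apply: dow_map => //; apply/dowP => p _; apply: jdow.
Qed.

Local Open Scope ring_scope.

Theorem theorem3 (I1 I2 : share) (f : 'I_(nch I1) -> 'I_(nch I2)) :
  graph_iso f ->
  forall (H : share) (C : numClosedFieldType) (A : algType C) (x : 'I_3 -> A),
    sl2_triple x ->
    wsl2 x (join I1 H) = wsl2 x (join I2 H).
Proof.
move=> fi H C A x sx; have [fb _ _] := fi.
pose T := option ('I_(nch I2) + 'I_(nch H))%type.
pose inH (c : 'I_(nch H)) : T := Some (inr c).
have dH : dow (map inH (st1 H) ++ map inH (st2 H)).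
  by rewrite -map_cat; apply: dow_map (share_dow H) => ? ? [].
have [l Hl] := wval_subst sx (fun=> 1%N) dH.
(* The list [l] was obtained from [H] alone, so both joins expand with the same coefficients. *)
have closed (I : share) (h : 'I_(nch I) -> 'I_(nch I2)) : injective h ->
    wsl2 x (join I H) = \sum_(q <- l) q.1 *: (cas x ^+ q.2.1.1 *
      wval x (mset (fun=> 1%N) None q.2.2)
        (map (omap (@inl _ 'I_(nch H))) (map (omap h) (closure_word I))) * cas x ^+ q.2.1.2).
  move=> hi; have [-> d] := wsl2_join H x hi.
  (* Rotated to begin with strand 1 of [H], the join is the share [H] with [st2 I] and [st1 I] in
     its gaps; putting the chord [None] for [H] gives [closure_word]. *)
  rewrite wval_rot // -!catA (Hl None).
  - apply: eq_bigr => q _; congr GRing.scale; congr GRing.mul; congr GRing.mul.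
    by rewrite /closure_word /= !map_cat /= -!map_comp.
  - move=> p; rewrite -map_cat => /mapP[c _ ->]; rewrite mem_cat negb_or.
    by apply/andP; split; apply/mapP => -[].
  by rewrite mem_cat negb_or; apply/andP; split; apply/mapP => -[].
rewrite (closed I1 f (bij_inj fb)) (closed I2 id) //.
apply: eq_bigr => q _; congr GRing.scale; congr GRing.mul; congr GRing.mul.
have ii : injective (omap (@inl 'I_(nch I2) 'I_(nch H))) by move=> [?|] [?|] //= [->].
have -> : map (omap id) (closure_word I2) = closure_word I2.
  by rewrite -[RHS]map_id; apply: eq_map => -[].
apply: same_gr_wval => //; last exact: same_gr_map (same_gr_closure fi).
have [pe _] := same_gr_map ii (same_gr_closure fi).
by rewrite (dow_perm pe); apply: dow_map => //; apply: closure_dow.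
Qed.
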